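(* A persistence module $F$ is flat and cotorsion if and only if $$F \cong \prod_{\sigma,\ \mathbf{a} \in \mathbb{Z}\sigma^\perp} R_\sigma(-\mathbf{a})^{(\beta^\sigma_{\mathbf{a}})}$$ for some sets $\beta^\sigma_{\mathbf{a}}$, where $\sigma$ ranges over all faces of $\mathbb{N}^n$ and, for each $\sigma$, $\mathbf{a}$ ranges over $\mathbb{Z}\sigma^\perp$. The sets $\beta^\sigma_{\mathbf{a}}$ are uniquely determined (up to bijection) by $F$.
   Context: Fix $n \in \mathbb{N}$, a field $\mathbf{k}$, and the polynomial ring $R = \mathbf{k}[x_1,\dots,x_n]$, $\mathbb{Z}^n$-graded by $\deg x_i = \mathbf{e}_i$ (standard basis vector). A persistence module is a $\mathbb{Z}^n$-graded $R$-module $M=\bigoplus_{\mathbf a\in\mathbb Z^n} M_{\mathbf a}$; a morphism is a degree-preserving $R$-linear map, and $\operatorname{Nat}(M,N)$ is the set of morphisms. The shift is $M(\mathbf{a})_{\mathbf{d}} = M_{\mathbf{a}+\mathbf{d}}$. Products are taken degreewise: $\prod_i M_i = \bigoplus_{\mathbf{a}} \prod_i (M_i)_{\mathbf{a}}$. For a set $X$, $M^{(X)}$ denotes the direct sum of copies of $M$ indexed by $X$. The graded Hom is $\underline{\operatorname{Hom}}(M,N) = \bigoplus_{\mathbf{a}\in\mathbb{Z}^n} \operatorname{Nat}(M,N(\mathbf{a}))$, with right derived functors $\underline{\operatorname{Ext}}^i$. A persistence module $F$ is flat if $F\otimes_R -$ is exact on persistence modules; $M$ is cotorsion if $\underline{\operatorname{Ext}}^1(F,M)=0$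 for every flat persistence module $F$. A face $\sigma$ of $\mathbb{N}^n$ is a submonoid generated by a subset of $\{\mathbf{e}_1,\dots,\mathbf{e}_n\}$; $\sigma^\perp = \langle \mathbf{e}_i \mid \mathbf{e}_i\notin\sigma\rangle$ is the face generated by the complementary basis vectors, and $\mathbb{Z}\sigma^\perp$ is the subgroup of $\mathbb{Z}^n$ it generates. Let $\mathfrak{p}_\sigma = \langle x_i \mid \mathbf{e}_i\notin\sigma\rangle$, and let $R_\sigma$ be the homogeneous localization of $R$ at $\mathfrak{p}_\sigma$ (inverting the homogeneous elements of $R\setminus\mathfrak{p}_\sigma$, i.e. inverting the $x_i$ with $\mathbf{e}_i\in\sigma$). *)

(* Defs.v *)
From HB Require Import structures.
From mathcomp Require Import all_boot all_order all_algebra.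
From mathcomp Require Import boolp classical_sets functions cardinality.
From mathcomp Require Import freeg mpoly.

Set Implicit Arguments.
Unset Strict Implicit.
Unset Printing Implicit Defensive.

Import GRing.Theory.
Local Open Scope ring_scope.
Local Open Scope quotient_scope.

Section Grading.
Variables (n : nat) (k : fieldType).

Definition mdegZ (m : 'X_{1..n}) : 'rV[int]_n := \row_i (m i)%:Z.

Lemma mdegZD m1 m2 : mdegZ (m1 + m2)%MM = mdegZ m1 + mdegZ m2.
Proof. by apply/rowP => i; rewrite !mxE mnmDE PoszD. Qed.

Lemma mdegZ_inj : injective mdegZ.
Proof.
move=> m1 m2 /rowP e; apply/mnmP => i; move: (e i); rewrite !mxE.
by move/eqP; rewrite eqz_nat => /eqP.
Qed.

(* The degree-d part of R = k[x_1,..,x_n]; it is 0 when d is not in N^n. *)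
Definition Rdeg (d : 'rV[int]_n) (p : {mpoly k[n]}) : Prop :=
  forall m, m \in msupp p -> mdegZ m = d.

Definition Rhomogeneous (p : {mpoly k[n]}) : Prop := exists d, Rdeg d p.

Lemma RdegD d p q : Rdeg d p -> Rdeg d q -> Rdeg d (p + q).
Proof. by move=> hp hq m /msuppD_le; rewrite mem_cat => /orP[/hp|/hq]. Qed.

Lemma Rdeg0 d : Rdeg d 0.
Proof. by move=> m; rewrite msupp0. Qed.

Lemma RdegM d e p q : Rdeg d p -> Rdeg e q -> Rdeg (d + e) (p * q).
Proof.
move=> hp hq m /msuppM_le /allpairsP[[m1 m2] /= [/hp <- /hq <- ->]].
by rewrite mdegZD.
Qed.

Lemma RdegZX c m : Rdeg (mdegZ m) (c *: 'X_[m] : {mpoly k[n]}).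
Proof. by move=> m' /msuppZ_le; rewrite msuppX inE => /eqP ->. Qed.

Lemma Rhomogeneous_ZX p : Rhomogeneous p -> p != 0 ->
  exists c m, c != 0 /\ p = c *: 'X_[m].
Proof.
case=> d hp p0; have lp := mlead_supp p0.
exists (p@_(mlead p)), (mlead p); split; first by rewrite -mcoeff_msupp.
apply/mpolyP => m; rewrite mcoeffZ mcoeffX.
have [<-|ne] := eqVneq; first by rewrite mulr1.
rewrite mulr0; apply: memN_msupp_eq0; apply/negP => /hp e.
by move/eqP: ne; apply; apply: mdegZ_inj; rewrite e (hp _ lp).
Qed.

End Grading.

(* Z^n-graded modules over R = k[x_1,..,x_n], with internal grading: pm_comp a
   is the component M_a, and pm_spanP, pm_freeP say that M is the direct sum of
   the M_a. By pm_compZ with d = 0 each M_a is a k-subspace. *)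
Record pmod (n : nat) (k : fieldType) := PMod {
  pm_sort :> lmodType {mpoly k[n]};
  pm_comp : 'rV[int]_n -> pm_sort -> Prop;
  pm_comp0 : forall a, pm_comp a 0;
  pm_compB : forall a u v, pm_comp a u -> pm_comp a v -> pm_comp a (u - v);
  pm_compZ : forall d a r u, Rdeg d r -> pm_comp a u -> pm_comp (d + a) (r *: u);
  pm_spanP : forall u, exists s (c : 'rV[int]_n -> pm_sort),
    [/\ uniq s, forall a, pm_comp a (c a) & u = \sum_(a <- s) c a];
  pm_freeP : forall s (c : 'rV[int]_n -> pm_sort),
    uniq s -> (forall a, pm_comp a (c a)) -> \sum_(a <- s) c a = 0 ->
    forall a, a \in s -> c a = 0 }.

Arguments pm_comp {n k} _ _ _.

Record pmor n k (M N : pmod n k) := PMor {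
  pmor_fun :> {linear M -> N};
  pmor_deg : forall a u, pm_comp M a u -> pm_comp N a (pmor_fun u) }.

Definition pm_iso n k (M N : pmod n k) : Prop :=
  exists (f : pmor M N) (g : pmor N M), cancel f g /\ cancel g f.

Section PModTheory.
Variables (n : nat) (k : fieldType).
Local Notation deg := 'rV[int]_n.
Local Notation R := {mpoly k[n]}.
Implicit Types M : pmod n k.

Lemma pm_compD M a u v : pm_comp M a u -> pm_comp M a v -> pm_comp M a (u + v).
Proof.
move=> hu hv; rewrite -[v]opprK; apply: pm_compB => //.
by rewrite -sub0r; apply: pm_compB => //; exact: pm_comp0.
Qed.

(* u lies in the sum of the components M_a, a in s *)
Definition in_degs M (s : seq deg) (u : M) : Prop :=
  exists c : deg -> M, (forall a, pm_comp M a (c a)) /\ u = \sum_(a <- s) c a.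

Lemma sum_widen (V : zmodType) (s t : seq deg) (c : deg -> V) :
  uniq s -> uniq t -> {subset s <= t} ->
  \sum_(a <- s) c a = \sum_(a <- t) (if a \in s then c a else 0).
Proof.
move=> us ut st; rewrite -big_mkcond /= -[RHS]big_filter; apply: perm_big.
apply: uniq_perm => //; first exact: filter_uniq.
by move=> a; rewrite mem_filter; have [/st ->|] := boolP (a \in s).
Qed.

Lemma pm_uniq M s t (c e : deg -> M) :
  uniq s -> uniq t -> (forall a, pm_comp M a (c a)) ->
  (forall a, pm_comp M a (e a)) ->
  \sum_(a <- s) c a = \sum_(a <- t) e a ->
  forall a, (if a \in s then c a else 0) = (if a \in t then e a else 0).
Proof.
move=> us ut hc he est a; set r := undup (s ++ t).
have ur : uniq r by exact: undup_uniq.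
have sr : {subset s <= r} by move=> b bs; rewrite mem_undup mem_cat bs.
have tr : {subset t <= r} by move=> b bs; rewrite mem_undup mem_cat bs orbT.
move: est; rewrite (sum_widen _ us ur sr) (sum_widen _ ut ur tr).
move/eqP; rewrite -subr_eq0 -sumrB => /eqP est.
have [ar|] := boolP (a \in r); last first.
  by rewrite mem_undup mem_cat negb_or => /andP[/negbTE -> /negbTE ->].
apply/eqP; rewrite -subr_eq0; apply/eqP.
apply: (pm_freeP ur _ est ar) => b.
by apply: pm_compB; case: ifP => // _; exact: pm_comp0.
Qed.

Lemma hcomp_ex M (u : M) : exists e : deg -> M,
  (forall a, pm_comp M a (e a)) /\
  forall s c, uniq s -> (forall a, pm_comp M a (c a)) ->
    u = \sum_(a <- s) c a -> forall a, e a = if a \in s then c a else 0.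
Proof.
have [t [e [ut he ue]]] := pm_spanP u.
exists (fun a => if a \in t then e a else 0); split.
  by move=> a; case: ifP => // _; exact: pm_comp0.
by move=> s c us hc uc a; apply: pm_uniq => //; rewrite -ue -uc.
Qed.

Definition hcomp M (u : M) : deg -> M := sval (cid (hcomp_ex u)).

Lemma hcompP M (u : M) a : pm_comp M a (hcomp u a).
Proof. by rewrite /hcomp; case: cid => e []. Qed.

Lemma hcompE M (u : M) s c : uniq s -> (forall a, pm_comp M a (c a)) ->
  u = \sum_(a <- s) c a -> forall a, hcomp u a = if a \in s then c a else 0.
Proof. by rewrite /hcomp; case: cid => e [] /= _; exact. Qed.

Lemma hcomp_sum M (u : M) s : uniq s -> in_degs s u ->
  u = \sum_(a <- s) hcomp u a.
Proof.
move=> us [c [hc uc]]; rewrite {1}uc; apply: eq_big_seq => a sa.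
by rewrite (hcompE us hc uc) sa.
Qed.

Lemma hcomp0 M a : hcomp (0 : M) a = 0.
Proof.
by rewrite (@hcompE _ _ [::] (fun=> 0)) ?big_nil // => b; exact: pm_comp0.
Qed.

Lemma in_degs_sub M s t (u : M) :
  uniq s -> uniq t -> {subset s <= t} -> in_degs s u -> in_degs t u.
Proof.
move=> us ut st [c [hc ->]].
exists (fun a => if a \in s then c a else 0); split; last exact: sum_widen.
by move=> a; case: ifP => // _; exact: pm_comp0.
Qed.

Lemma in_degs0 M s : in_degs s (0 : M).
Proof.
by exists (fun=> 0); split; [move=> a; exact: pm_comp0|rewrite big1].
Qed.

Lemma in_degsD M s (u v : M) : in_degs s u -> in_degs s v -> in_degs s (u + v).
Proof.
move=> [c [hc ->]] [e [he ->]]; exists (fun a => c a + e a).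
by split; [move=> a; exact: pm_compD|rewrite big_split].
Qed.

Lemma in_degs1 M a (u : M) : pm_comp M a u -> in_degs [:: a] u.
Proof.
move=> hu; exists (fun b => if b == a then u else 0); split.
  by move=> b; case: eqP => [->|_] //; exact: pm_comp0.
by rewrite big_seq1 eqxx.
Qed.

Lemma in_degs_sum M (I : Type) (r : seq I) s (F : I -> M) :
  (forall i, in_degs s (F i)) -> in_degs s (\sum_(i <- r) F i).
Proof.
by move=> hF; apply: big_rec => [|i x _]; [exact: in_degs0|exact: in_degsD].
Qed.

Definition zdegs (r : R) (s : seq deg) : seq deg :=
  undup [seq mdegZ m + a | m <- msupp r, a <- s].

Lemma in_degsZ M s r (u : M) : in_degs s u -> in_degs (zdegs r s) (r *: u).
Proof.
move=> [c [hc ->]]; rewrite {2}[r]mpolyE scaler_suml.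
rewrite big_seq; apply: big_rec => [|m x hm hx]; first exact: in_degs0.
apply: in_degsD hx; rewrite scaler_sumr big_seq.
apply: big_rec => [|a y ha hy]; first exact: in_degs0.
apply: in_degsD hy; apply: (@in_degs_sub _ [:: mdegZ m + a]) => //.
- exact: undup_uniq.
- move=> b; rewrite inE => /eqP ->; rewrite mem_undup.
  by apply/allpairsP; exists (m, a).
by apply/in_degs1/pm_compZ => //; exact: RdegZX.
Qed.

End PModTheory.

Section Shift.
Variables (n : nat) (k : fieldType) (M : pmod n k) (a : 'rV[int]_n).

Let comp d (u : M) := pm_comp M (a + d) u.

Let compZ d b r u : Rdeg d r -> comp b u -> comp (d + b) (r *: u).
Proof. by rewrite /comp addrCA; exact: pm_compZ. Qed.

Let spanP u : exists s (c : 'rV[int]_n -> M),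
  [/\ uniq s, forall d, comp d (c d) & u = \sum_(d <- s) c d].
Proof.
have [s [c [us hc ->]]] := pm_spanP u.
exists [seq b - a | b <- s], (fun d => c (a + d)); split.
- by rewrite map_inj_uniq //; exact: addIr.
- by move=> d; exact: hc.
by rewrite big_map; apply: eq_bigr => b _; rewrite addrC subrK.
Qed.

Let freeP s (c : 'rV[int]_n -> M) : uniq s -> (forall d, comp d (c d)) ->
  \sum_(d <- s) c d = 0 -> forall d, d \in s -> c d = 0.
Proof.
move=> us hc sc d ds.
have := @pm_freeP _ _ M [seq a + b | b <- s] (fun b => c (b - a)) _ _ _ (a + d).
rewrite addrAC subrr add0r; apply; rewrite ?map_f //.
- by rewrite map_inj_uniq //; exact: addrI.
- by move=> b; move: (hc (b - a)); rewrite /comp addrC subrK.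
rewrite big_map -[RHS]sc; apply: eq_bigr => b _.
by rewrite addrAC subrr add0r.
Qed.

(* M(a)_d = M_(a + d) *)
Definition shift : pmod n k :=
  @PMod n k (pm_sort M) comp (fun d => pm_comp0 M (a + d))
    (fun d => @pm_compB _ _ M (a + d)) compZ spanP freeP.

End Shift.

Section DepProd.
Variables (R : pzRingType) (I : Type) (M : I -> lmodType R).

Definition dprod : Type := forall i, M i.
HB.instance Definition _ := gen_eqMixin dprod.
HB.instance Definition _ := gen_choiceMixin dprod.

Let dadd (u v : dprod) : dprod := fun i => u i + v i.
Let dopp (u : dprod) : dprod := fun i => - u i.
Let dzero : dprod := fun i => 0.
Let dscale (r : R) (u : dprod) : dprod := fun i => r *: u i.

Let daddA : associative dadd.
Proof. by move=> u v w; apply: functional_extensionality_dep => i; exact: addrA. Qed.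
Let daddC : commutative dadd.
Proof. by move=> u v; apply: functional_extensionality_dep => i; exact: addrC. Qed.
Let dadd0 : left_id dzero dadd.
Proof. by move=> u; apply: functional_extensionality_dep => i; exact: add0r. Qed.
Let daddN : left_inverse dzero dopp dadd.
Proof. by move=> u; apply: functional_extensionality_dep => i; exact: addNr. Qed.
HB.instance Definition _ :=
  GRing.isZmodule.Build dprod daddA daddC dadd0 daddN.

Let dscaleA r s u : dscale r (dscale s u) = dscale (r * s) u.
Proof. by apply: functional_extensionality_dep => i; exact: scalerA. Qed.
Let dscale1 : left_id 1 dscale.
Proof. by move=> u; apply: functional_extensionality_dep => i; exact: scale1r. Qed.
Let dscaleDr : right_distributive dscale +%R.
Proof. by move=> r u v; apply: functional_extensionality_dep => i; exact: scalerDr. Qed.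
Let dscaleDl u : {morph dscale^~ u : r s / r + s}.
Proof. by move=> r s; apply: functional_extensionality_dep => i; exact: scalerDl. Qed.
HB.instance Definition _ := GRing.Zmodule_isLmodule.Build R dprod
  dscaleA dscale1 dscaleDr dscaleDl.

Lemma dprodP (u v : dprod) : (forall i, u i = v i) -> u = v.
Proof. exact: functional_extensionality_dep. Qed.

Lemma dprod_sumE J (s : seq J) (F : J -> dprod) i :
  (\sum_(j <- s) F j) i = \sum_(j <- s) F j i.
Proof. by elim/big_rec2: _ => // j x y _ <-. Qed.

End DepProd.

Section Products.
Variables (n : nat) (k : fieldType) (I : Type) (M : I -> pmod n k).
Local Notation deg := 'rV[int]_n.
Local Notation R := {mpoly k[n]}.
Local Notation D := (dprod (fun i => pm_sort (M i))).

(* The elements of the product of the underlying modules that are finite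
   sums of homogeneous ones: they form (+)_a prod_i (M_i)_a. *)
Definition bounded : {pred D} := fun u =>
  `[< exists s, uniq s /\ forall i, in_degs s (u i) >].

Lemma in_degs_comb s t (r : R) (u v : D) :
  uniq s -> uniq t -> (forall i, in_degs s (u i)) -> (forall i, in_degs t (v i)) ->
  forall i, in_degs (undup (zdegs r s ++ t)) ((r *: u + v) i).
Proof.
move=> us ut hu hv i; apply: in_degsD.
  apply: (@in_degs_sub _ _ _ (zdegs r s)); rewrite ?undup_uniq //.
    by move=> a ha; rewrite mem_undup mem_cat ha.
  exact: in_degsZ.
apply: in_degs_sub (hv i); rewrite ?undup_uniq //.
by move=> a ha; rewrite mem_undup mem_cat ha orbT.
Qed.

Lemma bounded_submod : submod_closed bounded.
Proof.
split.
  by apply/asboolP; exists [::]; split=> // i; exact: in_degs0.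
move=> r u v /asboolP[s [us hu]] /asboolP[t [ut hv]]; apply/asboolP.
exists (undup (zdegs r s ++ t)); split=> [|i]; first exact: undup_uniq.
exact: in_degs_comb.
Qed.

HB.instance Definition _ := GRing.isSubmodClosed.Build R D bounded bounded_submod.

Record gprod := GProd { gprod_val : D; _ : gprod_val \in bounded }.
HB.instance Definition _ := [isSub for gprod_val].
HB.instance Definition _ := [Choice of gprod by <:].
HB.instance Definition _ := [SubChoice_isSubLmodule of gprod by <:].

Definition finsupp : {pred D} := fun u => `[< finite_set [set i | u i != 0] >].

Lemma finsupp_submod : submod_closed finsupp.
Proof.
split.
  apply/asboolP; apply: sub_finite_set (finite_set0 I) => i /=.
  by rewrite eqxx.
move=> r u v /asboolP hu /asboolP hv; apply/asboolP.
have h : finite_set ([set i | u i != 0] `|` [set i | v i != 0]).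
  by rewrite finite_setU.
apply: (sub_finite_set _ h) => i /=.
have [ui|] := eqVneq (u i) 0; last by left.
have [vi|] := eqVneq (v i) 0; last by right.
have -> : (r *: u + v) i = r *: u i + v i by [].
by rewrite ui vi scaler0 addr0 eqxx.
Qed.

HB.instance Definition _ := GRing.isSubmodClosed.Build R D finsupp finsupp_submod.

Record gsum := GSum { gsum_val : D; _ : gsum_val \in finsupp }.
HB.instance Definition _ := [isSub for gsum_val].
HB.instance Definition _ := [Choice of gsum by <:].
HB.instance Definition _ := [SubChoice_isSubLmodule of gsum by <:].


Let pcomp a (u : gprod) := forall i, pm_comp (M i) a (gprod_val u i).

Let pcomp0 a : pcomp a 0.
Proof. by move=> i; exact: pm_comp0. Qed.

Let pcompB a u v : pcomp a u -> pcomp a v -> pcomp a (u - v).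
Proof. by move=> hu hv i; apply: pm_compB; [exact: hu|exact: hv]. Qed.

Let pcompZ d a r u : Rdeg d r -> pcomp a u -> pcomp (d + a) (r *: u).
Proof. by move=> hr hu i; apply: pm_compZ => //; exact: hu. Qed.

Lemma gprod_sumE J (s : seq J) (F : J -> gprod) i :
  gprod_val (\sum_(j <- s) F j : gprod) i = \sum_(j <- s) gprod_val (F j) i.
Proof. by elim/big_rec2: _ => // j x y _ <-. Qed.

Let pspanP u : exists s (c : deg -> gprod),
  [/\ uniq s, forall a, pcomp a (c a) & u = \sum_(a <- s) c a].
Proof.
have /asboolP[s [us hu]] := valP u.
have bc a : (fun i => hcomp (gprod_val u i) a : M i) \in bounded.
  apply/asboolP; exists [:: a]; split=> // i; exact/in_degs1/hcompP.
exists s, (fun a => GProd (bc a)); split=> // [a i|]; first exact: hcompP.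
apply/val_inj/dprodP => i; rewrite [RHS]gprod_sumE /=.
by apply: hcomp_sum => //; exact: hu.
Qed.

Let pfreeP s (c : deg -> gprod) : uniq s -> (forall a, pcomp a (c a)) ->
  \sum_(a <- s) c a = 0 -> forall a, a \in s -> c a = 0.
Proof.
move=> us hc sc a sa; apply/val_inj/dprodP => i.
apply: (@pm_freeP _ _ (M i) s (fun b => gprod_val (c b) i)) => //.
  by move=> b; exact: hc.
by rewrite -gprod_sumE sc.
Qed.

Definition pprod : pmod n k :=
  @PMod n k gprod pcomp pcomp0 pcompB pcompZ pspanP pfreeP.

Let scomp a (u : gsum) := forall i, pm_comp (M i) a (gsum_val u i).

Let scomp0 a : scomp a 0.
Proof. by move=> i; exact: pm_comp0. Qed.

Let scompB a u v : scomp a u -> scomp a v -> scomp a (u - v).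
Proof. by move=> hu hv i; apply: pm_compB; [exact: hu|exact: hv]. Qed.

Let scompZ d a r u : Rdeg d r -> scomp a u -> scomp (d + a) (r *: u).
Proof. by move=> hr hu i; apply: pm_compZ => //; exact: hu. Qed.

Lemma gsum_sumE J (s : seq J) (F : J -> gsum) i :
  gsum_val (\sum_(j <- s) F j : gsum) i = \sum_(j <- s) gsum_val (F j) i.
Proof. by elim/big_rec2: _ => // j x y _ <-. Qed.

Let sspanP u : exists s (c : deg -> gsum),
  [/\ uniq s, forall a, scomp a (c a) & u = \sum_(a <- s) c a].
Proof.
have /asboolP fu := valP u.
have bc a : (fun i => hcomp (gsum_val u i) a : M i) \in finsupp.
  apply/asboolP; apply: (sub_finite_set _ fu) => i /=.
  by apply: contraNN => /eqP ->; rewrite hcomp0.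
have /choice[t ht] i : exists t, uniq t /\ in_degs t (gsum_val u i).
  by have [t [c [ut hc e]]] := pm_spanP (gsum_val u i); exists t; split=> //; exists c.
have /(@finite_seqP {classic I})[l el] := fu.
exists (undup (flatten [seq t i | i <- l])), (fun a => GSum (bc a)).
split=> [|a i|]; [exact: undup_uniq|exact: hcompP|].
apply/val_inj/dprodP => i; rewrite [RHS]gsum_sumE /=.
apply: hcomp_sum; first exact: undup_uniq.
have [->|ui] := eqVneq (gsum_val u i) 0; first exact: in_degs0.
have [ut hi] := ht i; apply: in_degs_sub hi => //; first exact: undup_uniq.
move=> a ha; rewrite mem_undup; apply/(@flatten_mapP {classic I} _ t); exists i => //.
by have : ([set` l] i)%classic by rewrite -el.
Qed.

Let sfreeP s (c : deg -> gsum) : uniq s -> (forall a, scomp a (c a)) ->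
  \sum_(a <- s) c a = 0 -> forall a, a \in s -> c a = 0.
Proof.
move=> us hc sc a sa; apply/val_inj/dprodP => i.
apply: (@pm_freeP _ _ (M i) s (fun b => gsum_val (c b) i)) => //.
  by move=> b; exact: hc.
by rewrite -gsum_sumE sc.
Qed.

Definition pdsum : pmod n k :=
  @PMod n k gsum scomp scomp0 scompB scompZ sspanP sfreeP.

End Products.

(* M^(X) *)
Definition pcopies n k (X : Type) (M : pmod n k) : pmod n k :=
  pdsum (fun _ : X => M).

Definition frac_mod (n : nat) (k : fieldType) : Type := {fraction {mpoly k[n]}}.

Section FracMod.
Variables (n : nat) (k : fieldType).
Local Notation R := {mpoly k[n]}.

HB.instance Definition _ := GRing.Field.on (frac_mod n k).

Let fscale (r : R) (x : frac_mod n k) : frac_mod n k :=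
  (FracField.tofrac r : {fraction R}) * x.

Let fscaleA r s u : fscale r (fscale s u) = fscale (r * s) u.
Proof. by rewrite /fscale mulrA rmorphM. Qed.
Let fscale1 : left_id 1 fscale.
Proof. by move=> u; rewrite /fscale rmorph1 mul1r. Qed.
Let fscaleDr : right_distributive fscale +%R.
Proof. by move=> r u v; rewrite /fscale mulrDr. Qed.
Let fscaleDl u : {morph fscale^~ u : r s / r + s}.
Proof. by move=> r s; rewrite /fscale rmorphD mulrDl. Qed.
HB.instance Definition _ := GRing.Zmodule_isLmodule.Build R (frac_mod n k)
  fscaleA fscale1 fscaleDr fscaleDl.

Lemma frac_scaleE (r : R) (x : frac_mod n k) : r *: x = (FracField.tofrac r : {fraction R}) * x.
Proof. by []. Qed.

End FracMod.
Section Localization.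
Variables (n : nat) (k : fieldType) (sigma : {set 'I_n}).
Local Notation deg := 'rV[int]_n.
Local Notation R := {mpoly k[n]}.
Local Notation FR := (frac_mod n k).
Local Notation "x %:F" := (FracField.tofrac x : FR).

(* A face of N^n is encoded by the set sigma of the i such that e_i belongs to
   it; distinct sets generate distinct submonoids. pface is p_sigma. *)
Definition pface (p : R) : Prop :=
  exists q : 'I_n -> R, p = \sum_(i | i \notin sigma) q i * 'X_i.

Definition loc_comp (d : deg) (x : FR) : Prop :=
  exists r s a b, [/\ Rdeg a r, Rdeg b s, ~ pface s, d = a - b & x = r%:F / s%:F].

(* R_sigma, realized inside Frac(R). *)
Definition in_loc : {pred FR} := fun x =>
  `[< exists r s, [/\ Rhomogeneous s, ~ pface s & x = r%:F / s%:F] >].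

Definition face_mnm (m : 'X_{1..n}) : Prop := forall i, i \notin sigma -> m i = 0%N.

Lemma pfaceX m : face_mnm m -> ~ pface ('X_[m]).
Proof.
move=> hm [q /(congr1 (mcoeff m))]; rewrite mcoeffX eqxx raddf_sum /=.
rewrite big1 => [/eqP|i hi]; first by rewrite oner_eq0.
apply: memN_msupp_eq0; rewrite (perm_mem (msuppMX _ _)).
apply/negP => /mapP[m' _ e]; move: (hm i hi).
by rewrite e mnmDE mnm1E eqxx.
Qed.

Lemma pface_monomial s : Rhomogeneous s -> ~ pface s ->
  exists c m, [/\ c != 0, face_mnm m & s = c *: 'X_[m]].
Proof.
move=> hs ps; have s0 : s != 0.
  apply/eqP => s0; apply: ps; exists (fun=> 0).
  by rewrite s0 big1 // => i _; rewrite mul0r.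
have [c [m [c0 e]]] := Rhomogeneous_ZX hs s0.
exists c, m; split=> // i hi; apply/eqP; apply: contra_notT ps => mi.
exists (fun j => if j == i then c *: 'X_[m - U_(i)] else 0).
rewrite (bigD1 i) //= big1 ?eqxx => [|j /andP[_ /negbTE ->]]; last by rewrite mul0r.
rewrite addr0 e -scalerAl -mpolyXD submK //.
apply/mnm_lepP => j; rewrite mnm1E; have [<-|] := eqVneq i j => //=.
by rewrite lt0n.
Qed.

Lemma tofrac_mnm_neq0 m : ('X_[k, m] : R)%:F != 0.
Proof. by rewrite tofrac_eq0; apply/eqP => /(congr1 (mcoeff m)) /eqP; rewrite mcoeffX eqxx mcoeff0 oner_eq0. Qed.

Lemma frac_monomial (c : k) m (r : R) : c != 0 ->
  r%:F / (c *: 'X_[m] : R)%:F = (c^-1 *: r)%:F / ('X_[m] : R)%:F.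
Proof.
move=> c0; apply/eqP; rewrite eqr_div ?tofrac_mnm_neq0 //; last first.
  rewrite tofrac_eq0 scaler_eq0 negb_or c0 /= -tofrac_eq0.
  exact: tofrac_mnm_neq0.
rewrite -!rmorphM /= tofrac_eq -scalerAr -scalerAl.
by rewrite scalerA mulfV // scale1r.
Qed.

Lemma Rhomogeneous_X m : Rhomogeneous ('X_[k, m] : R).
Proof. by exists (mdegZ m); rewrite -['X_[m]]scale1r; exact: RdegZX. Qed.

Lemma in_locP x : reflect
  (exists p m, face_mnm m /\ x = p%:F / ('X_[k, m] : R)%:F) (x \in in_loc).
Proof.
apply: (iffP (asboolP _)) => [[r [s [hs ps ->]]]|[p [m [hm ->]]]].
  have [c [m [c0 hm ->]]] := pface_monomial hs ps.
  by exists (c^-1 *: r), m; rewrite frac_monomial.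
by exists p, 'X_[m]; split=> //; [exact: Rhomogeneous_X|exact: pfaceX].
Qed.

Lemma face_mnmD m1 m2 : face_mnm m1 -> face_mnm m2 -> face_mnm (m1 + m2)%MM.
Proof. by move=> h1 h2 i hi; rewrite mnmDE h1 // h2. Qed.

Lemma RdegZ d (c : k) p : Rdeg d p -> Rdeg d (c *: p : R).
Proof. by move=> hp m /msuppZ_le; exact: hp. Qed.

Lemma loc_compP d x : loc_comp d x <->
  exists p m, [/\ face_mnm m, Rdeg (d + mdegZ m) p
                & x = p%:F / ('X_[k, m] : R)%:F].
Proof.
split=> [[r [s [a [b [hr hs ps -> ->]]]]]|[p [m [hm hp ->]]]].
  have hs' : Rhomogeneous s by exists b.
  have [c [m [c0 hm e]]] := pface_monomial hs' ps.
  have -> : b = mdegZ m.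
    rewrite -(hs m) // e mcoeff_msupp mcoeffZ mcoeffX eqxx mulr1 //.
  exists (c^-1 *: r), m; split=> //; last by rewrite e frac_monomial.
  by rewrite subrK; exact: RdegZ.
exists p, 'X_[m], (d + mdegZ m), (mdegZ m); split=> //.
- by rewrite -['X_[m]]scale1r; exact: RdegZX.
- exact: pfaceX.
by rewrite addrK.
Qed.

Lemma in_loc_submod : submod_closed in_loc.
Proof.
split.
  by apply/in_locP; exists 0, 0%MM; split=> [i _|]; rewrite ?mnm0E // rmorph0 mul0r.
move=> r x y /in_locP[p [m [hm ->]]] /in_locP[q [m' [hm' ->]]].
apply/in_locP; exists (r * p * 'X_[m'] + q * 'X_[m]), (m + m')%MM.
split; first exact: face_mnmD.
rewrite frac_scaleE mulrA addf_div ?tofrac_mnm_neq0 //.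
by rewrite mpolyXD !rmorphD !rmorphM.
Qed.

HB.instance Definition _ := GRing.isSubmodClosed.Build R FR in_loc in_loc_submod.

Record loc := Loc { loc_val : FR; _ : loc_val \in in_loc }.
HB.instance Definition _ := [isSub for loc_val].
HB.instance Definition _ := [Choice of loc by <:].
HB.instance Definition _ := [SubChoice_isSubLmodule of loc by <:].

Let comp d (x : loc) := loc_comp d (loc_val x).

Lemma loc_comp0 d : loc_comp d 0.
Proof.
apply/loc_compP; exists 0, 0%MM; split; last by rewrite rmorph0 mul0r.
- by move=> i _; rewrite mnm0E.
- exact: Rdeg0.
Qed.

Lemma loc_compZD d e r x y : Rdeg d r -> loc_comp e x -> loc_comp (d + e) y ->
  loc_comp (d + e) (r *: x + y).
Proof.
move=> hr /loc_compP[p [m [hm hp ->]]] /loc_compP[q [m' [hm' hq ->]]].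
apply/loc_compP; exists (r * p * 'X_[m'] + q * 'X_[m]), (m + m')%MM.
have hX j : Rdeg (mdegZ j) ('X_[j] : R).
  by rewrite -['X_[j]]scale1r; exact: RdegZX.
split; first exact: face_mnmD.
  rewrite mdegZD; apply: RdegD.
    by rewrite !addrA -(addrA d); apply: RdegM => //; exact: RdegM.
  by rewrite [mdegZ m + _]addrC addrA; exact: RdegM.
rewrite frac_scaleE mulrA addf_div ?tofrac_mnm_neq0 //.
by rewrite mpolyXD !rmorphD !rmorphM.
Qed.

Let comp0 d : comp d 0. Proof. exact: loc_comp0. Qed.

Let Rdeg_const (c : k) : Rdeg 0 (c%:MP : R).
Proof.
have -> : 0 = mdegZ (0%MM : 'X_{1..n}) by apply/rowP => i; rewrite !mxE mnm0E.
have -> : c%:MP = c *: 'X_[0] :> R by rewrite mpolyX0 -mul_mpolyC mulr1.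
exact: RdegZX.
Qed.

Let compB d x y : comp d x -> comp d y -> comp d (x - y).
Proof.
move=> hx hy; rewrite /comp addrC.
have -> : loc_val (- y + x) = (-1)%:MP_[n] *: loc_val y + loc_val x.
  by rewrite mpolyCN mpolyC1 scaleN1r.
rewrite -[d]add0r; apply: loc_compZD => //; last by rewrite add0r.
Qed.

Let compZ d a r x : Rdeg d r -> comp a x -> comp (d + a) (r *: x).
Proof.
move=> hr hx; rewrite /comp.
have -> : loc_val (r *: x) = r *: loc_val x + 0 by rewrite addr0.
by apply: loc_compZD => //; exact: loc_comp0.
Qed.

Lemma loc_comp_in d x : loc_comp d x -> x \in in_loc.
Proof. by move=> /loc_compP[p [m [hm _ ->]]]; apply/in_locP; exists p, m. Qed.

Lemma loc_sumE J (s : seq J) (F : J -> loc) :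
  loc_val (\sum_(j <- s) F j : loc) = \sum_(j <- s) loc_val (F j).
Proof. by elim/big_rec2: _ => // j x y _ <-. Qed.

Let spanP x : exists s (c : deg -> loc),
  [/\ uniq s, forall d, comp d (c d) & x = \sum_(d <- s) c d].
Proof.
have /in_locP[p [m [hm e]]] := valP x.
pose q d : R := \sum_(v <- msupp p | mdegZ v - mdegZ m == d) p@_v *: 'X_[v].
have hq d : loc_comp d ((q d)%:F / ('X_[k, m] : R)%:F).
  apply/loc_compP; exists (q d), m; split=> //.
  rewrite /q; apply: big_rec => [|v y /eqP <- hy]; first exact: Rdeg0.
  by apply: RdegD => //; rewrite subrK; exact: RdegZX.
exists [seq mdegZ v - mdegZ m | v <- msupp p], (fun d => Loc (loc_comp_in (hq d))).
split=> //.
  by rewrite map_inj_uniq ?msupp_uniq // => u v /addIr /mdegZ_inj.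
apply: val_inj; rewrite [RHS]loc_sumE /= big_map -mulr_suml -rmorph_sum.
rewrite e; congr (FracField.tofrac _ / _); rewrite [LHS]mpolyE big_seq [RHS]big_seq.
apply: eq_bigr => v hv; rewrite /q big_mkcond (bigD1_seq v) ?msupp_uniq //= eqxx.
rewrite big1 ?addr0 // => u uv; case: eqP => // /addIr /mdegZ_inj e'.
by rewrite e' eqxx in uv.
Qed.

Let freeP s (c : deg -> loc) : uniq s -> (forall d, comp d (c d)) ->
  \sum_(d <- s) c d = 0 -> forall d, d \in s -> c d = 0.
Proof.
move=> us hc sc d ds.
have /choice[f hf] b : exists pm : R * 'X_{1..n},
    Rdeg (b + mdegZ pm.2) pm.1 /\ loc_val (c b) = pm.1%:F / ('X_[k, pm.2] : R)%:F.
  by have /loc_compP[p [m [hm hp e]]] := hc b; exists (p, m).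
pose M := (\sum_(d <- s) (f d).2)%MM.
have leM b : b \in s -> ((f b).2 <= M)%MM.
  move=> hd; apply/mnm_lepP => i; rewrite mnm_sumE (bigD1_seq b) //=.
  exact: leq_addr.
pose q d : R := (f d).1 * 'X_[M - (f d).2].
have hq b : b \in s -> Rdeg (b + mdegZ M) (q b).
  move=> hd; have [h _] := hf b.
  rewrite -(submK (leM b hd)) mdegZD [mdegZ _ + _]addrC addrA.
  apply: RdegM => //; rewrite -['X_[_]]scale1r; exact: RdegZX.
have eq b : b \in s -> loc_val (c b) = (q b)%:F / ('X_[k, M] : R)%:F.
  move=> hd; have [_ ->] := hf b; apply/eqP.
  rewrite eqr_div ?tofrac_mnm_neq0 // -!rmorphM /= tofrac_eq /q -mulrA -mpolyXD.
  by rewrite submK // leM.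
have q0 : \sum_(d <- s) q d = 0.
  apply/eqP; rewrite -tofrac_eq0 rmorph_sum /=.
  have /eqP := congr1 loc_val sc; rewrite loc_sumE (eq_big_seq _ eq) -mulr_suml.
  by rewrite mulf_eq0 invr_eq0 (negbTE (tofrac_mnm_neq0 _)) orbF.
apply: val_inj; rewrite /= eq // (_ : q d = 0) ?rmorph0 ?mul0r //.
apply/mpolyP => m; rewrite mcoeff0; apply/eqP; rewrite mcoeff_eq0; apply/negP => hm.
have /(congr1 (mcoeff m)) := q0; rewrite raddf_sum mcoeff0 (bigD1_seq d) //=.
rewrite big_seq_cond big1 ?addr0; first by apply/eqP; rewrite -mcoeff_msupp.
move=> b /andP[bs bd]; apply: memN_msupp_eq0; apply/negP => /(hq b bs).
by rewrite (hq d ds m hm) => /addIr /eqP; rewrite eq_sym (negbTE bd).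
Qed.

Definition Rloc : pmod n k := @PMod n k loc comp comp0 compB compZ spanP freeP.

End Localization.

Section Tensor.
Variables (R : comNzRingType) (A B : lmodType R).
Local Notation free := {freeg (A * B) / R}.
Local Notation "a ** b" := (<< (a, b) >> : free) (at level 40).

Variant tens_gen : free -> Prop :=
| TensDl a a' b : tens_gen ((a + a') ** b - (a ** b + a' ** b))
| TensDr a b b' : tens_gen (a ** (b + b') - (a ** b + a ** b'))
| TensZl r a b : tens_gen ((r *: a) ** b - r *: (a ** b))
| TensZr r a b : tens_gen (a ** (r *: b) - r *: (a ** b)).

(* the submodule generated by tens_gen *)
Definition tens_rel : {pred free} := fun x => `[< forall S : {pred free},
  submod_closed S -> (forall y, tens_gen y -> y \in S) -> x \in S >].

Lemma tens_rel_submod : submod_closed tens_rel.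
Proof.
split; first by apply/asboolP => S [].
move=> r x y /asboolP hx /asboolP hy; apply/asboolP => S hS gS.
by apply: (proj2 hS); [exact: hx|exact: hy].
Qed.

HB.instance Definition _ :=
  GRing.isSubmodClosed.Build R free tens_rel tens_rel_submod.

Lemma tens_gen_rel x : tens_gen x -> x \in tens_rel.
Proof. by move=> hx; apply/asboolP => S _; exact. Qed.

Definition tensor : Type := Quotient.quot tens_rel.
HB.instance Definition _ := GRing.Zmodule.on tensor.

Definition tens_pi (x : free) : tensor := \pi_(Quotient.quot tens_rel) x.
Definition tens_repr (x : tensor) : free := repr (x : Quotient.quot tens_rel).

Lemma tens_reprK x : tens_pi (tens_repr x) = x.
Proof. exact: reprK. Qed.

Lemma tens_pi_eq x y : tens_pi x = tens_pi y <-> x - y \in tens_rel.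
Proof.
rewrite (Quotient.idealrBE tens_rel); split=> [e|/eqP //]; exact/eqP.
Qed.

Lemma tens_piB : {morph tens_pi : x y / x - y}.
Proof. by move=> x y; exact: (raddfB (\pi_(Quotient.quot tens_rel))). Qed.

Lemma tens_piD : {morph tens_pi : x y / x + y}.
Proof. by move=> x y; exact: (raddfD (\pi_(Quotient.quot tens_rel))). Qed.

Let tscale (r : R) (x : tensor) : tensor := tens_pi (r *: tens_repr x).

Let tscale_pi r x : tscale r (tens_pi x) = tens_pi (r *: x).
Proof.
apply/tens_pi_eq; rewrite -scalerBr rpredZ //.
by apply/tens_pi_eq; rewrite tens_reprK.
Qed.

Let tscaleA r s u : tscale r (tscale s u) = tscale (r * s) u.
Proof. by rewrite -[u]tens_reprK !tscale_pi scalerA. Qed.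
Let tscale1 : left_id 1 tscale.
Proof. by move=> u; rewrite -[u]tens_reprK tscale_pi scale1r. Qed.
Let tscaleDr : right_distributive tscale +%R.
Proof.
move=> r u v; rewrite -[u]tens_reprK -[v]tens_reprK -tens_piD !tscale_pi.
by rewrite scalerDr tens_piD.
Qed.
Let tscaleDl u : {morph tscale^~ u : r s / r + s}.
Proof.
by move=> r s; rewrite -[u]tens_reprK !tscale_pi scalerDl tens_piD.
Qed.
HB.instance Definition _ := GRing.Zmodule_isLmodule.Build R tensor
  tscaleA tscale1 tscaleDr tscaleDl.

Lemma tens_piZ r x : tens_pi (r *: x) = r *: tens_pi x.
Proof. by rewrite -tscale_pi. Qed.

Definition tens (a : A) (b : B) : tensor := tens_pi (a ** b).

End Tensor.

Section FgliftLinear.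
Variables (R : comNzRingType) (K : choiceType) (M : lmodType R) (g : K -> M).

HB.instance Definition _ := GRing.isZmodMorphism.Build {freeg K / R} M
  (fglift g) (lift_is_additive g).

Lemma fglift_scalable : scalable (fglift g : {freeg K / R} -> M).
Proof.
move=> r x; rewrite -(freeg_sumE x) scaler_sumr !raddf_sum.
apply: eq_bigr => z _ /=.
have -> : r *: << coeff z x *g z >> = << r * coeff z x *g z >> :> {freeg K / R}.
  by apply/eqP/freeg_eqP => t; rewrite coeffZ !coeffU mulrA.
by rewrite !liftU scalerA.
Qed.

HB.instance Definition _ := GRing.isScalable.Build R {freeg K / R} M *:%R
  (fglift g) fglift_scalable.

End FgliftLinear.

Section TensorMap.
Variables (R : comNzRingType) (A B C : lmodType R) (f : {linear B -> C}).

Let lift_pair (p : A * B) : {freeg (A * C) / R} := << (p.1, f p.2) >>.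

(* A (x) f, the map a (x) b |-> a (x) f b *)
Definition tens_map (x : tensor A B) : tensor A C :=
  tens_pi (fglift lift_pair (tens_repr x)).

Lemma tens_map_pi x : tens_map (tens_pi x) = tens_pi (fglift lift_pair x).
Proof.
apply/tens_pi_eq; rewrite -raddfB.
have : tens_repr (tens_pi x) - x \in @tens_rel R A B.
  by apply/tens_pi_eq; rewrite tens_reprK.
move: (_ - x) => y /asboolP.
pose S : {pred {freeg (A * B) / R}} :=
  fun z => fglift lift_pair z \in @tens_rel R A C.
have SE z : (z \in S) = (fglift lift_pair z \in @tens_rel R A C) by [].
move=> /(_ S); rewrite !SE; apply.
  split=> [|r u v]; rewrite !SE ?raddf0 ?rpred0 // => hu hv.
  by rewrite linearP; apply: rpredD => //; apply: rpredZ.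
have hE a b : fglift lift_pair << (a, b) >> = << (a, f b) >>.
  by rewrite liftU scale1r.
move=> _ [a a' b|a b b'|r a b|r a b]; rewrite SE raddfB; apply: tens_gen_rel.
- by rewrite [X in _ - X]raddfD /= !hE; exact: TensDl.
- by rewrite [X in _ - X]raddfD /= !hE (raddfD f); exact: TensDr.
- by rewrite [X in _ - X]linearZ_LR /= !hE; exact: TensZl.
- by rewrite [X in _ - X]linearZ_LR /= !hE linearZ_LR; exact: TensZr.
Qed.

Lemma tens_mapE a b : tens_map (tens a b) = tens a (f b).
Proof. by rewrite /tens tens_map_pi liftU scale1r. Qed.

End TensorMap.

Definition exact_at (A B C : zmodType) (f : A -> B) (g : B -> C) : Prop :=
  forall y, g y = 0 <-> exists x, y = f x.

Definition surj (A B : Type) (f : A -> B) : Prop := forall y, exists x, f x = y.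

Section Homological.
Variables (n : nat) (k : fieldType).
Implicit Types F M N P : pmod n k.

(* Exactness of F (x)_R - on persistence modules; it is tested on the underlying
   R-modules, since the gradings play no role in it. *)
Definition flat F : Prop :=
  forall (A B C : pmod n k) (f : pmor A B) (g : pmor B C),
  injective f -> exact_at f g -> surj g ->
  [/\ injective (tens_map (A := F) f),
      exact_at (tens_map (A := F) f) (tens_map (A := F) g)
    & surj (tens_map (A := F) g)].

Definition projective P : Prop :=
  forall M N (g : pmor M N) (f : pmor P N), surj g ->
  exists h : pmor P M, forall x, g (h x) = f x.

Record proj_resolution M := ProjResolution {
  res_obj :> nat -> pmod n k;
  res_d : forall i, pmor (res_obj i.+1) (res_obj i);
  res_aug : pmor (res_obj 0) M;
  res_proj : forall i, projective (res_obj i);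
  res_surj : surj res_aug;
  res_exact0 : exact_at (res_d 0) res_aug;
  res_exact : forall i, exact_at (res_d i.+1) (res_d i) }.

(* The graded Hom: (+)_a Nat(M, N(a)). *)
Record ghom M N := GHom {
  ghom_comp :> forall a, pmor M (shift N a);
  ghom_fin : finite_set [set a | exists x, ghom_comp a x <> 0] }.

(* Ext^1(M, N) = 0 for the derived functors of the graded Hom: H^1 of the complex
   Hom(P_., N) vanishes for the projective resolutions P_. of M (this does not
   depend on the resolution, and resolutions exist). *)
Definition Ext1_eq0 M N : Prop :=
  forall (P : proj_resolution M) (phi : ghom (P 1%N) N),
  (forall a x, phi a (res_d P 1 x) = 0) ->
  exists psi : ghom (P 0%N) N, forall a x, phi a x = psi a (res_d P 0 x).

Definition cotorsion M : Prop := forall F, flat F -> Ext1_eq0 F M.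

End Homological.

(* Pairs (sigma, a) of a face sigma and an element a of Z sigma^perp. *)
Record face_deg (n : nat) := FaceDeg {
  fd_face : {set 'I_n};
  fd_deg : 'rV[int]_n;
  _ : [forall i in fd_face, fd_deg 0 i == 0] }.

(* prod_(sigma, a) R_sigma(-a)^(beta sigma a) *)
Definition flat_cotorsion_model n k (beta : face_deg n -> Type) : pmod n k :=
  pprod (fun j => pcopies (beta j) (shift (Rloc k (fd_face j)) (- fd_deg j))).

(* Main.v *)
(* A graded module F is flat iff it is "regular": each x_i is a nonzerodivisor modulo
   any set of other variables. If F is regular, Hom_k(F, k) extends maps from the
   primes p_sigma, and by Zorn it extends maps from graded submodules.

   A morphism from P to N = R_sigma(-a)^(B) is the same as a k-linear map P -> k^(B)
   that is invariant under the x_i and vanishes outside the support of R_sigma(-a).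
   Extending such functionals linearly gives Ext^1(F, N) = 0 for F regular, so the
   products of the theorem are flat and cotorsion.

   Of the cotorsion hypothesis only Ext^1(R_S, F) = 0 is used, that is, the vanishing
   of lim^1 for the towers of multiplications by x_S. Let D_sigma F be the image of
   Hom(R_sigma, F) in F. A basis of (D_sigma F / p_sigma D_sigma F)_a is beta^sigma_a,
   and its coordinates extend to functionals on F, which together define a map Phi
   from F to the product M. Phi induces an isomorphism D_sigma F / x_rho -> D_sigma M / x_rho
   when rho is the complement of sigma, and then for all disjoint sigma and rho by
   removing one variable i at a time: G = D_sigma F / x_rho is an extension of its
   x_i-completion, which G / x_i determines, by the intersection of the x_i^m G.
   Uniqueness holds since beta^sigma_a is a basis of (D_sigma F / p_sigma D_sigma F)_a. *)
Require Import Defs.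
From HB Require Import structures.
From mathcomp Require Import all_boot all_order all_algebra.
From mathcomp Require Import boolp classical_sets functions cardinality.
From mathcomp Require Import freeg mpoly zify.

Set Implicit Arguments.
Unset Strict Implicit.
Unset Printing Implicit Defensive.

Import GRing.Theory.
Local Open Scope ring_scope.
Local Open Scope quotient_scope.

(** * Linear algebra in infinite dimension *)

(** The coordinates of (D_sigma F / p_sigma D_sigma F)_a extend to functionals that define morphisms
    because, in degree a, D_sigma F meets [offspan] only inside p_sigma D_sigma F. Regularity brings
    a relation from the high degree used by [push] back to degree a; the vanishing of lim^1 brings
    its coefficients from F into D_sigma F. The obstacle to the bijectivity of Phi is that F is
    given no topology, so a series in powers of x_i cannot be summed outright. Instead, a sequence
    is built with u m = x u (m + 1) up to an error e m, the system z m - x z (m + 1) = e m is solved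
    by lim^1, and u - z is then exactly compatible, so that its first term is infinitely divisible
    by x. The errors lie in x_rho D_sigma, and so do their corrections; this is why the comparison
    carries two disjoint sets sigma and rho. Each limit lands in D_sigma with one more variable
    inverted, where the induction applies again. *)

Section LinearAlgebra.
Local Open Scope classical_set_scope.

(** Zorn is applied to the sets A for which Q holds of the union of G0 and A: the empty chain is
    then bounded by G0 itself, and the hypothesis on unions is asked of nonempty chains only. *)
Lemma zorn_above (T : Type) (Q : set T -> Prop) (G0 : set T) : Q G0 ->
  (forall F : set (set T), F !=set0 -> F `<=` Q -> total_on F subset ->
     Q (\bigcup_(G in F) G)) ->
  exists G, [/\ Q G, G0 `<=` G & forall H, G `<=` H -> Q H -> H `<=` G].
Proof.
move=> Q0 Qc.
have [F FP tF|A [QA mA]] := @Zorn_bigcup T (fun A => Q (G0 `|` A)).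
  have [->|/set0P[A FA]] := eqVneq F set0; first by rewrite bigcup_set0 setU0.
  have -> : G0 `|` \bigcup_(X in F) X = \bigcup_(X in [set G0 `|` B | B in F]) X.
    rewrite bigcup_image; apply/seteqP; split=> [x [Gx|[B FB Bx]]|x [B FB [Gx|Bx]]].
    - by exists A => //; left.
    - by exists B => //; right.
    - by left.
    - by right; exists B.
  apply: Qc => [|_ [B FB <-]|_ _ [B FB <-] [C FC <-]].
  - by exists (G0 `|` A), A.
  - exact: FP.
  - by case: (tF _ _ FB FC) => h; [left|right]; exact: setUS.
exists (G0 `|` A); split=> // H GH QH.
apply: contrapT => nH; apply: (mA H).
  split; first by move=> x Ax; apply: GH; right.
  by move=> HA; apply: nH => x /HA; right.
by rewrite setUidr // => x Gx; apply: GH; left.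
Qed.

Definition lin_closed (k : pzRingType) (X : lmodType k) (U : X -> Prop) : Prop :=
  U 0 /\ forall a x y, U x -> U y -> U (a *: x + y).

Section LinClosed.
Variables (k : pzRingType) (X : lmodType k) (U : X -> Prop).
Hypothesis hU : lin_closed U.

Lemma lin_closedD x y : U x -> U y -> U (x + y).
Proof. by move=> ux uy; rewrite -[x]scale1r; apply: (proj2 hU). Qed.

Lemma lin_closedZ a x : U x -> U (a *: x).
Proof. by move=> ux; rewrite -[_ *: _]addr0; apply: (proj2 hU) => //; exact: (proj1 hU). Qed.

Lemma lin_closedB x y : U x -> U y -> U (x - y).
Proof. by move=> ux uy; rewrite addrC -scaleN1r; apply: (proj2 hU). Qed.

Lemma lin_closed_sum (I : eqType) (s : seq I) (P : pred I) (F : I -> X) :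
  (forall i, i \in s -> P i -> U (F i)) -> U (\sum_(i <- s | P i) F i).
Proof.
move=> hF; rewrite big_seq_cond; apply: big_ind => [|x y|i /andP[]];
  [exact: (proj1 hU)|exact: lin_closedD|exact: hF].
Qed.
End LinClosed.

(* A linear relation [G] that contains no [(0, v)] with [v <> 0] is a partially
   defined linear map; a maximal one is total. *)
Lemma linear_extension (k : fieldType) (X V : lmodType k) (G0 : X * V -> Prop) :
  lin_closed G0 -> (forall v, G0 (0, v) -> v = 0) ->
  exists f : {linear X -> V}, forall x v, G0 (x, v) -> f x = v.
Proof.
move=> cG0 fG0.
pose Q (G : set (X * V)) := lin_closed G /\ forall v, G (0, v) -> v = 0.
have [//|F [A0 FA0] FQ tF|G [[cG fG] sG mG]] := @zorn_above _ Q G0.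
  split; last by move=> v [A FA /(proj2 (FQ _ FA))].
  split; first by exists A0 => //; have [[]] := FQ _ FA0.
  move=> a x y [A FA Ax] [B FB By].
  by case: (tF _ _ FA FB) => AB; [exists B|exists A] => //;
    apply: (proj2 (proj1 (FQ _ _))) => //; exact: AB.
have tot x : exists v, G (x, v).
  apply: contrapT => nx; apply: (nx); exists 0.
  (* H extends G to the span of its domain and the missing x, sending x to 0. *)
  pose H (p : X * V) := exists a, G (p.1 - a *: x, p.2).
  apply: (mG H) => [p Gp||].
  - by exists 0; rewrite scale0r subr0; case: p Gp.
  - split=> [|v [a /= Ga]].
      split=> [|a p q [b Gb] [c Gc]]; first by exists 0; rewrite scale0r subr0; exact: (proj1 cG).
      exists (a * b + c); have := proj2 cG a _ _ Gb Gc; congr (G (_, _)) => /=.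
      by rewrite scalerBr scalerDl opprD -scalerA addrACA.
    have [a0|a0] := eqVneq a 0; first by apply: fG; move: Ga; rewrite a0 scale0r subr0.
    exfalso; apply: nx; exists (- a^-1 *: v); have := lin_closedZ cG (- a^-1) Ga.
    congr (G (_, _)) => /=; rewrite sub0r scalerN scaleNr opprK scalerA mulVf //.
    by rewrite scale1r.
  by exists 1 => /=; rewrite scale1r subrr; exact: (proj1 cG).
have [f hf] := choice tot.
have uniqG x v w : G (x, v) -> G (x, w) -> v = w.
  move=> h1 h2; apply/eqP; rewrite -subr_eq0; apply/eqP/fG.
  by have := lin_closedB cG h1 h2; congr (G (_, _)) => /=; rewrite subrr.
have lf : linear f.
  by move=> a x y; apply: uniqG (hf _) _; exact: (proj2 cG a (x, f x) (y, f y)).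
pose lin := GRing.isLinear.Build _ _ _ _ f lf.
pose F : {linear X -> V} := HB.pack f lin.
by exists F => x v /sG Gxv; apply: uniqG (hf _) _.
Qed.

(** A maximal subset of U that is independent modulo W is a basis of U modulo its intersection with
    W. Its coordinates are defined on its span plus W, are zero on W, and extend to X by
    [linear_extension]. *)
Lemma relative_basis (k : fieldType) (X : lmodType k) (U W : X -> Prop) :
  lin_closed U -> lin_closed W ->
  exists (B : Type) (f : {linear X -> {freeg {classic B} / k}}),
    [/\ forall c, exists2 u, U u & f u = c,
        forall w, W w -> f w = 0 & forall u, U u -> f u = 0 -> W u].
Proof.
move=> cU cW.
pose C : choiceType := {classic X}.
pose comb (c : {freeg C / k}) : X := fglift (id : C -> X) c.
pose Q (S : set X) := S `<=` U /\
  forall c : {freeg C / k}, (forall x, x \in dom c -> S x) -> W (comb c) -> c = 0.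
have [||S [[SU iS] _ mS]] := @zorn_above _ Q set0.
- split=> // c hc _; apply/eqP; rewrite -dom_eq0; case: (dom c) hc => [//|x s hx].
  by have := hx x (mem_head _ _).
- move=> F _ FQ tF; split=> [x [A FA Ax]|c hc wc]; first exact: (proj1 (FQ _ FA)).
  have [[A FA hA]|e] : (exists2 A, F A & forall x, x \in dom c -> A x) \/ dom c = [::].
    elim: (dom c) hc => [|x s IH] hs; first by right.
    have [A FA Ax] := hs x (mem_head _ _).
    have [y ys|[B FB hB]|s0] := IH; first by apply: hs; rewrite inE ys orbT.
      left; case: (tF _ _ FA FB) => AB; [exists B|exists A] => // y;
        rewrite inE => /orP[/eqP ->|/hB]; by [|exact: AB].
    by left; exists A => // y; rewrite s0 inE => /eqP ->.
  - exact: (proj2 (FQ _ FA)).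
  - by apply/eqP; rewrite -dom_eq0 e.
(* Independence was stated over the fixed type C so that S could vary; [inc] transports it to the
   free space on the chosen S. *)
pose B : choiceType := {classic {x : X | S x}}.
pose b (z : B) : X := sval z.
have bI : injective b.
  move=> [x hx] [y hy] /= e; rewrite /b /= in e.
  by case: _ / e in hy *; rewrite (Prop_irrelevance hx hy).
pose inc (c : {freeg B / k}) : {freeg C / k} := fglift (fun z : B => (<< (b z : C) >> : {freeg C / k})) c.
have incb c : comb (inc c) = fglift b c.
  rewrite /inc /comb -[c]freeg_sumE !raddf_sum; apply: eq_bigr => z _.
  by rewrite /= !liftU linearZ /= liftU scale1r.
have coi c z : coeff (b z : C) (inc c) = coeff z c.
  rewrite /inc -{1}[c]freeg_sumE !raddf_sum /=; under eq_bigr do rewrite liftU coeffZ coeffU mul1r.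
  have [zc|zc] := boolP (z \in dom c); last first.
    rewrite coeff_outdom // big_seq big1 // => y yc.
    case: eqP => [/bI e|]; last by rewrite mulr0.
    by rewrite -e yc in zc.
  rewrite (bigD1_seq z) ?uniq_dom //= eqxx mulr1 big1 ?addr0 // => y yz.
  by case: eqP => [/bI e|]; [rewrite e eqxx in yz|rewrite mulr0].
have di c x : x \in dom (inc c) -> S x.
  rewrite mem_dom /inc -{1}[c]freeg_sumE !raddf_sum /= => h; apply: contrapT => nS.
  move/eqP: h; apply; apply: big1 => z _; rewrite liftU coeffZ coeffU.
  by case: eqP => [e|]; [case: nS; rewrite -e; exact: (svalP z)|rewrite !mulr0].
pose G0 (p : X * {freeg B / k}) := W (p.1 - fglift b p.2).
have [||f hf] := @linear_extension _ _ _ G0.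
- split=> [|a p q hp hq]; rewrite /G0 /=.
    by rewrite raddf0 subr0; exact: (proj1 cW).
  rewrite linearP /= opprD addrACA -scalerBr; exact: (proj2 cW).
- rewrite /G0 /= => c; rewrite sub0r -scaleN1r -incb => hc.
  have {}hc : W (comb (inc c)).
    by have := lin_closedZ cW (-1) hc; rewrite scalerA mulrNN mulr1 scale1r.
  have c0 := iS _ (@di c) hc.
  by apply/eqP/freeg_eqP => z; rewrite -coi c0 !coeff0.
have fW w : W w -> f w = 0 by move=> ww; apply: hf; rewrite /G0 /= raddf0 subr0.
exists {x : X | S x}, f; split=> // [c|u uu fu].
  exists (fglift b c); last by apply: hf; rewrite /G0 /= subrr; exact: (proj1 cW).
  rewrite -[c]freeg_sumE raddf_sum; apply: (lin_closed_sum cU) => z _ _ /=.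
  by rewrite liftU; apply: lin_closedZ => //; exact/SU/(svalP z).
have [c hc] : exists c, W (u - fglift b c).
  have [Su|nSu] := pselect (S u).
    exists << (exist _ u Su : B) >>; rewrite liftU scale1r subrr; exact: (proj1 cW).
  apply: contrapT => nc; apply: nSu; apply: (mS (S `|` [set u])); [exact: subsetUl| |by right].
  split=> [x [/SU //|-> //]|c hc wc].
  pose c' : {freeg C / k} := c - << coeff (u : C) c *g (u : C) >>.
  have hc' x : x \in dom c' -> S x.
    rewrite mem_dom coeffB coeffU => xc'.
    have [e|xu] := eqVneq (u : C) x; first by rewrite e eqxx mulr1 subrr eqxx in xc'.
    move: xc'; rewrite (negbTE xu) mulr0 subr0 -mem_dom => /hc [//|/= e].
    by rewrite e eqxx in xu.
  have [cu|cu] := eqVneq (coeff (u : C) c) 0.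
    by apply: iS wc => x xc; apply: hc'; rewrite /c' cu freegU0 subr0.
  (* Divided by its coefficient at u, the relation writes u modulo W as a combination of S. *)
  exfalso; apply: nc.
  have lc : exists d : {freeg B / k}, fglift b d = comb c'.
    rewrite -[c']freeg_sumE /comb raddf_sum /=.
    suff : forall s, {subset s <= dom c'} -> exists d : {freeg B / k},
        fglift b d = \sum_(x <- s) fglift (id : C -> X) << coeff x c' *g x >> by exact.
    elim=> [|x s IH] hs; first by exists 0; rewrite raddf0 big_nil.
    have [y ys|d hd] := IH; first by apply: hs; rewrite inE ys orbT.
    have Sx := hc' x (hs x (mem_head _ _)).
    exists (<< coeff x c' *g (exist _ x Sx : B) >> + d).
    by rewrite raddfD /= hd big_cons !liftU.
  have [d hd] := lc.
  exists (- (coeff (u : C) c)^-1 *: d); rewrite linearZ /= hd.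
  have := lin_closedZ cW (coeff (u : C) c)^-1 wc; congr W.
  have -> : comb c = coeff (u : C) c *: u + comb c'.
    by rewrite /comb raddfB /= liftU addrC subrK.
  by rewrite scalerDr scaleNr opprK scalerA mulVf // scale1r.
have e : f u = c.
  rewrite -[u](subrK (fglift b c)) linearD /= (fW _ hc) add0r.
  by apply: hf; rewrite /G0 /= subrr; exact: (proj1 cW).
by move: hc; rewrite -e fu raddf0 subr0.
Qed.
End LinearAlgebra.

Section Steinitz.
Local Open Scope classical_set_scope.

(* Steinitz exchange: in a maximal partial injection A that keeps
   (phi i, i notin dom A) together with the range of A independent,
   every i has been exchanged. *)
Lemma freeg_injection (k : fieldType) (I J : choiceType)
    (phi : {linear {freeg I / k} -> {freeg J / k}}) :
  injective phi -> exists f : I -> J, injective f.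
Proof.
move=> iphi.
pose avoid (A : set (I * J)) (c : {freeg I / k}) :=
  forall i j, A (i, j) -> i \notin dom c.
pose inran (A : set (I * J)) (d : {freeg J / k}) :=
  forall j, j \in dom d -> exists i, A (i, j).
pose Q A := [/\ forall i j j', A (i, j) -> A (i, j') -> j = j',
  forall i i' j, A (i, j) -> A (i', j) -> i = i' &
  forall c d, avoid A c -> inran A d -> phi c + d = 0 -> c = 0].
have [||A [[fA jA iA] _ mA]] := @zorn_above _ Q set0.
- split=> // c d _ hd; have -> : d = 0.
    apply/eqP; rewrite -dom_eq0; case: (dom d) (hd : forall j, j \in dom d -> _) => [//|x s {}hd].
    by have [] := hd x (mem_head _ _).
  by rewrite addr0 => e; apply: iphi; rewrite e raddf0.
- move=> F [A0 FA0] FQ tF.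
  have two p q : (\bigcup_(G in F) G) p -> (\bigcup_(G in F) G) q ->
      exists A, [/\ F A, A p & A q].
    move=> [A FA Ap] [B FB Bq].
    by case: (tF _ _ FA FB) => AB; [exists B|exists A]; split=> //; exact: AB.
  split=> [i j j' h1 h2|i i' j h1 h2|c d hc hd].
  - by have [A [/FQ[h _ _] ? ?]] := two _ _ h1 h2; exact: (h i).
  - by have [A [/FQ[_ h _] ? ?]] := two _ _ h1 h2; exact: (h i i' j).
  have [A FA hA] : exists2 A, F A & inran A d.
    rewrite /inran; elim: (dom d) (hd : forall j, j \in dom d -> exists i, (\bigcup_(G in F) G) (i, j)) => [|x s IH] hs.
      by exists A0.
    have [y ys|A FA hA] := IH; first by apply: hs; rewrite inE ys orbT.
    have [i [B FB Bx]] := hs x (mem_head _ _).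
    case: (tF _ _ FA FB) => AB; [exists B|exists A] => // y.
      by rewrite inE => /orP[/eqP ->|/hA [i' /AB ?]]; [exists i|exists i'].
    by rewrite inE => /orP[/eqP ->|/hA //]; exists i; exact: AB.
  have [_ _] := FQ _ FA; apply=> // i j Aij; apply: (hc i j); exists A => //.
suff tot i : exists j, A (i, j).
  have [f hf] := choice tot; exists f => i i' e; apply: jA (hf i) _.
  by rewrite e; exact: hf.
apply: contrapT => ni.
(* L is the span of the current system with phi i left out. A generator j outside L could be
   exchanged with i, against maximality; so L is everything and contains phi i, against
   independence. *)
pose L (w : {freeg J / k}) := exists c d,
  [/\ avoid A c, i \notin dom c, inran A d & w = phi c + d].
have av0 (c : {freeg I / k}) j : (j \notin dom c) = (coeff j c == 0).
  by rewrite mem_dom negbK.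
have cL : lin_closed L.
  split=> [|a _ _ [c [d [h1 h2 h3 ->]]] [c' [d' [h1' h2' h3' ->]]]].
    by exists 0, 0; rewrite !dom0 raddf0 addr0; split=> // [? ? ?|?]; rewrite ?dom0.
  exists (a *: c + c'), (a *: d + d'); split.
  - move=> j j' Aj; rewrite av0 coeffD coeffZ; move: (h1 j j' Aj) (h1' j j' Aj).
    by rewrite !av0 => /eqP -> /eqP ->; rewrite mulr0 addr0.
  - rewrite av0 coeffD coeffZ; move: h2 h2'.
    by rewrite !av0 => /eqP -> /eqP ->; rewrite mulr0 addr0.
  - move=> j; rewrite mem_dom coeffD coeffZ => hj.
    have [jd|] := boolP (j \in dom d); first exact: h3.
    have [jd' _|] := boolP (j \in dom d'); first exact: h3'.
    by rewrite !mem_dom !negbK => /eqP e /eqP e'; rewrite e e' mulr0 addr0 eqxx in hj.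
  - by rewrite linearP scalerDr addrACA.
have Lj j : L << j >>.
  have [[i' Aij]|nj] := pselect (exists i', A (i', j)).
    exists 0, << j >>; rewrite raddf0 add0r dom0; split=> // [? ? ?|j'].
      by rewrite dom0.
    by rewrite domU1 inE => /eqP ->; exists i'.
  apply: contrapT => nL; apply: (ni); exists j.
  apply: (mA (A `|` [set (i, j)])); [exact: subsetUl| |by right].
  split.
  - move=> i1 j1 j2 [h|e1] [h'|e2]; first exact: fA h h'.
    + by case: e2 => e2 _; case: ni; exists j1; rewrite -e2.
    + by case: e1 => e1 _; case: ni; exists j2; rewrite -e1.
    + by case: e1 => _ ->; case: e2.
  - move=> i1 i2 j1 [h|e1] [h'|e2]; first exact: jA h h'.
    + by case: e2 => _ e2; case: nj; exists i1; rewrite -e2.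
    + by case: e1 => _ e1; case: nj; exists i2; rewrite -e1.
    + by case: e1 => -> _; case: e2.
  move=> c d hc hd e; have hcA : avoid A c by move=> i1 j1 h; apply: (hc i1 j1); left.
  have ic : i \notin dom c by apply: (hc i j); right.
  have [dj|dj] := eqVneq (coeff j d) 0.
    apply: iA e => // j1 j1d; have [i1 [h|[_ e1]]] := hd _ j1d; first by exists i1.
    by move: j1d; rewrite e1 mem_dom dj eqxx.
  exfalso; apply: nL.
  have -> : << j >> = - (coeff j d)^-1 *: (phi c + (d - << coeff j d *g j >>)).
    rewrite addrA e sub0r scaleNr scalerN opprK; apply/eqP/freeg_eqP => j1.
    by rewrite coeffZ !coeffU mulrA mulVf // !mul1r.
  apply: lin_closedZ => //; exists c, (d - << coeff j d *g j >>); split=> //.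
  move=> j1; rewrite mem_dom coeffB coeffU => hj1.
  have [e1|ne] := eqVneq j j1; first by rewrite e1 eqxx mulr1 subrr eqxx in hj1.
  rewrite (negbTE ne) mulr0 subr0 -mem_dom in hj1.
  by have [i1 [h|[_ e1]]] := hd _ hj1; [exists i1|rewrite e1 eqxx in ne].
have Lall w : L w.
  rewrite -[w]freeg_sumE; apply: (lin_closed_sum cL) => z _ _.
  have -> : << coeff z w *g z >> = coeff z w *: << z >> :> {freeg J / k}.
    by apply/eqP/freeg_eqP => t; rewrite coeffZ !coeffU mul1r.
  exact: lin_closedZ.
have [c [d [h1 h2 h3 e]]] := Lall (phi << i >>).
have : << i >> - c = 0.
  apply: (iA _ (- d)); last by rewrite raddfB /= e -addrA -opprD subrr.
  - move=> i1 j1 h; rewrite av0 coeffB coeffU; move: (h1 _ _ h); rewrite av0 => /eqP ->.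
    have [e1|_] := eqVneq i i1; last by rewrite mulr0 subr0.
    by case: ni; exists j1; rewrite e1.
  - by move=> j1; rewrite domN; exact: h3.
move/(congr1 (coeff i)); rewrite coeffB coeffU eqxx mulr1 coeff0.
by move: h2; rewrite av0 => /eqP ->; rewrite subr0 => /eqP; rewrite oner_eq0.
Qed.

(** By Cantor-Bernstein, injections in both directions are enough to compare bases, so the
    uniqueness part only has to produce injective linear maps. *)
Lemma freeg_bijection (k : fieldType) (I J : Type)
    (phi : {linear {freeg {classic I} / k} -> {freeg {classic J} / k}})
    (psi : {linear {freeg {classic J} / k} -> {freeg {classic I} / k}}) :
  injective phi -> injective psi -> exists h : I -> J, bijective h.
Proof.
move=> /freeg_injection[f If] /freeg_injection[g Ig].
have : ([set: I] #= [set: J])%card.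
  apply: Cantor_Bernstein.
    by rewrite -(card_le_eql (inj_card_eq (in2W If))) subset_card_le.
  by rewrite -(card_le_eql (inj_card_eq (in2W Ig))) subset_card_le.
move=> /card_bijP[h hb].
have vK T : bijective (to_setT : T -> [set: T]).
  by exists val => // x; exact: val_inj.
have vK' T : bijective (val : [set: T] -> T).
  by exists to_setT => // x; exact: val_inj.
by exists (val \o (h \o to_setT)); apply: bij_comp => //; exact: bij_comp.
Qed.
End Steinitz.

(** * Graded modules and regularity *)

Section Monomials.
Variables (n : nat) (k : fieldType).
Local Notation deg := 'rV[int]_n.
Local Notation R := {mpoly k[n]}.
Local Notation "''x_' m" := ('X_[k, m] : R) (at level 2, m at level 2).

Section Action.
Variable M : lmodType R.
Implicit Types u v : M.

Lemma xact0 u : 'x_0%MM *: u = u.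
Proof. by rewrite mpolyX0 scale1r. Qed.

Lemma xactD m1 m2 u : 'x_(m1 + m2)%MM *: u = 'x_m1 *: ('x_m2 *: u).
Proof. by rewrite mpolyXD scalerA. Qed.

Lemma xactC m1 m2 u : 'x_m1 *: ('x_m2 *: u) = 'x_m2 *: ('x_m1 *: u).
Proof. by rewrite -!xactD addmC. Qed.

Lemma cactC c m u : 'x_m *: (c%:MP_[n] *: u) = c%:MP *: ('x_m *: u).
Proof. by rewrite !scalerA mulrC. Qed.
End Action.

Lemma Rdeg_X m : Rdeg (mdegZ m) 'x_m.
Proof. by rewrite -['x_m]scale1r; exact: RdegZX. Qed.

Lemma mdegZ0 : mdegZ (0%MM : 'X_{1..n}) = 0.
Proof. by apply/rowP => i; rewrite !mxE mnm0E. Qed.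

Lemma Rdeg_C (c : k) : Rdeg 0 (c%:MP : R).
Proof.
have -> : c%:MP = c *: 'x_0%MM by rewrite mpolyX0 -mul_mpolyC mulr1.
by rewrite -mdegZ0; exact: RdegZX.
Qed.

End Monomials.

Section Homogeneous.
Variables (n : nat) (k : fieldType).
Local Notation deg := 'rV[int]_n.
Local Notation R := {mpoly k[n]}.
Local Notation "''x_' m" := ('X_[k, m] : R) (at level 2, m at level 2).

Section OneModule.
Variable M : pmod n k.
Implicit Types (u v : M) (d e : deg).

Lemma comp_x d m u : pm_comp M d u -> pm_comp M (d + mdegZ m) ('x_m *: u).
Proof. by rewrite addrC; apply: pm_compZ; exact: Rdeg_X. Qed.

Lemma comp_c d c u : pm_comp M d u -> pm_comp M d (c%:MP_[n] *: u).
Proof. by move=> h; rewrite -[d]add0r; apply: pm_compZ => //; exact: Rdeg_C. Qed.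

Lemma comp_sum d (I : eqType) (s : seq I) (P : pred I) (F : I -> M) :
  (forall i, i \in s -> P i -> pm_comp M d (F i)) -> pm_comp M d (\sum_(i <- s | P i) F i).
Proof.
move=> hF; rewrite big_seq_cond; apply: big_ind => [|x y|i /andP[]];
  [exact: pm_comp0|exact: pm_compD|exact: hF].
Qed.

Lemma hcompE1 d u e : pm_comp M d u -> hcomp u e = if e == d then u else 0.
Proof.
move=> hu; rewrite (@hcompE _ _ M u [:: d] (fun b => if b == d then u else 0)) //.
- by rewrite inE; case: (e == d).
- by move=> a; case: eqP => [-> //|_]; exact: pm_comp0.
- by rewrite big_seq1 eqxx.
Qed.

Lemma hcomp_id d u : pm_comp M d u -> hcomp u d = u.
Proof. by move=> /(hcompE1 d) ->; rewrite eqxx. Qed.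

(** A finite list that contains the support of u, possibly with degrees whose component is 0; hence
    the condition at 0 in [hsumE], which makes sums independent of the list. *)
Definition hsupp u : seq deg := sval (cid (pm_spanP u)).

Lemma hsupp_uniq u : uniq (hsupp u).
Proof. by rewrite /hsupp; case: cid => s [c []]. Qed.

Lemma hsuppP u d : hcomp u d != 0 -> d \in hsupp u.
Proof.
rewrite /hsupp; case: cid => s [c [us hc uc]] /=.
by rewrite (hcompE us hc uc); case: ifP => //; rewrite eqxx.
Qed.

Lemma hsuppE u : u = \sum_(d <- hsupp u) hcomp u d.
Proof.
apply: hcomp_sum; first exact: hsupp_uniq.
by rewrite /hsupp; case: cid => s [c [us hc uc]] /=; exists c.
Qed.

Lemma hsumE (V : zmodType) (phi : deg -> M -> V) u s :
  (forall d, phi d 0 = 0) ->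
  uniq s -> (forall d, hcomp u d != 0 -> d \in s) ->
  \sum_(d <- hsupp u) phi d (hcomp u d) = \sum_(d <- s) phi d (hcomp u d).
Proof.
move=> p0 us hs.
rewrite (bigID (fun d => hcomp u d != 0)) /= [X in _ + X]big1 => [|d /negbNE/eqP -> //].
rewrite [RHS](bigID (fun d => hcomp u d != 0)) /= [X in _ = _ + X]big1 => [|d /negbNE/eqP -> //].
congr (_ + 0); rewrite -[LHS]big_filter -[RHS]big_filter; apply: perm_big.
apply: uniq_perm; rewrite ?filter_uniq ?hsupp_uniq // => d; rewrite !mem_filter.
by have [//|h] := eqVneq (hcomp u d) 0; rewrite hsuppP // hs.
Qed.

Lemma hsuppE_sub u s : uniq s -> (forall d, hcomp u d != 0 -> d \in s) ->
  u = \sum_(d <- s) hcomp u d.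
Proof.
by move=> us hs; rewrite {1}[u]hsuppE (@hsumE _ (fun _ => id) u s).
Qed.

Lemma hcomp_eqE u (c : deg -> M) s : uniq s -> (forall d, pm_comp M d (c d)) ->
  (forall d, d \notin s -> c d = 0) -> u = \sum_(d <- s) c d -> hcomp u =1 c.
Proof.
by move=> us hc h0 e d; rewrite (hcompE us hc e); case: ifPn => [|/h0 ->].
Qed.

Lemma hcomp0E u (s : seq deg) d : (forall e, hcomp u e != 0 -> e \in s) -> d \notin s -> hcomp u d = 0.
Proof. by move=> hs; apply: contraNeq; exact: hs. Qed.

Lemma hcompD d : {morph (fun u => hcomp u d) : u v / u + v}.
Proof.
move=> u v; set s := undup (hsupp u ++ hsupp v).
have hu e : hcomp u e != 0 -> e \in s by move=> /hsuppP h; rewrite mem_undup mem_cat h.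
have hv e : hcomp v e != 0 -> e \in s by move=> /hsuppP h; rewrite mem_undup mem_cat h orbT.
apply: (@hcomp_eqE (u + v) (fun d => hcomp u d + hcomp v d) s); first exact: undup_uniq.
- by move=> e; apply: pm_compD; exact: hcompP.
- by move=> e he; rewrite !(@hcomp0E _ s) ?addr0.
by rewrite big_split /= -!hsuppE_sub ?undup_uniq.
Qed.

Lemma hcomp_x m u d : hcomp ('x_m *: u) (d + mdegZ m) = 'x_m *: hcomp u d.
Proof.
set e := d + _; have -> : d = e - mdegZ m by rewrite addrK.
apply: (@hcomp_eqE _ (fun e => 'x_m *: hcomp u (e - mdegZ m)) [seq d + mdegZ m | d <- hsupp u]).
- by rewrite map_inj_uniq ?hsupp_uniq //; exact: addIr.
- by move=> a; rewrite -{1}[a](subrK (mdegZ m)); apply: comp_x; exact: hcompP.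
- move=> a ha; rewrite (@hcomp0E _ (hsupp u)) ?scaler0 //; first exact: hsuppP.
  by apply: contra ha => ha; apply/mapP; exists (a - mdegZ m); rewrite ?subrK.
by rewrite big_map {1}[u]hsuppE scaler_sumr; apply: eq_bigr => a _; rewrite addrK.
Qed.

Lemma homogeneous_ind (P : M -> Prop) : P 0 -> (forall u v, P u -> P v -> P (u + v)) ->
  (forall d u, pm_comp M d u -> P u) -> forall u, P u.
Proof.
move=> P0 PD Ph u; rewrite [u]hsuppE; apply: big_ind => // d _.
apply: (Ph d); exact: hcompP.
Qed.

Section HSum.
Variables (V : zmodType) (phi : deg -> M -> V).
Hypothesis phiD : forall d u v, pm_comp M d u -> pm_comp M d v ->
  phi d (u + v) = phi d u + phi d v.

Definition hsum u : V := \sum_(d <- hsupp u) phi d (hcomp u d).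

Let phi0 d : phi d 0 = 0.
Proof.
have := phiD (pm_comp0 M d) (pm_comp0 M d); rewrite addr0 => /eqP.
by rewrite -subr_eq0 opprD addNKr oppr_eq0 => /eqP.
Qed.

Lemma hsumD : {morph hsum : u v / u + v}.
Proof.
move=> u v; rewrite /hsum; set s := undup (hsupp u ++ hsupp v ++ hsupp (u + v)).
rewrite !(@hsumE _ phi _ s) ?undup_uniq //.
- rewrite -big_split; apply: eq_bigr => d _ /=.
  by rewrite hcompD phiD //; exact: hcompP.
- by move=> d /hsuppP h; rewrite mem_undup !mem_cat h ?orbT.
- by move=> d /hsuppP h; rewrite mem_undup !mem_cat h ?orbT.
- by move=> d /hsuppP h; rewrite mem_undup !mem_cat h ?orbT.
Qed.

Lemma hsum1 d u : pm_comp M d u -> hsum u = phi d u.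
Proof.
move=> hu; rewrite /hsum (@hsumE _ phi _ [:: d]) //; first by rewrite big_seq1 hcomp_id.
by move=> e; rewrite (hcompE1 e hu) inE; case: ifP => // _; rewrite eqxx.
Qed.
End HSum.
End OneModule.

Lemma pmor_hcomp (M N : pmod n k) (f : pmor M N) u d : f (hcomp u d) = hcomp (f u) d.
Proof.
symmetry; apply: (@hcomp_eqE N (f u) (fun d => f (hcomp u d)) (hsupp u)).
- exact: hsupp_uniq.
- by move=> e; apply: pmor_deg; exact: hcompP.
- by move=> e he; rewrite (@hcomp0E _ _ (hsupp u)) ?raddf0 //; exact: hsuppP.
by rewrite {1}[u]hsuppE raddf_sum.
Qed.

Lemma linear_of_additive_x (A B : lmodType R) (f : A -> B) :
  {morph f : u v / u + v} -> (forall c u, f (c%:MP_[n] *: u) = c%:MP *: f u) ->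
  (forall m u, f ('x_m *: u) = 'x_m *: f u) -> linear f.
Proof.
move=> fD fc fx r u v; rewrite fD; congr (_ + _); elim/mpolyind: r => [|c m p _ _ IH].
  by rewrite -mpolyC0 fc.
by rewrite -mul_mpolyC !scalerDl fD IH -!scalerA fc fx.
Qed.

Lemma pmor_build (M : pmod n k) (N : lmodType R) (phi : deg -> M -> N) :
  (forall d u v, pm_comp M d u -> pm_comp M d v -> phi d (u + v) = phi d u + phi d v) ->
  (forall d c u, pm_comp M d u -> phi d (c%:MP_[n] *: u) = c%:MP *: phi d u) ->
  (forall d m u, pm_comp M d u -> phi (d + mdegZ m) ('x_m *: u) = 'x_m *: phi d u) ->
  exists f : {linear M -> N}, forall d u, pm_comp M d u -> f u = phi d u.
Proof.
move=> pD pc px; have lf : linear (hsum phi).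
  apply: linear_of_additive_x; first exact: hsumD.
  - move=> c; apply: homogeneous_ind => [|u v hu hv|d u hu].
    + have e : hsum phi 0 = 0 by apply: (@addrI _ (hsum phi 0)); rewrite -hsumD // !addr0.
      by rewrite scaler0 e scaler0.
    + by rewrite scalerDr !hsumD // hu hv scalerDr.
    + by rewrite !(hsum1 pD (d := d)) ?pc //; exact: comp_c.
  - move=> m; apply: homogeneous_ind => [|u v hu hv|d u hu].
    + have e : hsum phi 0 = 0 by apply: (@addrI _ (hsum phi 0)); rewrite -hsumD // !addr0.
      by rewrite scaler0 e scaler0.
    + by rewrite scalerDr !hsumD // hu hv scalerDr.
    + by rewrite (hsum1 pD hu) (hsum1 pD (comp_x m hu)) px.
pose lin := GRing.isLinear.Build _ _ _ _ (hsum phi) lf.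
pose F : {linear M -> N} := HB.pack (hsum phi) lin.
by exists F => d u hu; exact: (hsum1 pD hu).
Qed.

Lemma linear_eq_hom (M : pmod n k) (V : zmodType) (f g : {additive M -> V}) :
  (forall d u, pm_comp M d u -> f u = g u) -> f =1 g.
Proof.
by move=> h; apply: homogeneous_ind => [|u v hu hv|//]; rewrite ?raddf0 // !raddfD hu hv.
Qed.

End Homogeneous.

(* Alias of M carrying its structure of k-vector space. *)
Definition kres (n : nat) (k : fieldType) (M : lmodType {mpoly k[n]}) : Type := M.

Section Kres.
Variables (n : nat) (k : fieldType) (M : lmodType {mpoly k[n]}).
HB.instance Definition _ := GRing.Zmodule.on (kres M).

Let kscale (c : k) (u : kres M) : kres M := c%:MP_[n] *: (u : M).
Let kscaleA c c' u : kscale c (kscale c' u) = kscale (c * c') u.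
Proof. by rewrite /kscale scalerA mpolyCM. Qed.
Let kscale1 : left_id 1 kscale.
Proof. by move=> u; rewrite /kscale mpolyC1 scale1r. Qed.
Let kscaleDr : right_distributive kscale +%R.
Proof. by move=> c u v; exact: scalerDr. Qed.
Let kscaleDl u : {morph kscale^~ u : c c' / c + c'}.
Proof. by move=> c c'; rewrite /kscale mpolyCD scalerDl. Qed.
HB.instance Definition _ := GRing.Zmodule_isLmodule.Build k (kres M)
  kscaleA kscale1 kscaleDr kscaleDl.

Lemma kscaleE c (u : kres M) : c *: u = c%:MP_[n] *: (u : M) :> M.
Proof. by []. Qed.

Lemma kres_linearZ (V : lmodType k) (T : {linear kres M -> V}) c (u : M) :
  T (c%:MP_[n] *: u) = c *: T u.
Proof. exact: (linearZ_LR T c u). Qed.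

End Kres.

(** * Ideals generated by powers of variables, and regular modules *)

Section GradedIdeals.
Variables (n : nat) (k : fieldType).
Local Notation deg := 'rV[int]_n.
Local Notation R := {mpoly k[n]}.
Local Notation "''x_' m" := ('X_[k, m] : R) (at level 2, m at level 2).

Lemma mnm_ind (P : 'X_{1..n} -> Prop) : P 0%MM ->
  (forall i m, P m -> P (m + U_(i))%MM) -> forall m, P m.
Proof.
move=> P0 PS m; move: {2}(mdeg m) (erefl (mdeg m)) => N; elim: N m => [|N IH] m hm.
  by move/eqP: hm; rewrite mdeg_eq0 => /eqP ->.
have [i mi|h] := pickP (fun i => m i != 0%N); last first.
  suff m0 : m = 0%MM by rewrite m0 mdeg0 in hm.
  by apply/mnmP => i; rewrite mnm0E; move/negbFE/eqP: (h i).
have le : (U_(i) <= m)%MM.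
  apply/mnm_lepP => j; rewrite mnm1E; case: eqP => [<-|] //=; by rewrite lt0n.
rewrite -(submK le); apply: PS; apply: IH.
by apply: succn_inj; rewrite -hm -{2}(submK le) mdegD mdeg1 addn1.
Qed.

Section OneModule.
Variable M : pmod n k.
Implicit Types (u v : M) (d e : deg) (G : deg -> M -> Prop) (S : {set 'I_n}) (c m : 'X_{1..n}).

Definition graded_submod G : Prop :=
  [/\ forall d, G d 0, forall d u v, G d u -> G d v -> G d (u - v),
      forall d a u, G d u -> G d (a%:MP_[n] *: u)
    & forall d m u, G d u -> G (d + mdegZ m) ('x_m *: u)].

(** The degree-d part of the submodule generated by the x_j^(c j) G. The coefficient family G is a
    parameter because the arguments move coefficients between M, the kernel of a morphism and
    D_sigma M. *)
Definition gid G c S d u : Prop := exists f : 'I_n -> M,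
  (forall j, j \in S -> G (d - mdegZ (U_(j) *+ c j)%MM) (f j)) /\
  u = \sum_(j in S) 'x_(U_(j) *+ c j)%MM *: f j.

Lemma graded_submod_comp : graded_submod (pm_comp M).
Proof.
split=> *; [exact: pm_comp0|exact: pm_compB|exact: comp_c|exact: comp_x].
Qed.

Section Closed.
Variable G : deg -> M -> Prop.
Hypothesis hG : graded_submod G.

Lemma gsub0 d : G d 0. Proof. by case: hG. Qed.
Lemma gsubB d u v : G d u -> G d v -> G d (u - v).
Proof. by case: hG => _ h _ _; exact: h. Qed.
Lemma gsubN d u : G d u -> G d (- u).
Proof. by move=> h; rewrite -sub0r; apply: gsubB => //; exact: gsub0. Qed.
Lemma gsubD d u v : G d u -> G d v -> G d (u + v).
Proof. by move=> hu hv; rewrite -[v]opprK; apply: gsubB => //; exact: gsubN. Qed.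
Lemma gsub_c d a u : G d u -> G d (a%:MP_[n] *: u).
Proof. by case: hG => _ _ h _; exact: h. Qed.
Lemma gsub_x d m u : G d u -> G (d + mdegZ m) ('x_m *: u).
Proof. by case: hG => _ _ _ h; exact: h. Qed.
Lemma gsub_xK d m u : G (d - mdegZ m) u -> G d ('x_m *: u).
Proof. by move=> /(gsub_x m); rewrite subrK. Qed.
Lemma gsub_sum d (I : finType) (P : pred I) (F : I -> M) :
  (forall i, P i -> G d (F i)) -> G d (\sum_(i | P i) F i).
Proof. by move=> hF; apply: big_ind => [|x y|//]; [exact: gsub0|exact: gsubD]. Qed.

End Closed.

Section Closed.
Variable G : deg -> M -> Prop.
Hypothesis hG : graded_submod G.

Lemma gid_sub c S d u : gid G c S d u -> G d u.
Proof. by move=> [f [hf ->]]; apply: gsub_sum => // j jS; apply: gsub_xK => //; exact: hf. Qed.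

Lemma gid_submod c S : graded_submod (gid G c S).
Proof.
split=> [d|d _ _ [f [hf ->]] [g [hg ->]]|d a _ [f [hf ->]]|d m _ [f [hf ->]]].
- by exists (fun=> 0); split=> [j _|]; [exact: gsub0|rewrite big1 // => j _; rewrite scaler0].
- exists (fun j => f j - g j); split=> [j jS|]; first by apply: gsubB => //; [exact: hf|exact: hg].
  by rewrite -sumrB; apply: eq_bigr => j _; rewrite scalerBr.
- exists (fun j => a%:MP *: f j); split=> [j jS|]; first by apply: gsub_c => //; exact: hf.
  by rewrite scaler_sumr; apply: eq_bigr => j _; rewrite cactC.
- exists (fun j => 'x_m *: f j); split=> [j jS|]; first by rewrite addrAC; apply: gsub_x => //; exact: hf.
  by rewrite scaler_sumr; apply: eq_bigr => j _; rewrite xactC.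
Qed.

Lemma gid_gen c S d j v : j \in S -> G (d - mdegZ (U_(j) *+ c j)%MM) v ->
  gid G c S d ('x_(U_(j) *+ c j)%MM *: v).
Proof.
move=> jS hv; exists (fun i => if i == j then v else 0); split=> [i iS|].
  by case: eqP => [->|_] //; exact: gsub0.
rewrite (bigD1 j) //= eqxx big1 ?addr0 // => i /andP[_ /negbTE ->].
by rewrite scaler0.
Qed.

Lemma gid_mono c S S' d u : S \subset S' -> gid G c S d u -> gid G c S' d u.
Proof.
move=> /fintype.subsetP sS [f [hf ->]]; apply: gsub_sum => [|j jS].
  exact: gid_submod.
by apply: gid_gen; [exact: sS|exact: hf].
Qed.
End Closed.

Lemma gid_weaken G G' c S d u : (forall e v, G e v -> G' e v) ->
  gid G c S d u -> gid G' c S d u.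
Proof. by move=> GG [f [hf ->]]; exists f; split=> // j /hf /GG. Qed.

Lemma gid_eqc G c c' S d u : (forall j, j \in S -> c j = c' j) ->
  gid G c S d u -> gid G c' S d u.
Proof.
move=> e [f [hf ->]]; exists f; split=> [j jS|]; first by rewrite -e //; exact: hf.
by apply: eq_bigr => j jS; rewrite e.
Qed.

Lemma gid_set0 G c d u : gid G c finset.set0 d u -> u = 0.
Proof. by move=> [f [_ ->]]; rewrite big_set0. Qed.

Lemma gid_split G c S d u i : i \in S -> gid G c S d u -> exists2 v,
  G (d - mdegZ (U_(i) *+ c i)%MM) v & gid G c (S :\ i) d (u - 'x_(U_(i) *+ c i)%MM *: v).
Proof.
move=> iS [f [hf ->]]; exists (f i); first exact: hf.
exists f; split=> [j|]; first by rewrite inE => /andP[_]; exact: hf.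
by rewrite (big_setD1 i) //= addrAC subrr add0r.
Qed.

(* Equivalent to flatness: vanishing of Tor_1(R/p_sigma, M) for all sigma is enough,
   and it amounts to x_i being a nonzerodivisor modulo any set of other variables. *)
Definition regular : Prop := forall c S i d u, i \notin S -> pm_comp M d u ->
  gid (pm_comp M) c S (d + mdegZ U_(i)) ('x_U_(i) *: u) -> gid (pm_comp M) c S d u.

Local Notation Id := (gid (pm_comp M)).
Let gM := graded_submod_comp.

Section Regular.
Hypothesis rM : regular.

Lemma regular_x c S m d u : (forall j, j \in S -> m j = 0%N) -> pm_comp M d u ->
  Id c S (d + mdegZ m) ('x_m *: u) -> Id c S d u.
Proof.
move: m d u; apply: mnm_ind => [d u _ _|i m IH d u hm hu].
  by rewrite mdegZ0 addr0 xact0.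
rewrite addmC mdegZD xactD [mdegZ U_(i) + _]addrC addrA => h.
have iS : i \notin S by apply/negP => /hm; rewrite mnmDE mnm1E eqxx addn1.
apply: IH => // [j /hm|]; first by rewrite mnmDE => /eqP; rewrite addn_eq0 => /andP[/eqP].
by apply: rM h => //; exact: comp_x.
Qed.

Lemma regular_inj m : injective (fun u : M => 'x_m *: u).
Proof.
have inj0 d u : pm_comp M d u -> 'x_m *: u = 0 -> u = 0.
  move=> hu e; apply: (@gid_set0 (pm_comp M) 0%MM d); apply: (@regular_x _ _ m) => //.
    by move=> j; rewrite inE.
  by rewrite e; apply: gsub0; exact: gid_submod.
move=> u v /eqP; rewrite -subr_eq0 -scalerBr => /eqP e.
apply/eqP; rewrite -subr_eq0; apply/eqP.
rewrite [_ - _]hsuppE big1 // => d _; apply: (inj0 d); first exact: hcompP.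
by rewrite -hcomp_x e hcomp0.
Qed.

Definition ones : 'X_{1..n} := [multinom 1%N | i < n].

Lemma onesE i : ones i = 1%N. Proof. by rewrite mnmE. Qed.

(** The colon ideal (x_j^(m j + 1)) : x^m is (x_j), for a regular sequence. Variables of m are
    removed one at a time: for i in S, x_i v is x_i^(c i + 1) w modulo the other powers, and x_i
    cancels from x_i (v - x_i^(c i) w). *)
Lemma regular_shrink S m d u : pm_comp M d u ->
  Id (m + ones)%MM S (d + mdegZ m) ('x_m *: u) -> Id ones S d u.
Proof.
move=> hu; move: m; apply: mnm_ind => [|i m IH].
  by rewrite mdegZ0 addr0 xact0 add0m.
rewrite {2 3}[(m + _)%MM]addmC mdegZD xactD [mdegZ U_(i) + _]addrC addrA => h.
apply: IH; set v := 'x_m *: u; have hv : pm_comp M (d + mdegZ m) v by exact: comp_x.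
have [iS|iS] := boolP (i \in S); last first.
  apply: rM (iS) hv _; apply: gid_eqc h => j jS; rewrite !mnmDE mnm1E.
  by case: eqP => [e|_]; [move: iS; rewrite e jS|rewrite addn0].
have [w hw h'] := gid_split iS h.
set c := (m + ones)%MM.
have ci : (m + U_(i) + ones)%MM i = (c i).+1 by rewrite !mnmDE mnm1E eqxx onesE !addn1.
rewrite ci in hw h'.
have hw' : pm_comp M (d + mdegZ m) ('x_(U_(i) *+ c i)%MM *: w).
  by move: (comp_x (U_(i) *+ c i)%MM hw); rewrite mulmS mdegZD opprD addrA addrK subrK.
have -> : v = (v - 'x_(U_(i) *+ c i)%MM *: w) + 'x_(U_(i) *+ c i)%MM *: w by rewrite subrK.
apply: gsubD; first exact: gid_submod; last first.
  apply: gid_gen => //; move: hw.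
  by rewrite mulmS mdegZD opprD addrA addrK.
apply: (@gid_mono _ gM _ (S :\ i)); first exact: subD1set.
apply: (rM (i := i)); rewrite ?inE ?eqxx //; first exact: pm_compB.
move: h'; rewrite scalerBr mulmS xactD => h'; apply: gid_eqc h' => j; rewrite !inE => /andP[ji _].
by rewrite !mnmDE mnm1E eq_sym (negbTE ji) addn0.
Qed.
End Regular.
End OneModule.

Lemma surj_hom (M N : pmod n k) (f : pmor M N) d v : Defs.surj f -> pm_comp N d v ->
  exists2 u, pm_comp M d u & f u = v.
Proof.
move=> sf hv; have [u e] := sf v; exists (hcomp u d); first exact: hcompP.
by rewrite pmor_hcomp e hcomp_id.
Qed.

Lemma pmor_gid (M N : pmod n k) (f : pmor M N) c S d u :
  gid (pm_comp M) c S d u -> gid (pm_comp N) c S d (f u).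
Proof.
move=> [g [hg ->]]; exists (f \o g); split=> [j /hg h|]; first exact: pmor_deg.
by rewrite raddf_sum; apply: eq_bigr => j _; rewrite /= linearZ_LR.
Qed.

Lemma ker_submod (M N : pmod n k) (f : pmor M N) :
  graded_submod (fun d u => pm_comp M d u /\ f u = 0).
Proof.
split=> [d|d u v [hu fu] [hv fv]|d a u [hu fu]|d m u [hu fu]].
- by rewrite raddf0; split=> //; exact: pm_comp0.
- by rewrite raddfB /= fu fv subrr; split=> //; exact: pm_compB.
- by rewrite /= linearZ_LR fu scaler0; split=> //; exact: comp_c.
- by rewrite /= linearZ_LR fu scaler0; split=> //; exact: comp_x.
Qed.

(* Tor_1(R/(x_j^(c_j), j in S), F) = 0. *)
Lemma ker_gid (P F : pmod n k) (f : pmor P F) c S d u : Defs.surj f -> regular F ->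
  f u = 0 -> gid (pm_comp P) c S d u ->
  gid (fun d u => pm_comp P d u /\ f u = 0) c S d u.
Proof.
move=> sf rF; have hK := ker_submod f; have hP := graded_submod_comp P.
have hF := graded_submod_comp F.
move: {2}#|S| (erefl #|S|) => N; elim: N S u => [|N IH] S u cS fu hu.
  move/eqP: cS; rewrite cards_eq0 => /eqP S0; move: hu; rewrite S0 => /gid_set0 ->.
  by apply: gsub0; exact: gid_submod.
have [i iS] : exists i, i \in S by apply/set0Pn; rewrite -card_gt0 cS.
have [v hv hw] := gid_split iS hu; set x := 'x_(_) in hw; set w := u - _ in hw.
have fv : gid (pm_comp F) c (S :\ i) (d - mdegZ (U_(i) *+ c i)%MM) (f v).
  apply: (regular_x rF (m := (U_(i) *+ c i)%MM)).
  - by move=> j; rewrite !inE mulmnE mnm1E eq_sym => /andP[/negbTE ->].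
  - exact: pmor_deg.
  rewrite subrK; have := pmor_gid f hw; rewrite raddfB /= fu sub0r /= linearZ_LR.
  by move=> /(gsubN (gid_submod hF _ _)); rewrite opprK.
case: fv => g [hg eg].
(* Lifting to P the relation that puts f v in the ideal of the other powers gives v' with v - v' in
   the kernel; the correction x v' joins the terms that do not involve i. *)
have /choice[q hq] j : exists q, j \in S :\ i ->
    pm_comp P (d - mdegZ (U_(i) *+ c i)%MM - mdegZ (U_(j) *+ c j)%MM) q /\ f q = g j.
  have [/hg h|h] := boolP (j \in S :\ i); last by exists 0.
  by have [q h1 h2] := surj_hom sf h; exists q.
pose v' := \sum_(j in S :\ i) 'x_(U_(j) *+ c j)%MM *: q j.
have hv' : gid (pm_comp P) c (S :\ i) (d - mdegZ (U_(i) *+ c i)%MM) v'.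
  by exists q; split=> // j /hq[].
have fv' : f (v - v') = 0.
  rewrite raddfB /= eg raddf_sum /= -sumrB big1 // => j /hq[_ e].
  by rewrite /= linearZ_LR e subrr.
have -> : u = x *: (v - v') + (w + x *: v').
  by rewrite scalerBr addrCA subrK /w subrK.
apply: gsubD; first exact: gid_submod.
  apply: gid_gen => //; split=> //; apply: pm_compB => //.
  by apply: gid_sub hv'.
apply: (@gid_mono _ _ hK _ (S :\ i)); first exact: subD1set.
apply: IH.
- by move: cS; rewrite (cardsD1 i) iS => -[].
- have := fu; rewrite {1}(_ : u = x *: (v - v') + (w + x *: v')); last first.
    by rewrite scalerBr addrCA subrK /w subrK.
  by rewrite raddfD /= /= linearZ_LR fv' scaler0 add0r.
apply: gsubD => //; first exact: gid_submod.
rewrite -[d](subrK (mdegZ (U_(i) *+ c i)%MM)).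
by apply: gsub_x => //; exact: gid_submod.
Qed.

End GradedIdeals.

(** * Sums of copies of R_sigma(-a) *)

Ltac dlia := repeat match goal with
  | |- context [@fun_of_matrix ?T ?m ?p ?d ?a ?i] =>
      move: (@fun_of_matrix T m p d a i) => ?
  end; lia.

Section Traced.
Variables (n : nat) (k : fieldType).
Local Notation deg := 'rV[int]_n.
Local Notation R := {mpoly k[n]}.
Local Notation "''x_' m" := ('X_[k, m] : R) (at level 2, m at level 2).
Implicit Types (d e a M : deg) (sigma S : {set 'I_n}).

Definition ledeg d e : bool := [forall i, (d 0 i <= e 0 i)].

(** Inverse to [mdegZ] on nonnegative degrees, as in [absmK]; elsewhere the absolute values are
    junk. *)
Definition absm d : 'X_{1..n} := [multinom absz (d 0%R i) | i < n].

Lemma ledegP d e : reflect (forall i, (d 0 i <= e 0 i)) (ledeg d e).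
Proof. exact: forallP. Qed.

Lemma ledeg_trans d e a : ledeg d e -> ledeg e a -> ledeg d a.
Proof. by move=> /ledegP h /ledegP h'; apply/ledegP => i; move: (h i) (h' i); dlia. Qed.

Lemma absmK d e : ledeg d e -> d + mdegZ (absm (e - d)) = e.
Proof.
move=> /ledegP h; apply/rowP => i; rewrite !mxE mnmE !mxE.
by move: (h i); dlia.
Qed.

Definition updeg d e : deg := \row_i (if (d 0 i <= e 0 i) then e 0 i else d 0 i).

Lemma ledeg_upl d e : ledeg d (updeg d e).
Proof. by apply/ledegP => i; rewrite mxE; case: ifP => // _; dlia. Qed.

Lemma ledeg_upr d e : ledeg e (updeg d e).
Proof. by apply/ledegP => i; rewrite mxE; case: ifP; dlia. Qed.

Lemma ledeg_bound (s : seq deg) : exists M, forall d, d \in s -> ledeg d M.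
Proof.
elim: s => [|d s [M hM]]; first by exists 0.
exists (updeg d M) => e; rewrite inE => /orP[/eqP ->|/hM h]; first exact: ledeg_upl.
by apply: ledeg_trans h _; exact: ledeg_upr.
Qed.

Section Push.
Variable P : pmod n k.
Implicit Types u v : P.

(** The default 0 keeps this additive in u for every M, so that [push] is defined before M is chosen
    large. *)
Definition xto M d u : P := if ledeg d M then 'x_(absm (M - d)) *: u else 0.

Lemma xtoD M d u v : xto M d (u + v) = xto M d u + xto M d v.
Proof. by rewrite /xto; case: ifP; rewrite ?addr0 // scalerDr. Qed.

(* The image of u in the degree-M part, all x_i being treated as 1. *)
Definition push M : P -> P := hsum (xto M).

Lemma pushD M : {morph push M : u v / u + v}.
Proof. by apply: hsumD => *; exact: xtoD. Qed.

Lemma push1 M d u : pm_comp P d u -> push M u = xto M d u.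
Proof. by apply: hsum1 => *; exact: xtoD. Qed.

Lemma push0 M : push M 0 = 0.
Proof. by apply: (@addrI _ (push M 0)); rewrite -pushD !addr0. Qed.

Lemma push_c M (c : k) u : push M (c%:MP_[n] *: u) = c%:MP *: push M u.
Proof.
move: u; apply: homogeneous_ind => [|u v hu hv|d u hu]; first by rewrite scaler0 push0 scaler0.
  by rewrite scalerDr !pushD hu hv scalerDr.
rewrite (push1 _ hu) (push1 _ (comp_c c hu)) /xto.
by case: ifP; rewrite ?scaler0 // cactC.
Qed.

Lemma push_x M d m u : pm_comp P d u -> ledeg (d + mdegZ m) M ->
  push M ('x_m *: u) = push M u.
Proof.
move=> hu le; rewrite (push1 _ hu) (push1 _ (comp_x m hu)) /xto le.
have -> : ledeg d M.
  by apply/ledegP => i; move/ledegP/(_ i): le; rewrite !mxE; dlia.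
rewrite -xactD; congr ('X_[_] *: _); apply/mnmP => i; rewrite mnmDE !mnmE !mxE.
by move/ledegP/(_ i): le; rewrite !mxE; dlia.
Qed.

Lemma push_inv (V : zmodType) (l : {additive P -> V}) M u :
  (forall m v, l ('x_m *: v) = l v) ->
  (forall d, d \in hsupp u -> ledeg d M) -> l (push M u) = l u.
Proof.
move=> lx hM; rewrite {2}[u]hsuppE raddf_sum /push /hsum raddf_sum.
by apply: eq_big_seq => d /hM h; rewrite /xto h lx.
Qed.

(* The span of the x_i u - u and of the components of degree outside the support
   of R_sigma(-a): a morphism to R_sigma(-a) is a functional vanishing on it. *)
Definition offspan sigma a u : Prop := exists M0, forall M, ledeg M0 M ->
  gid (pm_comp P) (absm (M - a) + ones n)%MM (~: sigma) M (push M u).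

Variables (sigma : {set 'I_n}) (a : deg).
Let gid_cl M := gid_submod (graded_submod_comp P) (absm (M - a) + ones n)%MM (~: sigma).

Lemma offspan_closed : lin_closed (offspan sigma a : kres P -> Prop).
Proof.
split; first by exists 0 => M _; rewrite push0; exact: (gsub0 (gid_cl M)).
move=> c u v [M hM] [M' hM']; exists (updeg M M') => N hN.
rewrite pushD kscaleE push_c; apply: (gsubD (gid_cl N)).
  by apply: (gsub_c (gid_cl N)); apply: hM; apply: ledeg_trans hN; exact: ledeg_upl.
by apply: hM'; apply: ledeg_trans hN; exact: ledeg_upr.
Qed.

Lemma offspan_x d m u : pm_comp P d u -> offspan sigma a ('x_m *: u - u).
Proof.
move=> hu; exists (d + mdegZ m) => M hM.
rewrite pushD -[- u]scaleN1r -mpolyC1 -mpolyCN push_c (push_x hu hM).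
by rewrite mpolyCN mpolyC1 scaleN1r subrr; exact: (gsub0 (gid_cl M)).
Qed.

(** Since d i < a i, pushing u to degree M multiplies it by x_i at least M i - a i + 1 times. This
    is the origin of the exponent in [offspan]: lowering M i by it gives a i - 1, the first degree
    outside the support. *)
Lemma offspan_out d u i : i \notin sigma -> (d 0 i < a 0 i) -> pm_comp P d u ->
  offspan sigma a u.
Proof.
move=> iS lt hu; exists (updeg d a) => M hM.
have dM : ledeg d M := ledeg_trans (ledeg_upl d a) hM.
have aM : ledeg a M := ledeg_trans (ledeg_upr d a) hM.
rewrite (push1 _ hu) /xto dM; set c := (_ + _)%MM.
have le : (U_(i) *+ c i <= absm (M - d))%MM.
  apply/mnm_lepP => j; rewrite mulmnE mnm1E; case: eqP => [<-|_]; last by rewrite mul0n.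
  rewrite mul1n /c mnmDE !mnmE !mxE.
  by move/ledegP/(_ i): dM; move/ledegP/(_ i): aM; move: lt; dlia.
rewrite -(submK le) addmC xactD; apply: (gid_gen (graded_submod_comp P)).
  by rewrite inE.
have := comp_x (absm (M - d) - U_(i) *+ c i)%MM hu; congr (pm_comp P _ _).
by apply: (@addIr _ (mdegZ (U_(i) *+ c i)%MM)); rewrite subrK -addrA -mdegZD submK ?absmK.
Qed.
End Push.

Lemma push_pmor (P Q : pmod n k) (f : pmor P Q) M u : f (push M u) = push M (f u).
Proof.
move: u; apply: homogeneous_ind => [|u v hu hv|d u hu]; first by rewrite push0 !raddf0 push0.
  by rewrite pushD !raddfD /= pushD hu hv.
rewrite (push1 _ hu) (push1 _ (pmor_deg f hu)) /xto; case: ifP => _; last exact: raddf0.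
by rewrite linearZ_LR.
Qed.

(* N is a sum of copies of R_sigma(-a), T adding up the coefficients: V is a
   vector space of which the components of N are copies inside the support of
   R_sigma(-a). *)
Definition traced sigma a (V : lmodType k) (N : pmod n k) (T : {linear kres N -> V}) : Prop :=
  [/\ forall m (u : N), T ('x_m *: u : N) = T u,
      forall d (u : N), pm_comp N d u -> T u = 0 -> u = 0,
      forall d (u : N) i, i \notin sigma -> (d 0 i < a 0 i) -> pm_comp N d u -> u = 0
    & forall d v, (forall i, i \notin sigma -> (a 0 i <= d 0 i)) ->
        exists2 u : N, pm_comp N d u & T u = v].

Section TracedTheory.
Variables (sigma : {set 'I_n}) (a : deg) (V : lmodType k) (N : pmod n k).
Variable T : {linear kres N -> V}.
Hypothesis trN : traced sigma a T.

Lemma traced_x m (u : N) : T ('x_m *: u : N) = T u. Proof. by case: trN. Qed.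

Lemma traced_inj d (u v : N) : pm_comp N d u -> pm_comp N d v -> T u = T v -> u = v.
Proof.
case: trN => _ h _ _ hu hv e; apply/eqP; rewrite -subr_eq0; apply/eqP.
by apply: (h d); [exact: pm_compB|rewrite raddfB /= e subrr].
Qed.

Lemma traced_out d (u : N) i : i \notin sigma -> (d 0 i < a 0 i) -> pm_comp N d u -> u = 0.
Proof. by case: trN => _ _ h _; exact: h. Qed.

Lemma traced_onto d v : (forall i, i \notin sigma -> (a 0 i <= d 0 i)) ->
  exists2 u : N, pm_comp N d u & T u = v.
Proof. by case: trN => _ _ _ h; exact: h. Qed.

Lemma traced_supp d (u : N) : pm_comp N d u -> u != 0 ->
  forall i, i \notin sigma -> (a 0 i <= d 0 i).
Proof.
move=> hu u0 i iS; rewrite Order.TotalTheory.leNgt; apply/negP => lt; move/eqP: u0; apply.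
exact: traced_out iS lt hu.
Qed.

Lemma traced_div d (u : N) j c : pm_comp N d u ->
  (j \notin sigma -> (a 0 j <= d 0 j - c%:Z)) ->
  exists2 v : N, pm_comp N (d - mdegZ (U_(j) *+ c)%MM) v & u = 'x_(U_(j) *+ c)%MM *: v.
Proof.
move=> hu hj; have [->|u0] := eqVneq u 0; first by exists 0; [exact: pm_comp0|rewrite scaler0].
have [i iS|v hv e] := @traced_onto (d - mdegZ (U_(j) *+ c)%MM) (T u).
  rewrite !mxE mulmnE mnm1E; have := traced_supp hu u0 iS.
  by case: eqP => [e|_]; [rewrite -e in iS *; move: (hj iS); dlia|dlia].
exists v => //; apply: (traced_inj hu); last by rewrite traced_x.
by move: (comp_x (U_(j) *+ c)%MM hv); rewrite subrK.
Qed.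

(** In N the degree alone decides divisibility. If x_i u is a nonzero combination of the x_j^(c j) f
    j, some f j is nonzero, so its degree lies in the support; as j differs from i, x_j^(c j)
    already divides u. *)
Lemma traced_regular : regular N.
Proof.
move=> c S i d u iS hu [f [hf e]].
have [->|u0] := eqVneq u 0; first by apply: gsub0; apply: gid_submod; exact: graded_submod_comp.
have [j jS fj0] : exists2 j, j \in S & f j != 0.
  apply: contrapT => nj; move/eqP: u0; apply; apply: (traced_inj hu (pm_comp0 N d)).
  rewrite -(traced_x U_(i)%MM u) e !raddf_sum raddf0 big1 // => j jS.
  rewrite [LHS]traced_x (_ : f j = 0) ?raddf0 //; apply/eqP; apply: contraT => h.
  by case: nj; exists j.
have [|v hv ->] := @traced_div d u j (c j) hu.
  move=> js; have := traced_supp (hf j jS) fj0 js; rewrite !mxE mulmnE !mnm1E eqxx.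
  by have /negbTE -> : i != j; [apply/eqP => ij; move: iS; rewrite ij jS|dlia].
by apply: gid_gen => //; exact: graded_submod_comp.
Qed.

Lemma traced_hom (P : pmod n k) (l : {linear kres P -> V}) :
  (forall u, offspan sigma a u -> l u = 0) ->
  exists f : pmor P N, forall u, T (f u) = l u.
Proof.
move=> lW.
have lx d m (u : P) : pm_comp P d u -> l ('x_m *: u : P) = l u.
  by move=> hu; apply/eqP; rewrite -subr_eq0 -raddfB; apply/eqP/lW/offspan_x/hu.
have /choice[phi hphi] (p : deg * P) : exists u : N, pm_comp P p.1 p.2 ->
    pm_comp N p.1 u /\ T u = l p.2.
  have [hp|//] := pselect (pm_comp P p.1 p.2); last by exists 0.
  have [hs|hs] := pselect (forall i, i \notin sigma -> (a 0 i <= p.1 0 i)).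
    by have [u h1 h2] := traced_onto (l p.2) hs; exists u.
  (* Outside the support 0 is the only candidate, and l vanishes there by [offspan_out]. *)
  exists 0 => _; split; [exact: pm_comp0|rewrite raddf0; symmetry].
  apply: contrapT => l0; apply: hs => i iS; rewrite Order.TotalTheory.leNgt; apply/negP => lt.
  by apply: l0; apply: lW; exact: offspan_out iS lt hp.
have [|||f hf] := @pmor_build _ _ P N (fun d u => phi (d, u)); last 1 first.
- have fd d (u : P) : pm_comp P d u -> pm_comp N d (f u).
    by move=> hu; rewrite (hf d) //; case: (hphi (d, u) hu).
  exists (PMor fd); apply: (@linear_eq_hom _ _ P V (T \o f) l) => d u hu /=.
  by rewrite (hf d) //; case: (hphi (d, u) hu).
- move=> d u v hu hv; have [h1 e1] := hphi (d, u) hu; have [h2 e2] := hphi (d, v) hv.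
  have [h3 e3] := hphi (d, u + v) (pm_compD hu hv).
  by apply: (traced_inj h3); [exact: pm_compD|rewrite e3 [RHS]raddfD /= e1 e2 [LHS]raddfD].
- move=> d c u hu; have [h1 e1] := hphi (d, u) hu.
  have [h2 e2] := hphi (d, c%:MP *: u) (comp_c c hu).
  apply: (traced_inj h2); first exact: comp_c.
  by rewrite e2 !kres_linearZ e1.
- move=> d m u hu; have [h1 e1] := hphi (d, u) hu.
  have [h2 e2] := hphi (d + mdegZ m, 'x_m *: u) (comp_x m hu).
  by apply: (traced_inj h2); [exact: comp_x|rewrite e2 traced_x e1 (lx d)].
Qed.

(* Ext^1(F, N) = 0 for regular F. *)
Lemma traced_extend (P2 P1 P0 F : pmod n k) (d2 : pmor P2 P1) (d1 : pmor P1 P0)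
    (aug : pmor P0 F) (phi : pmor P1 N) :
  Defs.surj aug -> exact_at d1 aug -> exact_at d2 d1 -> regular F ->
  (forall u, phi (d2 u) = 0) -> exists psi : pmor P0 N, forall u, phi u = psi (d1 u).
Proof.
move=> saug ex0 ex1 rF phi0.
(* This makes the partial functional d1 u + w |-> T (phi u), with w in [offspan], well defined. For
   large M, [ker_gid] writes d1 (push M u) with coefficients in the kernel of [aug], that is d1 (g
   j). By exactness phi (push M u) is the same combination of the phi (g j), whose degree at j is a
   j - 1, so they vanish. *)
have key u : offspan sigma a (d1 u) -> T (phi u) = 0.
  move=> [M0 hM0]; have [M1 hM1] := ledeg_bound (hsupp u).
  pose M := updeg a (updeg M0 M1).
  have aM : ledeg a M by exact: ledeg_upl.
  have M0M : ledeg M0 M := ledeg_trans (ledeg_upl _ _) (ledeg_upr _ _).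
  have uM d : d \in hsupp u -> ledeg d M.
    by move=> /hM1 h; apply: ledeg_trans h (ledeg_trans (ledeg_upr _ _) (ledeg_upr _ _)).
  have := hM0 M M0M; rewrite -push_pmor => /(ker_gid saug rF) [].
    by apply/ex0; exists (push M u).
  move=> f [hf ef].
  have /choice[g hg] j : exists g, j \in ~: sigma ->
      pm_comp P1 (M - mdegZ (U_(j) *+ (absm (M - a) + ones n)%MM j)%MM) g /\ f j = d1 g.
    have [/hf[h1 /ex0[g e]]|h] := boolP (j \in ~: sigma); last by exists 0.
    eexists (hcomp g _) => _; split; first exact: hcompP.
    by rewrite pmor_hcomp -e hcomp_id.
  have /ex1[z ez] : d1 (push M u -
      \sum_(j in ~: sigma) 'x_(U_(j) *+ (absm (M - a) + ones n)%MM j)%MM *: g j) = 0.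
    rewrite raddfB /= ef raddf_sum -sumrB big1 // => j /hg[_ ->].
    by rewrite /= linearZ_LR subrr.
  have ephi : phi (push M u) = 0.
    have := phi0 z; rewrite -ez raddfB /= => /eqP; rewrite subr_eq0 => /eqP ->.
    rewrite raddf_sum big1 // => j js; rewrite /= linearZ_LR.
    have [hgj _] := hg j js; rewrite [phi _](_ : _ = 0) ?scaler0 //.
    apply: (traced_out (i := j)); [by move: js; rewrite inE| |exact: pmor_deg hgj].
    rewrite !mxE mulmnE mnm1E eqxx mnmDE !mnmE !mxE.
    by move/ledegP/(_ j): aM; dlia.
  have e : (T \o phi) (push M u) = (T \o phi) u.
    by apply: push_inv => // m v; rewrite /= linearZ_LR traced_x.
  by rewrite -[LHS]e /= ephi raddf0.
pose G0 (p : kres P0 * V) := exists u (w : P0),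
  [/\ offspan sigma a w, p.1 = d1 u + w & p.2 = T (phi u)].
have W0 := offspan_closed P0 sigma a.
have [||l hl] := @linear_extension _ _ _ G0.
- split=> [|c [x y] [x' y'] [u [w [/= h1 -> ->]]] [u' [w' [/= h1' -> ->]]]].
    by exists 0, 0; rewrite !raddf0 addr0; split=> //; exact: (proj1 W0).
  exists (c%:MP *: u + u'), ((c *: (w : kres P0) + w') : kres P0); split.
  + exact: (proj2 W0).
  + rewrite /= (raddfD d1) /= linearZ_LR kscaleE scalerDr -!addrA; congr (_ + _).
    by rewrite addrCA.
  + by rewrite /= (raddfD phi) /= linearZ_LR [RHS]raddfD /= kres_linearZ.
- move=> v [u [w [/= h1 /esym/eqP h2 ->]]]; apply: key.
  move: h2; rewrite addr_eq0 => /eqP ->.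
  by have := lin_closedZ W0 (-1) h1; rewrite scaleN1r.
have lW u : offspan sigma a u -> l u = 0.
  by move=> hu; apply: hl; exists 0, u; rewrite !raddf0 add0r.
have [psi hpsi] := traced_hom lW; exists psi.
apply: (@linear_eq_hom _ _ P1 N phi (psi \o d1)) => d u hu /=.
apply: (traced_inj (d := d)); [exact: pmor_deg|by do 2 apply: pmor_deg|].
by rewrite hpsi; symmetry; apply: hl; exists u, 0; rewrite addr0; split=> //; exact: (proj1 W0).
Qed.
End TracedTheory.
End Traced.

(** * Copies and products of R_sigma(-a) *)

Section Models.
Variables (n : nat) (k : fieldType).
Local Notation deg := 'rV[int]_n.
Local Notation R := {mpoly k[n]}.
Local Notation "''x_' m" := ('X_[k, m] : R) (at level 2, m at level 2).
Implicit Types (d e a : deg) (sigma S : {set 'I_n}).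

Lemma traced_shift sigma a (V : lmodType k) (N : pmod n k) (T : {linear kres N -> V}) e :
  traced sigma a T -> @traced n k sigma (a - e) V (shift N e) T.
Proof.
move=> [h1 h2 h3 h4]; split=> [//|d u hu|d u i iS lt hu|d v hv].
- exact: h2 hu.
- apply: (h3 (e + d) u i) => //; move: lt; rewrite !mxE; dlia.
- by have [|u hu eu] := h4 (e + d) v; [move=> i /hv; rewrite !mxE; dlia|exists u].
Qed.

Lemma freeg_family (B : choiceType) (X : lmodType k) (phi : X -> B -> k) :
  (forall c x y b, phi (c *: x + y) b = c * phi x b + phi y b) ->
  (forall x, finite_set [set b | phi x b != 0]%classic) ->
  exists l : {linear X -> {freeg B / k}}, forall x b, coeff b (l x) = phi x b.
Proof.
move=> lin fin.
have /choice[f hf] x : exists D : {freeg B / k}, forall b, coeff b D = phi x b.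
  have /finite_seqP[s es] := fin x.
  exists (\sum_(b <- undup s) << phi x b *g b >>) => b.
  rewrite raddf_sum /=; under eq_bigr do rewrite coeffU.
  have [bs|bs] := boolP (b \in undup s).
    rewrite (bigD1_seq b) ?undup_uniq //= eqxx mulr1 big1 ?addr0 // => c /negbTE ->.
    by rewrite mulr0.
  rewrite big_seq big1 => [|c cs]; last first.
    by case: eqP => [e|]; [rewrite -e cs in bs|rewrite mulr0].
  apply/esym/eqP; apply: contraNT bs => h; rewrite mem_undup.
  by have : ([set` s] b)%classic by rewrite -es.
have lf : linear f.
  by move=> c x y; apply/eqP/freeg_eqP => b; rewrite coeffD coeffZ !hf lin.
pose linf := GRing.isLinear.Build _ _ _ _ f lf.
pose F : {linear X -> {freeg B / k}} := HB.pack f linf.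
by exists F.
Qed.

Section Copies.
Variables (B : Type) (N : pmod n k).
Local Notation cval u := (@gsum_val n k B (fun _ : B => N) u).

Lemma gsum_hom d (v : B -> N) : (forall b, pm_comp N d (v b)) ->
  finite_set [set b | v b != 0]%classic ->
  exists2 u : pcopies B N, pm_comp (pcopies B N) d u & forall b, cval u b = v b.
Proof.
move=> hv fv; have fs : (v : dprod (fun _ : B => pm_sort N)) \in finsupp (M := fun _ : B => N).
  exact/asboolP.
by exists (GSum fs).
Qed.

Lemma gsum_eq (u v : pcopies B N) : (forall b, cval u b = cval v b) -> u = v.
Proof. by move=> h; apply/val_inj/dprodP. Qed.

Lemma traced_pcopies sigma a (T : {linear kres N -> k^o}) : traced sigma a T ->
  exists T' : {linear kres (pcopies B N) -> {freeg {classic B} / k}},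
    traced sigma a T' /\ forall (u : pcopies B N) b, coeff b (T' u) = T (cval u b).
Proof.
move=> trN; have [|u|T' hT'] := @freeg_family {classic B} (kres (pcopies B N))
    (fun (u : pcopies B N) (b : B) => T (cval u b)).
- by move=> c x y b; rewrite -[RHS]linearP.
- have /asboolP := valP (u : pcopies B N); apply: sub_finite_set => b /=.
  by apply: contraNN => /eqP e; rewrite [cval u b]e raddf0.
exists T'; split=> //; split=> [m u|d u hu e|d u i iS lt hu|d v hv].
- by apply/eqP/freeg_eqP => b; rewrite !hT' -[RHS](traced_x trN m).
- apply: gsum_eq => b; apply: (traced_inj trN (d := d)); first exact: hu.
    exact: pm_comp0.
  by rewrite -hT' e coeff0 [RHS]raddf0.
- by apply: gsum_eq => b; apply: (traced_out trN iS lt); exact: hu.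
have /choice[f hf] b : exists u : N, pm_comp N d u /\ T u = coeff (b : {classic B}) v.
  by have [u h1 h2] := traced_onto trN (coeff (b : {classic B}) v) hv; exists u.
have [b||u hu eu] := @gsum_hom d f.
- by case: (hf b).
- apply/(@finite_seqP {classic B}); exists (dom v); apply/seteqP; split=> b /= h.
    rewrite mem_dom; apply: contraNN h => /eqP e; apply/eqP.
    apply: (traced_inj trN (proj1 (hf b)) (pm_comp0 N d)).
    by rewrite (proj2 (hf b)) e raddf0.
  move: h; rewrite mem_dom; apply: contraNN => /eqP e.
  by rewrite -(proj2 (hf b)) e raddf0.
- by exists u => //; apply/eqP/freeg_eqP => b; rewrite hT' eu (proj2 (hf b)).
Qed.
End Copies.

Section Products.
Variables (I : Type) (M : I -> pmod n k).

Lemma gprod_hom d (v : forall i, M i) : (forall i, pm_comp (M i) d (v i)) ->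
  exists2 u : pprod M, pm_comp (pprod M) d u & forall i, gprod_val u i = v i.
Proof.
move=> hv; have bv : (v : dprod (fun i => pm_sort (M i))) \in bounded (M := M).
  by apply/asboolP; exists [:: d]; split=> // i; exact: in_degs1.
by exists (GProd bv).
Qed.

Lemma gprod_eq (u v : pprod M) : (forall i, gprod_val u i = gprod_val v i) -> u = v.
Proof. by move=> h; apply/val_inj/dprodP. Qed.

(** The family of the f i u is bounded because all its members live in the finitely many shifted
    degrees of u, whatever i is. *)
Lemma pprod_into (P : pmod n k) a (f : forall i, {linear P -> M i}) :
  (forall i d u, pm_comp P d u -> pm_comp (M i) (a + d) (f i u)) ->
  exists g : pmor P (shift (pprod M) a), forall u i, gprod_val (g u) i = f i u.
Proof.
move=> hf.
have /choice[g hg] u : exists w : pprod M, forall i, gprod_val w i = f i u.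
  have bu : (fun i => f i u : M i) \in bounded (M := M).
    apply/asboolP; exists [seq a + d | d <- hsupp u]; split.
      by rewrite map_inj_uniq ?hsupp_uniq //; exact: addrI.
    move=> i; exists (fun e => f i (hcomp u (e - a))); split=> [e|].
      by move: (hf i _ _ (hcompP u (e - a))); rewrite addrC subrK.
    rewrite big_map {1}[u]hsuppE raddf_sum; apply: eq_bigr => d _.
    by rewrite addrAC subrr add0r.
  by exists (GProd bu).
have lg : linear (g : P -> shift (pprod M) a).
  move=> r u v; apply: gprod_eq => i; rewrite hg linearP.
  by rewrite -[f i u]hg -[f i v]hg.
pose lin := GRing.isLinear.Build _ _ _ _ (g : P -> shift (pprod M) a) lg.
pose G : {linear P -> shift (pprod M) a} := HB.pack (g : P -> shift (pprod M) a) lin.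
have hG d u : pm_comp P d u -> pm_comp (shift (pprod M) a) d (G u).
  move=> hu; change (forall i, pm_comp (M i) (a + d) (gprod_val (g u : pprod M) i)) => i.
  by rewrite hg; exact: hf.
by exists (PMor hG) => u i; exact: hg.
Qed.

Lemma gprod_bigE (J : finType) (P : pred J) (F : J -> pprod M) i :
  gprod_val (\sum_(j | P j) F j : pprod M) i = \sum_(j | P j) gprod_val (F j) i.
Proof. by elim/big_rec2: _ => // j x y _ <-. Qed.

(** S is finite and the coefficients have prescribed degrees, so relations chosen in each factor
    assemble into one relation in the product. *)
Lemma gid_pprod (G : forall i, deg -> M i -> Prop) c S d (u : pprod M) :
  (forall i e v, G i e v -> pm_comp (M i) e v) ->
  (forall i, gid (G i) c S d (gprod_val u i)) ->
  gid (fun e (w : pprod M) => forall i, G i e (gprod_val w i)) c S d u.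
Proof.
move=> GM hu; pose f i := sval (cid (hu i)); have hf i := svalP (cid (hu i)).
have /choice[g hg] j : exists w : pprod M, j \in S -> forall i, gprod_val w i = f i j.
  have [jS|_] := boolP (j \in S); last by exists 0.
  have [|w _ ew] := @gprod_hom (d - mdegZ (U_(j) *+ c j)%MM) (fun i => f i j).
    by move=> i; apply: GM; exact: (proj1 (hf i)).
  by exists w.
exists g; split=> [j jS i|]; first by rewrite hg //; exact: (proj1 (hf i)).
apply: gprod_eq => i; rewrite gprod_bigE (proj2 (hf i)); apply: eq_bigr => j jS.
by have e := hg j jS i; rewrite /f in e; rewrite -e.
Qed.

Lemma pprod_regular : (forall i, regular (M i)) -> regular (pprod M).
Proof.
move=> rM c S i d u iS hu [f [hf e]]; apply: (gid_pprod (G := fun i => pm_comp (M i))) => // j.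
apply: rM iS (hu j) _; exists (fun l => gprod_val (f l) j); split=> [l lS|].
  exact: hf.
have := congr1 (fun w : pprod M => gprod_val w j) e.
by rewrite gprod_bigE => <-.
Qed.
End Products.

Section Loc.
Variable sigma : {set 'I_n}.
Local Notation ev := (meval (fun _ : 'I_n => 1 : k)).

Lemma ev_x m : ev 'x_m = 1.
Proof. by rewrite mevalX big1 // => i _; rewrite expr1n. Qed.

Lemma frac_ev (p q : R) m m' :
  (FracField.tofrac p / FracField.tofrac 'x_m : frac_mod n k) =
  (FracField.tofrac q / FracField.tofrac 'x_m') -> ev p = ev q.
Proof.
move/eqP; rewrite eqr_div ?tofrac_mnm_neq0 // -!rmorphM /= tofrac_eq => /eqP.
by move/(congr1 ev); rewrite !mevalM !ev_x !mulr1.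
Qed.

(** The trace is evaluation at x_i = 1 for all i. It is well defined on fractions with monomial
    denominator, and it is injective on each component because a homogeneous polynomial is a scalar
    times a monomial. *)
Lemma traced_Rloc : exists T : {linear kres (Rloc k sigma) -> k^o}, traced sigma 0 T.
Proof.
have /choice[f hf] (x : Rloc k sigma) : exists c : k^o, forall p m,
    loc_val x = (FracField.tofrac p / FracField.tofrac 'x_m : frac_mod n k) -> c = ev p.
  have /in_locP[p [m [_ e]]] := valP (x : Rloc k sigma).
  by exists (ev p) => q m' e'; apply: (@frac_ev _ _ m m'); rewrite -e -e'.
have reprx (x : Rloc k sigma) : exists p m,
    loc_val x = (FracField.tofrac p / FracField.tofrac 'x_m : frac_mod n k).
  by have /in_locP[p [m [_ e]]] := valP (x : Rloc k sigma); exists p, m.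
have lf : linear (f : kres (Rloc k sigma) -> k^o).
  move=> c x y; have [p [m e]] := reprx x; have [q [m' e']] := reprx y.
  rewrite (hf _ _ _ e) (hf _ _ _ e') (hf _ (c%:MP * p * 'x_m' + q * 'x_m) (m + m')%MM).
    by rewrite mevalD !mevalM !ev_x !mulr1 mevalC.
  have -> : loc_val (c *: x + y) = c%:MP_[n] *: loc_val (x : Rloc k sigma) + loc_val (y : Rloc k sigma) by [].
  rewrite e e' frac_scaleE mulrA addf_div ?tofrac_mnm_neq0 //.
  by rewrite mpolyXD !rmorphD !rmorphM.
pose lin := GRing.isLinear.Build _ _ _ _ (f : kres (Rloc k sigma) -> k^o) lf.
pose T : {linear kres (Rloc k sigma) -> k^o} := HB.pack (f : kres (Rloc k sigma) -> k^o) lin.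
exists T; split=> [m x|d x /loc_compP[p [m [hm hp e]]]|d x i iS lt /loc_compP[p [m [hm hp e]]]|d c hd].
- have [p [m' e]] := reprx x; rewrite [RHS](hf _ _ _ e) [LHS](hf _ ('x_m * p) m').
    by rewrite mevalM ev_x mul1r.
  have -> : loc_val ('x_m *: x) = 'x_m *: loc_val x by [].
  by rewrite e frac_scaleE mulrA -rmorphM.
- rewrite [T x](hf _ _ _ e) => ep; apply/val_inj; rewrite /= e.
  suff -> : p = 0 by rewrite rmorph0 mul0r.
  apply/eqP; apply: contraT => p0.
  have [|c [v [c0 ec]]] := @Rhomogeneous_ZX _ _ p _ p0; first by exists (d + mdegZ m).
  by move/eqP: ep; rewrite ec mevalZ ev_x mulr1 (negbTE c0).
- apply/val_inj; rewrite /= e; suff -> : p = 0 by rewrite rmorph0 mul0r.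
  apply/eqP; apply: contraT => p0; have := hp _ (mlead_supp p0).
  move/rowP/(_ i); move: lt; rewrite !mxE (hm i iS); dlia.
pose vp : 'X_{1..n} := [multinom absz (if (0 <= d 0%R i)%R then d 0%R i else 0%R) | i < n].
pose vm : 'X_{1..n} := [multinom absz (if (0 <= d 0%R i)%R then 0%R else d 0%R i) | i < n].
(* The monomial of degree d is x^vp / x^vm; its denominator only involves variables of sigma because
   d is nonnegative outside sigma. *)
have hx : loc_comp sigma d (FracField.tofrac (c *: 'x_vp) / FracField.tofrac 'x_vm : frac_mod n k).
  apply/loc_compP; exists (c *: 'x_vp), vm; split=> //.
    by move=> i /hd; rewrite mnmE mxE => ->.
  have -> : d + mdegZ vm = mdegZ vp; last exact: RdegZX.
  by apply/rowP => i; rewrite !mxE !mnmE; case: ifP; dlia.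
exists (Loc (loc_comp_in hx)); first exact: hx.
rewrite [LHS](hf _ (c *: 'x_vp) vm) //.
by rewrite mevalZ ev_x mulr1.
Qed.

End Loc.

Lemma traced_piece (j : face_deg n) (B : Type) :
  exists T : {linear kres (pcopies B (shift (Rloc k (fd_face j)) (- fd_deg j)))
              -> {freeg {classic B} / k}}, traced (fd_face j) (fd_deg j) T.
Proof.
have [T0 hT0] := traced_Rloc (fd_face j).
have hT1 := traced_shift (- fd_deg j) hT0; rewrite sub0r opprK in hT1.
by have [T [hT _]] := traced_pcopies B hT1; exists T.
Qed.

Lemma iso_regular (M N : pmod n k) : pm_iso M N -> regular N -> regular M.
Proof.
move=> [f [g [fg gf]]] rN c S i d u iS hu h; rewrite -[u]fg; apply: pmor_gid.
apply: rN iS _ _; first exact: pmor_deg.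
by rewrite -linearZ_LR; exact: pmor_gid.
Qed.

Lemma traced_pprod_extend (I : Type) (M : I -> pmod n k) (sigma : I -> {set 'I_n})
    (a : I -> deg) (V : I -> lmodType k) (T : forall i, {linear kres (M i) -> V i}) e
    (P2 P1 P0 F : pmod n k) (d2 : pmor P2 P1) (d1 : pmor P1 P0)
    (aug : pmor P0 F) (phi : pmor P1 (shift (pprod M) e)) :
  (forall i, traced (sigma i) (a i) (T i)) ->
  Defs.surj aug -> exact_at d1 aug -> exact_at d2 d1 -> regular F ->
  (forall u, phi (d2 u) = 0) ->
  exists psi : pmor P0 (shift (pprod M) e), forall u, phi u = psi (d1 u).
Proof.
move=> tr saug ex0 ex1 rF phi0.
have psiE i : exists psi : pmor P0 (shift (M i) e), forall u, gprod_val (phi u) i = psi (d1 u).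
  pose f (u : P1) : shift (M i) e := gprod_val (phi u) i.
  have lf : linear f by move=> r u v; rewrite /f linearP.
  pose lin := GRing.isLinear.Build _ _ _ _ f lf.
  pose L : {linear P1 -> shift (M i) e} := HB.pack f lin.
  have hL d u : pm_comp P1 d u -> pm_comp (shift (M i) e) d (L u).
    by move=> hu; exact: (pmor_deg phi hu).
  have [|psi hpsi] := traced_extend (traced_shift e (tr i)) (phi := PMor hL) saug ex0 ex1 rF.
    by move=> u; rewrite /= /f phi0.
  by exists psi => u; rewrite -hpsi.
pose psi i := sval (cid (psiE i)).
have hpsi i := svalP (cid (psiE i)).
have [|g hg] := @pprod_into I M P0 e (fun i => psi i : {linear P0 -> M i}).
  by move=> i d u hu; exact: (pmor_deg (psi i) hu).
by exists g => u; apply: gprod_eq => i; rewrite hg hpsi.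
Qed.

End Models.

(** * Extensions and the telescope of R_S *)

Section Ext.
Variables (n : nat) (k : fieldType).
Local Notation deg := 'rV[int]_n.
Local Notation R := {mpoly k[n]}.
Local Notation "''x_' m" := ('X_[k, m] : R) (at level 2, m at level 2).

(** The degrees a can be treated separately provided that only finitely many extensions are nonzero;
    the extension is therefore taken to be 0 whenever phi a is 0. *)
Lemma Ext1_eq0_of (F N : pmod n k) :
  (forall (P : proj_resolution F) a (phi : pmor (P 1%N) (shift N a)),
     (forall u, phi (res_d P 1 u) = 0) ->
     exists psi : pmor (P 0%N) (shift N a), forall u, phi u = psi (res_d P 0 u)) ->
  Ext1_eq0 F N.
Proof.
move=> H P phi phi0.
have ex a : exists psi : pmor (P 0%N) (shift N a),
    (forall u, phi a u = psi (res_d P 0 u)) /\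
    ((exists x, psi x <> 0) -> exists x, phi a x <> 0).
  have [[x hx]|nz] := pselect (exists x, phi a x <> 0).
    by have [psi hpsi] := H P a (phi a) (phi0 a); exists psi; split=> // _; exists x.
  have h0 d u : pm_comp (P 0%N) d u -> pm_comp (shift N a) d ((\0 : {linear P 0%N -> N}) u).
    by move=> _; exact: pm_comp0.
  exists (PMor (N := shift N a) h0); split=> [u|[x] //].
  by apply: contrapT => h; apply: nz; exists u.
pose psi a := sval (cid (ex a)); have hpsi a := svalP (cid (ex a)).
have fin : finite_set [set a | exists x, psi a x <> 0]%classic.
  by apply: sub_finite_set (ghom_fin phi) => a; exact: (proj2 (hpsi a)).
by exists (GHom fin) => a x; exact: (proj1 (hpsi a)).
Qed.

Lemma Ext1_eq0_extend (F N : pmod n k) (P : proj_resolution F) a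
    (phi : pmor (P 1%N) (shift N a)) :
  Ext1_eq0 F N -> (forall u, phi (res_d P 1 u) = 0) ->
  exists psi : pmor (P 0%N) (shift N a), forall u, phi u = psi (res_d P 0 u).
Proof.
move=> H phi0.
have ex b : exists f : pmor (P 1%N) (shift N b),
    forall u, (f u : N) = if b == a then phi u else 0.
  have [->|_] := eqVneq b a; first by exists phi.
  have h0 d u : pm_comp (P 1%N) d u -> pm_comp (shift N b) d ((\0 : {linear P 1%N -> N}) u).
    by move=> _; exact: pm_comp0.
  by exists (PMor (N := shift N b) h0).
pose f b := sval (cid (ex b)); have hf b := svalP (cid (ex b)).
have fin : finite_set [set b | exists x, f b x <> 0]%classic.
  apply: sub_finite_set (finite_set1 a) => b [x] /=; rewrite [f b x]hf.
  by case: eqP.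
have [b x|psi hpsi] := H P (GHom fin).
  by rewrite [LHS]hf phi0; case: ifP.
by exists (psi a) => u; rewrite -hpsi [RHS]hf eqxx.
Qed.

Definition pmor_comp (A B C : pmod n k) (g : pmor B C) (f : pmor A B) : pmor A C :=
  PMor (pmor_fun := g \o f) (fun d u hu => pmor_deg g (pmor_deg f hu)).

Lemma pmor_shift (M N : pmod n k) (f : pmor M N) a :
  exists g : pmor (shift M a) (shift N a), forall u, g u = f u.
Proof.
have h d u : pm_comp (shift M a) d u -> pm_comp (shift N a) d (f u) by move=> hu; exact: (pmor_deg f hu).
by exists (PMor (M := shift M a) (N := shift N a) h).
Qed.

Lemma iso_cotorsion (M N : pmod n k) : pm_iso M N -> cotorsion N -> cotorsion M.
Proof.
move=> [f [g [fg gf]]] cN F fF; apply: Ext1_eq0_of => P a phi phi0.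
have [f' hf'] := pmor_shift f a; have [g' hg'] := pmor_shift g a.
have [u|psi hpsi] := Ext1_eq0_extend (phi := pmor_comp f' phi) (cN F fF).
  by rewrite /= phi0 raddf0.
exists (pmor_comp g' psi) => u; rewrite /= -hpsi /= hg' hf' [RHS]fg.
by [].
Qed.

Section Free.
Variables (K : choiceType) (dg : K -> deg).
Local Notation Fr := {freeg K / R}.

Let comp d (c : Fr) : Prop := forall z, Rdeg (d - dg z) (coeff z c).

Lemma RdegN d (p : R) : Rdeg d p -> Rdeg d (- p).
Proof. by move=> hp m; rewrite (perm_mem (msuppN p)); exact: hp. Qed.

Let comp0 d : comp d 0. Proof. by move=> z; rewrite coeff0; exact: Rdeg0. Qed.
Let compB d u v : comp d u -> comp d v -> comp d (u - v).
Proof. by move=> hu hv z; rewrite coeffB; apply: RdegD; [exact: hu|apply: RdegN; exact: hv]. Qed.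
Let compZ d a r u : Rdeg d r -> comp a u -> comp (d + a) (r *: u).
Proof. by move=> hr hu z; rewrite coeffZ -addrA; apply: RdegM. Qed.

Let compD d u v : comp d u -> comp d v -> comp d (u + v).
Proof. by move=> hu hv z; rewrite coeffD; apply: RdegD; [exact: hu|exact: hv]. Qed.

Let comp1 d z p : Rdeg (d - dg z) p -> comp d << p *g z >>.
Proof.
move=> hp y; rewrite coeffU; case: eqP => [<-|_]; first by rewrite mulr1.
by rewrite mulr0; exact: Rdeg0.
Qed.

Let spanP u : exists s (c : deg -> Fr),
  [/\ uniq s, forall d, comp d (c d) & u = \sum_(d <- s) c d].
Proof.
pose Sp u := exists s (c : deg -> Fr),
  [/\ uniq s, forall d, comp d (c d) & u = \sum_(d <- s) c d].
have Sp1 d v : comp d v -> Sp v.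
  move=> hv; exists [:: d], (fun e => if e == d then v else 0).
  by split=> // [e|]; [case: eqP => [->|_] //; exact: comp0|rewrite big_seq1 eqxx].
have SpD v w : Sp v -> Sp w -> Sp (v + w).
  move=> [s [c [us hc ->]]] [t [e [ut he ->]]].
  have st : {subset s <= undup (s ++ t)} by move=> x xs; rewrite mem_undup mem_cat xs.
  have ts : {subset t <= undup (s ++ t)} by move=> x xs; rewrite mem_undup mem_cat xs orbT.
  exists (undup (s ++ t)), (fun d => (if d \in s then c d else 0) + (if d \in t then e d else 0)).
  split; first exact: undup_uniq.
    by move=> d; apply: compD; case: ifP => // _; exact: comp0.
  by rewrite big_split /= -!sum_widen ?undup_uniq.
have Sp_sum (I : Type) (r : seq I) (G : I -> Fr) : (forall i, Sp (G i)) -> Sp (\sum_(i <- r) G i).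
  by move=> hG; apply: big_ind => //; exact: (Sp1 0).
rewrite -[u]freeg_sumE; apply: (@Sp_sum _) => z; rewrite [coeff z u]mpolyE.
have -> : << \sum_(m <- msupp (coeff z u)) (coeff z u)@_m *: 'x_m *g z >> =
    \sum_(m <- msupp (coeff z u)) << (coeff z u)@_m *: 'x_m *g z >> :> Fr.
  apply/eqP/freeg_eqP => y; rewrite raddf_sum /= coeffU mulr_suml.
  by apply: eq_bigr => m _; rewrite coeffU.
apply: (@Sp_sum _) => m; apply: (Sp1 (mdegZ m + dg z)); apply: comp1.
by rewrite addrK; exact: RdegZX.
Qed.

Let freeP s (c : deg -> Fr) : uniq s -> (forall d, comp d (c d)) ->
  \sum_(d <- s) c d = 0 -> forall d, d \in s -> c d = 0.
Proof.
move=> us hc e d ds; apply/eqP/freeg_eqP => z; rewrite coeff0; apply/mpolyP => m.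
rewrite mcoeff0; apply/eqP; rewrite mcoeff_eq0; apply/negP => hm.
have /(congr1 (fun u => (coeff z u)@_m)) := e; rewrite !raddf_sum /= coeff0 mcoeff0.
rewrite (bigD1_seq d) //= big_seq_cond big1 ?addr0.
  by apply/eqP; rewrite -mcoeff_msupp.
move=> b /andP[bs bd]; apply: memN_msupp_eq0; apply/negP => /(hc b z).
by rewrite (hc d z m hm) => /addIr /eqP; rewrite eq_sym (negbTE bd).
Qed.

Definition pfree : pmod n k :=
  @PMod n k {freeg K / R} comp comp0 compB compZ spanP freeP.

Lemma pfree_gen z : pm_comp pfree (dg z) << z >>.
Proof. by apply: comp1; rewrite subrr -mdegZ0 -mpolyX0; exact: Rdeg_X. Qed.

Lemma pfree_lift (N : pmod n k) (g : K -> N) : (forall z, pm_comp N (dg z) (g z)) ->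
  exists f : pmor pfree N, forall z, f << z >> = g z.
Proof.
move=> hg.
have hf d u : pm_comp pfree d u -> pm_comp N d (fglift g u).
  move=> hu; rewrite -[u]freeg_sumE raddf_sum; apply: comp_sum => z _ _ /=.
  rewrite liftU -[d](subrK (dg z)); apply: pm_compZ => //; exact: hu.
by exists (PMor (M := pfree) (pmor_fun := fglift g) hf) => z; rewrite /= liftU scale1r.
Qed.

Lemma pfree_eq (V : lmodType R) (f g : {linear pfree -> V}) :
  (forall z, f << z >> = g << z >>) -> f =1 g.
Proof.
move=> h u; rewrite -[u]freeg_sumE !raddf_sum; apply: eq_bigr => z _.
have -> : << coeff z (u : Fr) *g z >> = coeff z (u : Fr) *: (<< z >> : pfree).
  by apply/eqP/freeg_eqP => y; rewrite coeffZ !coeffU mul1r.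
by rewrite /= !linearZ_LR h.
Qed.

Lemma pfree_projective : projective pfree.
Proof.
move=> M N g f sg.
have /choice[h hh] z : exists h, pm_comp M (dg z) h /\ g h = f << z >>.
  by have [h h1 h2] := surj_hom sg (pmor_deg f (@pfree_gen z)); exists h.
have [H hH] := pfree_lift (fun z => proj1 (hh z)); exists H.
by apply: (pfree_eq (f := g \o H) (g := f)) => z /=; rewrite hH (proj2 (hh z)).
Qed.
End Free.

(* The telescope resolution 0 -> (+)_m R(m s) -> (+)_m R(m s) -> R_S, where s is
   the sum of the basis vectors in S. *)
Section Telescope.
Variable S : {set 'I_n}.

Definition mset : 'X_{1..n} := [multinom nat_of_bool (i \in S) | i < n].

Let dg (m : nat) : deg := - mdegZ (mset *+ m)%MM.
Local Notation Fr := (pfree dg).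

Let d0E : exists d : pmor Fr Fr, forall m, d << m >> = << m >> - 'x_mset *: << m.+1 >>.
Proof.
apply: pfree_lift => m; apply: pm_compB; first exact: (@pfree_gen _ dg m).
have := comp_x mset (@pfree_gen _ dg m.+1); congr (pm_comp _ _ _).
by rewrite /dg mulmS mdegZD opprD addrAC addNr add0r.
Qed.
Let d0 := sval (cid d0E).
Let d0_gen m : d0 << m >> = << m >> - 'x_mset *: << m.+1 >>.
Proof. exact: (svalP (cid d0E)). Qed.

Let augE : exists d : pmor Fr (Rloc k S), forall m, loc_val (d << m >>) =
  (FracField.tofrac 1 / FracField.tofrac 'x_(mset *+ m)%MM : frac_mod n k).
Proof.
have hx m : loc_comp S (dg m)
    (FracField.tofrac 1 / FracField.tofrac 'x_(mset *+ m)%MM : frac_mod n k).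
  apply/loc_compP; exists 1, (mset *+ m)%MM; split=> //.
    by move=> i iS; rewrite mulmnE mnmE (negbTE iS).
  by rewrite addNr -mdegZ0 -mpolyX0; exact: Rdeg_X.
have [m|d hd] := @pfree_lift _ dg (Rloc k S) (fun m => Loc (loc_comp_in (hx m))).
  exact: hx.
by exists d => m; rewrite hd.
Qed.
Let aug := sval (cid augE).
Let aug_gen m : loc_val (aug << m >>) =
  (FracField.tofrac 1 / FracField.tofrac 'x_(mset *+ m)%MM : frac_mod n k).
Proof. exact: (svalP (cid augE)). Qed.

Let genZ (p : R) m : << p *g m >> = p *: (<< m >> : Fr) :> Fr.
Proof. by apply/eqP/freeg_eqP => y; rewrite coeffZ !coeffU mul1r. Qed.

Let d0_coeff (u : Fr) m : coeff m (d0 u : {freeg nat / R}) =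
  coeff m (u : {freeg nat / R}) - (if m is m'.+1 then 'x_mset * coeff m' (u : {freeg nat / R}) else 0).
Proof.
pose sh (v : {freeg nat / R}) : R := if m is m'.+1 then 'x_mset * coeff m' v else 0.
have shD v w : sh (v + w) = sh v + sh w.
  by rewrite /sh; case: (m) => [|m']; rewrite ?addr0 // coeffD mulrDr.
have sh0 : sh 0 = 0 by rewrite /sh; case: (m) => [|m'] //; rewrite coeff0 mulr0.
pose Q (v : Fr) := coeff m (d0 v : {freeg nat / R}) = coeff m (v : {freeg nat / R}) - sh v.
suff : Q (\sum_(z <- dom (u : {freeg nat / R})) << coeff z (u : {freeg nat / R}) *g z >>).
  by rewrite freeg_sumE.
apply: big_ind => [|v w hv hw|z _].
- by rewrite /Q raddf0 coeff0 sh0 subr0.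
- by rewrite /Q raddfD /= !coeffD hv hw shD opprD addrACA.
rewrite /Q genZ linearZ_LR d0_gen coeffZ coeffB coeffZ !coeffU /sh.
case: (m) => [|m']; rewrite !coeffZ !coeffU ?eqSS; first by rewrite mul1r !mulr0 !subr0.
by rewrite !mul1r mulrBr [X in _ - X]mulrCA.
Qed.

Let d0_inj u : d0 u = 0 -> u = 0.
Proof.
move=> e; apply/eqP/freeg_eqP => m; rewrite coeff0; elim: m => [|m IH].
  by have := d0_coeff u 0; rewrite e coeff0 subr0.
by have := d0_coeff u m.+1; rewrite e coeff0 IH mulr0 subr0.
Qed.

Let loc_valZ (p : R) (x : Rloc k S) : loc_val (p *: x) = p *: loc_val x.
Proof. by []. Qed.

Let aug_d0 u : aug (d0 u) = 0.
Proof.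
apply: (pfree_eq (f := aug \o d0) (g := \0)) => m /=.
rewrite d0_gen raddfB /= linearZ_LR; apply/val_inj.
transitivity (loc_val (aug << m >>) - 'x_mset *: loc_val (aug << m.+1 >>)) => //.
rewrite !aug_gen frac_scaleE mulmS mpolyXD rmorphM /= rmorph1 invfM !mul1r.
by rewrite mulrA mulfV ?tofrac_mnm_neq0 // mul1r subrr.
Qed.

(** Modulo the image of [d0] each generator is a multiple of any later one, so every element is
    congruent to some p << N >>, on which [aug] is injective. This gives exactness in the middle. *)
Let d0_tail (p : R) m N : (m <= N)%N -> exists u,
  << p *g m >> = d0 u + << p * 'x_(mset *+ (N - m))%MM *g N >> :> Fr.
Proof.
move=> /subnKC; move: (N - m)%N => j <- {N}; elim: j p m => [|j IH] p m.
  by exists 0; rewrite raddf0 add0r addn0 mulm0n mpolyX0 mulr1.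
have [u hu] := IH (p * 'x_mset) m.+1.
have e : d0 << p *g m >> = << p *g m >> - << p * 'x_mset *g m.+1 >> :> Fr.
  by rewrite [in LHS]genZ linearZ_LR d0_gen scalerBr scalerA -!genZ.
have e' : p * 'x_(mset *+ j.+1)%MM = p * 'x_mset * 'x_(mset *+ j)%MM.
  by rewrite mulmS mpolyXD mulrA.
exists (<< p *g m >> + u); rewrite raddfD /= e e' -addSnnS -addrA -hu.
by rewrite subrK.
Qed.

Let ex0 : exact_at d0 aug.
Proof.
move=> c; split=> [ec|[u ->]]; last exact: aug_d0.
have [N hN] : exists N, forall m, m \in dom (c : {freeg nat / R}) -> (m <= N)%N.
  exists (\max_(m <- dom (c : {freeg nat / R})) m) => m hm.
  by rewrite (big_rem m hm) leq_maxl.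
have [u [p e]] : exists u p, c = d0 u + << p *g N >> :> Fr.
  rewrite -[c : {freeg nat / R}]freeg_sumE.
  suff : forall s : seq nat, {subset s <= dom (c : {freeg nat / R})} ->
     exists u p, \sum_(z <- s) << coeff z (c : {freeg nat / R}) *g z >> = d0 u + << p *g N >> :> Fr.
    by apply.
  elim=> [|z s IH] hs; first by exists 0, 0; rewrite big_nil raddf0 freegU0 addr0.
  have [y ys|u [p e]] := IH; first by apply: hs; rewrite inE ys orbT.
  have [v ev] := d0_tail (coeff z (c : {freeg nat / R})) (hN z (hs z (mem_head _ _))).
  eexists (v + u), _; rewrite big_cons e ev raddfD /= addrACA; congr (_ + _).
  exact: freegUD.
exists u; rewrite e [X in _ + X](_ : _ = 0) ?addr0 //.
suff -> : p = 0 by rewrite freegU0.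
have := ec; rewrite e raddfD /= aug_d0 add0r genZ linearZ_LR => /(congr1 (@loc_val n k S)).
rewrite loc_valZ aug_gen frac_scaleE => /eqP; rewrite mulf_eq0 tofrac_eq0 => /orP[/eqP //|].
rewrite mulf_eq0 invr_eq0 rmorph1 oner_eq0 => h.
by have := tofrac_mnm_neq0 k (mset *+ N)%MM; rewrite -[_ == 0]/(false || _) h.
Qed.

Let aug_surj : Defs.surj aug.
Proof.
move=> x; have /in_locP[p [m [hm e]]] := valP (x : Rloc k S).
pose N := mdeg m; have le : (m <= mset *+ N)%MM.
  apply/mnm_lepP => i; rewrite mulmnE mnmE; have [iS|/hm -> //] := boolP (i \in S).
  by rewrite mul1n /N mdegE (bigD1 i) //= leq_addr.
exists << p * 'x_(mset *+ N - m)%MM *g N >>; rewrite genZ linearZ_LR; apply/val_inj.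
rewrite [LHS]loc_valZ aug_gen e frac_scaleE rmorph1 mul1r.
apply/eqP; rewrite eqr_div ?tofrac_mnm_neq0 // -!rmorphM /= tofrac_eq -mulrA -mpolyXD.
by rewrite submK.
Qed.

(** The free module on [void] is 0, which ends the resolution after two terms. *)
Definition tele_obj (i : nat) : pmod n k :=
  if i is i'.+2 then pfree (fun _ : void => 0) else Fr.

Let voidE : exists f : forall N : pmod n k, pmor (pfree (fun _ : void => 0)) N, True.
Proof.
have ex N : exists f : pmor (pfree (fun _ : void => 0)) N, True.
  by have [z|f _] := @pfree_lift void (fun=> 0) N (fun z : void => match z with end); [|exists f].
by exists (fun N => sval (cid (ex N))).
Qed.

Definition tele_d (i : nat) : pmor (tele_obj i.+1) (tele_obj i) :=
  match i return pmor (tele_obj i.+1) (tele_obj i) with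
  | 0 => d0
  | i'.+1 => sval (cid voidE) _
  end.

Let void0 (u : pfree (fun _ : void => 0)) : u = 0.
Proof. by apply/eqP/freeg_eqP => -[]. Qed.

Let tele_exact i : exact_at (tele_d i.+1) (tele_d i).
Proof.
case: i => [|i] u; split=> [e|[x ->]].
- by exists 0; rewrite raddf0; exact: d0_inj.
- by rewrite (void0 x) !raddf0.
- by exists 0; rewrite raddf0; exact: void0.
- by rewrite (void0 x) !raddf0.
Qed.

Let tele_proj i : projective (tele_obj i).
Proof. by case: i => [|[|i]]; exact: pfree_projective. Qed.

Definition telescope : proj_resolution (Rloc k S) :=
  @ProjResolution _ _ (Rloc k S) tele_obj tele_d aug tele_proj aug_surj ex0 tele_exact.

(* Ext^1(R_S, F) = 0 says that lim^1 of F <- F(-s) <- F(-2s) <- ... vanishes. *)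
Lemma telescope_solve (F : pmod n k) d (g : nat -> F) : Ext1_eq0 (Rloc k S) F ->
  (forall m, pm_comp F (d - mdegZ (mset *+ m)%MM) (g m)) ->
  exists h : nat -> F, forall m,
    pm_comp F (d - mdegZ (mset *+ m)%MM) (h m) /\ h m - 'x_mset *: h m.+1 = g m.
Proof.
move=> eF hg; have [phi hphi] := @pfree_lift _ dg (shift F d) g hg.
have [u|psi hpsi] := @Ext1_eq0_extend _ _ telescope d phi eF.
  by rewrite (void0 u) !raddf0.
exists (fun m => psi (<< m >> : Fr)) => m; split; first exact: (pmor_deg psi (@pfree_gen _ dg m)).
rewrite -hphi hpsi [res_d telescope 0 _]d0_gen raddfB /=.
by rewrite (linearZ_LR psi).
Qed.
End Telescope.
End Ext.

(** * Flatness and regularity *)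


Section LinearQuotient.
Variables (R : pzRingType) (M : lmodType R) (G : {pred M}) (clG : submod_closed G).

(** An alias of G that mentions the closure proof, so that the submodule structure can be attached
    to it as a canonical instance. *)
Definition closed_pred of submod_closed G : {pred M} := G.
HB.instance Definition _ := GRing.isSubmodClosed.Build R M (closed_pred clG) clG.
Local Notation cG := (closed_pred clG).

Definition lquot : Type := Quotient.quot cG.
HB.instance Definition _ := GRing.Zmodule.on lquot.

Definition lproj (u : M) : lquot := \pi_(Quotient.quot cG) u.
Definition lrepr (x : lquot) : M := repr (x : Quotient.quot cG).

Lemma lreprK x : lproj (lrepr x) = x.
Proof. exact: reprK. Qed.

Lemma lproj_eq u v : lproj u = lproj v <-> u - v \in G.
Proof.
rewrite (Quotient.idealrBE cG); split=> [e|/eqP //]; exact/eqP.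
Qed.

Lemma lprojD : {morph lproj : x y / x + y}.
Proof. by move=> x y; exact: (raddfD (\pi_(Quotient.quot cG))). Qed.

Let qscale (r : R) (x : lquot) : lquot := lproj (r *: lrepr x).

Let qscale_pi r x : qscale r (lproj x) = lproj (r *: x).
Proof. by apply/lproj_eq; rewrite -scalerBr (rpredZ (s := cG)) //; apply/lproj_eq; rewrite lreprK. Qed.

Let qscaleA r s u : qscale r (qscale s u) = qscale (r * s) u.
Proof. by rewrite -[u]lreprK !qscale_pi scalerA. Qed.
Let qscale1 : left_id 1 qscale.
Proof. by move=> u; rewrite -[u]lreprK qscale_pi scale1r. Qed.
Let qscaleDr : right_distributive qscale +%R.
Proof.
by move=> r u v; rewrite -[u]lreprK -[v]lreprK -lprojD !qscale_pi scalerDr lprojD.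
Qed.
Let qscaleDl u : {morph qscale^~ u : r s / r + s}.
Proof. by move=> r s; rewrite -[u]lreprK !qscale_pi scalerDl lprojD. Qed.
HB.instance Definition _ := GRing.Zmodule_isLmodule.Build R lquot
  qscaleA qscale1 qscaleDr qscaleDl.

Let lproj_linear : linear lproj.
Proof. by move=> r u v; rewrite lprojD -qscale_pi. Qed.
HB.instance Definition _ := GRing.isLinear.Build R M lquot *:%R lproj lproj_linear.

Lemma lproj_eq0 u : lproj u = 0 <-> u \in G.
Proof. by rewrite -(raddf0 lproj) lproj_eq subr0. Qed.
End LinearQuotient.

Section GradedQuotient.
Variables (n : nat) (k : fieldType) (M : pmod n k) (G : {pred M}) (clG : submod_closed G).
Local Notation deg := 'rV[int]_n.
Hypothesis hG : forall u, u \in G -> forall d, hcomp u d \in G.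

Let comp d (x : lquot clG) : Prop := exists2 u : M, pm_comp M d u & lproj clG u = x.

Let comp0 d : comp d 0.
Proof. by exists 0; [exact: pm_comp0|rewrite raddf0]. Qed.
Let compB d x y : comp d x -> comp d y -> comp d (x - y).
Proof. by move=> [u hu <-] [v hv <-]; exists (u - v); [exact: pm_compB|rewrite raddfB]. Qed.
Let compZ d a r x : Rdeg d r -> comp a x -> comp (d + a) (r *: x).
Proof. by move=> hr [u hu <-]; exists (r *: u); [exact: pm_compZ|rewrite linearZ]. Qed.

Let spanP x : exists s (c : deg -> lquot clG),
  [/\ uniq s, forall d, comp d (c d) & x = \sum_(d <- s) c d].
Proof.
exists (hsupp (lrepr x)), (fun d => lproj clG (hcomp (lrepr x) d)).
split=> [|d|]; [exact: hsupp_uniq|by exists (hcomp (lrepr x) d); [exact: hcompP|]|].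
by rewrite -{1}[x]lreprK {1}[lrepr x]hsuppE raddf_sum.
Qed.

Let freeP s (c : deg -> lquot clG) : uniq s -> (forall d, comp d (c d)) ->
  \sum_(d <- s) c d = 0 -> forall d, d \in s -> c d = 0.
Proof.
move=> us hc e d ds.
have /choice[u hu] a : exists u, pm_comp M a u /\ lproj clG u = c a.
  by have [u h1 h2] := hc a; exists u.
have : \sum_(a <- s) u a \in G.
  apply/lproj_eq0; rewrite raddf_sum -[RHS]e; apply: eq_bigr => a _.
  exact: (proj2 (hu a)).
move=> /hG/(_ d); rewrite (hcompE us (fun a => proj1 (hu a)) erefl) ds => h.
by rewrite -(proj2 (hu d)); apply/lproj_eq0.
Qed.

Definition pquot : pmod n k :=
  @PMod n k (lquot clG) comp comp0 compB compZ spanP freeP.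

Lemma comp_lproj d u : pm_comp M d u -> pm_comp pquot d (lproj clG u).
Proof. by move=> hu; exists u. Qed.
End GradedQuotient.

Section Ideals.
Variables (n : nat) (k : fieldType).
Local Notation deg := 'rV[int]_n.
Local Notation R := {mpoly k[n]}.
Local Notation "''x_' m" := ('X_[k, m] : R) (at level 2, m at level 2).

(** The ungraded counterpart of [gid], as a predicate by which a quotient can be taken; the two
    agree on homogeneous elements. *)
Definition idl (M : lmodType R) (c : 'X_{1..n}) (S : {set 'I_n}) : {pred M} :=
  fun u => `[< exists f : 'I_n -> M, u = \sum_(j in S) 'x_(U_(j) *+ c j)%MM *: f j >].

Lemma idl_submod (M : lmodType R) c S : submod_closed (@idl M c S).
Proof.
split; first by apply/asboolP; exists (fun=> 0); rewrite big1 // => j _; rewrite scaler0.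
move=> r u v /asboolP[f ->] /asboolP[g ->]; apply/asboolP.
exists (fun j => r *: f j + g j); rewrite scaler_sumr -big_split /=.
by apply: eq_bigr => j _; rewrite scalerDr !scalerA mulrC.
Qed.

HB.instance Definition _ (M : lmodType R) c S :=
  GRing.isSubmodClosed.Build R M (@idl M c S) (@idl_submod M c S).

Lemma idlP (M : lmodType R) (c : 'X_{1..n}) (S : {set 'I_n}) (u : M) :
  reflect (exists f : 'I_n -> M, u = \sum_(j in S) 'x_(U_(j) *+ c j)%MM *: f j) (u \in idl c S).
Proof. exact: asboolP. Qed.

Section Graded.
Variable M : pmod n k.
Implicit Types u : M.

Lemma hcomp_sum_x (c : 'X_{1..n}) (S : {set 'I_n}) (f : 'I_n -> M) d :
  hcomp (\sum_(j in S) 'x_(U_(j) *+ c j)%MM *: f j) d =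
  \sum_(j in S) 'x_(U_(j) *+ c j)%MM *: hcomp (f j) (d - mdegZ (U_(j) *+ c j)%MM).
Proof.
elim/big_rec2: _ => [|j u v _ <-]; first exact: hcomp0.
by rewrite hcompD -hcomp_x subrK.
Qed.

Lemma idl_gid c S d u : pm_comp M d u -> u \in idl c S -> gid (pm_comp M) c S d u.
Proof.
move=> hu /idlP[f e]; exists (fun j => hcomp (f j) (d - mdegZ (U_(j) *+ c j)%MM)).
by split=> [j _|]; [exact: hcompP|rewrite -hcomp_sum_x -e hcomp_id].
Qed.

Lemma gid_idl c S d u : gid (pm_comp M) c S d u -> u \in idl c S.
Proof. by move=> [f [_ ->]]; apply/idlP; exists f. Qed.

Lemma idl_graded c S u : u \in idl c S -> forall d, hcomp u d \in idl c S.
Proof.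
move=> /idlP[f ->] d; rewrite hcomp_sum_x; apply/idlP.
by exists (fun j => hcomp (f j) (d - mdegZ (U_(j) *+ c j)%MM)).
Qed.

Lemma regular_idl c (S : {set 'I_n}) i u : regular M -> i \notin S ->
  'x_U_(i)%MM *: u \in idl c S -> u \in idl c S.
Proof.
move=> rM iS h; rewrite [u]hsuppE; apply: rpred_sum => d _.
apply: (@gid_idl _ _ d); apply: rM iS _ _; first exact: hcompP.
apply: idl_gid; first by apply: comp_x; exact: hcompP.
by rewrite -hcomp_x; exact: idl_graded.
Qed.
End Graded.
End Ideals.

(** * Tensor products: universal property and right exactness *)

Section TensorTheory.
Variable R : comNzRingType.

Section Two.
Variables A B : lmodType R.

Lemma tensDl (a a' : A) (b : B) : tens (a + a') b = tens a b + tens a' b.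
Proof. by rewrite /tens -tens_piD; apply/tens_pi_eq/tens_gen_rel; exact: TensDl. Qed.
Lemma tensDr (a : A) (b b' : B) : tens a (b + b') = tens a b + tens a b'.
Proof. by rewrite /tens -tens_piD; apply/tens_pi_eq/tens_gen_rel; exact: TensDr. Qed.
Lemma tensZl r (a : A) (b : B) : tens (r *: a) b = r *: tens a b.
Proof. by rewrite /tens -tens_piZ; apply/tens_pi_eq/tens_gen_rel; exact: TensZl. Qed.
Lemma tensZr r (a : A) (b : B) : tens a (r *: b) = r *: tens a b.
Proof. by rewrite /tens -tens_piZ; apply/tens_pi_eq/tens_gen_rel; exact: TensZr. Qed.
Lemma tens0l (b : B) : tens (0 : A) b = 0.
Proof. by rewrite -(scale0r (0 : A)) tensZl scale0r. Qed.
Lemma tens0r (a : A) : tens a (0 : B) = 0.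
Proof. by rewrite -(scale0r (0 : B)) tensZr scale0r. Qed.

Lemma tens_ind (P : tensor A B -> Prop) : P 0 ->
  (forall x y, P x -> P y -> P (x + y)) -> (forall a b, P (tens a b)) -> forall x, P x.
Proof.
move=> P0 PD Pt x; rewrite -[x]tens_reprK -[tens_repr x]freeg_sumE.
have tp0 : tens_pi (0 : {freeg (A * B) / R}) = 0.
  by rewrite -(subrr 0) tens_piB subrr.
elim: (dom _) => [|z s IH]; first by rewrite big_nil tp0.
rewrite big_cons tens_piD; apply: PD => //; case: z => a b; set r := coeff _ _.
have -> : << r *g (a, b) >> = r *: << (a, b) >> :> {freeg (A * B) / R}.
  by apply/eqP/freeg_eqP => y; rewrite coeffZ !coeffU mul1r.
by rewrite tens_piZ -[tens_pi _]/(tens a b) -tensZl.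
Qed.

Lemma tens_lift (M : lmodType R) (g : A -> B -> M) :
  (forall a a' b, g (a + a') b = g a b + g a' b) ->
  (forall a b b', g a (b + b') = g a b + g a b') ->
  (forall r a b, g (r *: a) b = r *: g a b) ->
  (forall r a b, g a (r *: b) = r *: g a b) ->
  exists h : {linear tensor A B -> M}, forall a b, h (tens a b) = g a b.
Proof.
move=> gDl gDr gZl gZr; pose G (p : A * B) := g p.1 p.2.
have kill x : x \in @tens_rel R A B -> fglift G x = 0.
  move=> /asboolP; pose S : {pred {freeg (A * B) / R}} := fun z => fglift G z == 0.
  have SE z : (z \in S) = (fglift G z == 0) by [].
  move=> /(_ S) h; apply/eqP; rewrite -SE; apply: h.
    split=> [|r u v]; rewrite !SE ?raddf0 // => /eqP hu /eqP hv.
    by rewrite linearP /= hu hv scaler0 addr0.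
  have GE a b : fglift G << (a, b) >> = g a b by rewrite liftU scale1r.
  move=> _ [a a' b|a b b'|r a b|r a b]; rewrite SE raddfB.
  - by rewrite [X in _ - X]raddfD /= !GE gDl subrr.
  - by rewrite [X in _ - X]raddfD /= !GE gDr subrr.
  - by rewrite [X in _ - X]linearZ_LR /= !GE gZl subrr.
  - by rewrite [X in _ - X]linearZ_LR /= !GE gZr subrr.
pose h (x : tensor A B) : M := fglift G (tens_repr x).
have hpi x : h (tens_pi x) = fglift G x.
  apply/eqP; rewrite -subr_eq0 -raddfB; apply/eqP/kill.
  by apply/tens_pi_eq; rewrite tens_reprK.
have lh : linear h.
  move=> r x y; rewrite -[x]tens_reprK -[y]tens_reprK -tens_piZ -tens_piD !hpi.
  by rewrite linearP.
pose lin := GRing.isLinear.Build _ _ _ _ h lh.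
pose H : {linear tensor A B -> M} := HB.pack h lin.
by exists H => a b; rewrite [LHS]hpi liftU scale1r.
Qed.
End Two.

Lemma tens_mapP (A B C : lmodType R) (f : {linear B -> C}) :
  exists F : {linear tensor A B -> tensor A C}, F =1 tens_map f.
Proof.
have [||||F hF] := @tens_lift A B (tensor A C) (fun a b => tens a (f b)).
- by move=> *; exact: tensDl.
- by move=> *; rewrite raddfD tensDr.
- by move=> *; exact: tensZl.
- by move=> *; rewrite linearZ_LR tensZr.
have mapD x y : tens_map (A := A) f (x + y) = tens_map f x + tens_map f y.
  by rewrite -[x]tens_reprK -[y]tens_reprK -tens_piD !tens_map_pi raddfD /= tens_piD.
exists F; apply: tens_ind => [|x y hx hy|a b].
- rewrite raddf0; apply: (@addrI _ (tens_map (A := A) f 0)).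
  by rewrite -mapD !addr0.
- by rewrite raddfD mapD /= hx hy.
- by rewrite hF tens_mapE.
Qed.

Lemma tens_map_surj (A B C : lmodType R) (g : {linear B -> C}) :
  Defs.surj g -> Defs.surj (tens_map (A := A) g).
Proof.
move=> sg y; have [G hG] := tens_mapP A g.
suff [x <-] : exists x, G x = y by exists x.
move: y; apply: tens_ind => [|_ _ [x <-] [y <-]|a c].
- by exists 0; rewrite raddf0.
- by exists (x + y); rewrite raddfD.
- by have [b <-] := sg c; exists (tens a b); rewrite hG tens_mapE.
Qed.

Definition tens_im (A B C : lmodType R) (f : {linear B -> C}) : {pred tensor A C} :=
  fun y => `[< exists x, y = tens_map (A := A) f x >].

Lemma tens_im_submod (A B C : lmodType R) (f : {linear B -> C}) :
  submod_closed (@tens_im A B C f).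
Proof.
have [F hF] := tens_mapP A f; split.
  by apply/asboolP; exists 0; rewrite -hF raddf0.
move=> r _ _ /asboolP[x ->] /asboolP[y ->]; apply/asboolP; exists (r *: x + y).
by rewrite -!hF linearP.
Qed.

HB.instance Definition _ (A B C : lmodType R) (f : {linear B -> C}) :=
  GRing.isSubmodClosed.Build R (tensor A C) (@tens_im A B C f) (@tens_im_submod A B C f).

(** For a set-theoretic section s of g, the map sending a (x) d to the class of a (x) s d modulo the
    image of A (x) f is bilinear and does not depend on s. Composed with A (x) g it is the
    projection, so the kernel of A (x) g is that image. *)
Lemma tens_map_exact (A B C D : lmodType R) (f : {linear B -> C}) (g : {linear C -> D}) :
  exact_at f g -> Defs.surj g -> exact_at (tens_map (A := A) f) (tens_map (A := A) g).
Proof.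
move=> ex sg y; have [F hF] := tens_mapP A f; have [G hG] := tens_mapP A g.
split=> [e|[x ->]]; last first.
  rewrite -hF -hG; move: x; apply: tens_ind => [|x x' hx hx'|a b].
  - by rewrite !raddf0.
  - by rewrite !raddfD /= hx hx' addr0.
  - by rewrite hF hG !tens_mapE (_ : g (f b) = 0) ?tens0r //; apply/ex; exists b.
have /choice[s hs] := sg.
pose pr : {linear tensor A C -> lquot (@tens_im_submod A B C f)} := lproj (@tens_im_submod A B C f).
have pr_g a c c' : g c = g c' -> pr (tens a c) = pr (tens a c').
  move=> e'; have /ex[b eb] : g (c - c') = 0 by rewrite raddfB /= e' subrr.
  rewrite -[c](subrK c') tensDr raddfD /= eb -tens_mapE.
  by rewrite [pr (tens_map _ _)](_ : _ = 0) ?add0r //; apply/lproj_eq0/asboolP; exists (tens a b).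
have [||||h hh] := @tens_lift A D (lquot (@tens_im_submod A B C f)) (fun a d => pr (tens a (s d))).
- by move=> a a' d; rewrite tensDl raddfD.
- move=> a d d'; rewrite -raddfD -tensDr; apply: pr_g.
  by rewrite [RHS]raddfD /= !hs.
- by move=> r a d; rewrite tensZl linearZ.
- move=> r a d; rewrite -linearZ -tensZr; apply: pr_g.
  by rewrite [RHS]linearZ_LR /= !hs.
have hG' x : h (G x) = pr x.
  move: x; apply: tens_ind => [|x x' hx hx'|a c].
  - by rewrite !raddf0.
  - by rewrite !raddfD /= hx hx'.
  - by rewrite hG tens_mapE hh; apply: pr_g; rewrite hs.
have /lproj_eq0/asboolP // : pr y = 0.
by rewrite -hG' hG e raddf0.
Qed.
End TensorTheory.

(** * Flat modules are regular *)

Section FlatRegular.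
Variables (n : nat) (k : fieldType).
Local Notation deg := 'rV[int]_n.
Local Notation R := {mpoly k[n]}.
Local Notation "''x_' m" := ('X_[k, m] : R) (at level 2, m at level 2).
Local Notation Rp := (pfree k (fun _ : unit => 0 : deg)).
Local Notation one := (<< tt >> : {freeg unit / R}).

Lemma Rp_eq (p q : Rp) :
  coeff tt (p : {freeg unit / R}) = coeff tt (q : {freeg unit / R}) -> p = q.
Proof. by move=> e; apply/eqP/freeg_eqP => -[]. Qed.

Lemma Rp_traced : exists T : {linear kres Rp -> k^o}, traced finset.set0 0 T.
Proof.
pose ev (p : {freeg unit / R}) : k^o := meval (fun _ => 1) (coeff tt p).
have lev : linear (ev : kres Rp -> k^o).
  by move=> c x y; rewrite /ev coeffD coeffZ mevalD mevalM mevalC.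
pose lin := GRing.isLinear.Build _ _ _ _ (ev : kres Rp -> k^o) lev.
pose T : {linear kres Rp -> k^o} := HB.pack (ev : kres Rp -> k^o) lin.
have monom d (u : Rp) : pm_comp Rp d u -> u != 0 ->
    exists c m, [/\ c != 0, mdegZ m = d & coeff tt (u : {freeg unit / R}) = c *: 'x_m].
  move=> /(_ tt); rewrite subr0 => hu u0.
  have p0 : coeff tt (u : {freeg unit / R}) != 0.
    by apply: contraNneq u0 => e; apply/eqP/Rp_eq; rewrite e coeff0.
  have [|c [m [c0 e]]] := @Rhomogeneous_ZX _ _ _ _ p0; first by exists d.
  exists c, m; split=> //; apply: hu; rewrite e mcoeff_msupp mcoeffZ mcoeffX eqxx.
  by rewrite mulr1.
have TE (u : Rp) : T u = meval (fun _ => 1) (coeff tt (u : {freeg unit / R})) by [].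
exists T; split=> [m u|d u hu Tu|d u i _ lt hu|d v hv].
- by rewrite !TE coeffZ mevalM ev_x mul1r.
- apply/eqP; apply: contraT => u0; have [c [m [c0 _ e]]] := monom d u hu u0.
  by move/eqP: Tu; rewrite TE e mevalZ ev_x mulr1 (negbTE c0).
- apply/eqP; apply: contraT => u0; have [c [m [c0 hm _]]] := monom d u hu u0.
  by move: lt; rewrite -hm !mxE; case: (m i).
have e : mdegZ (absm d) = d.
  by rewrite -{2}[d](@absmK _ 0) ?subr0 ?add0r //; apply/ledegP => i; apply: hv; rewrite inE.
exists << v *: 'x_(absm d) *g tt >>; last first.
  by rewrite TE coeffU eqxx mulr1 mevalZ ev_x mulr1.
by move=> []; rewrite coeffU mulr1 subr0 -{1}e; exact: RdegZX.
Qed.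

Lemma Rp_regular : regular Rp.
Proof. by have [T hT] := Rp_traced; exact: traced_regular hT. Qed.

(** Flatness is tested on multiplication by x_i on B = R / (x_j^(c j), j in S), which is injective
    because R is regular. It sends u (x) 1 to x_i u (x) 1 = 0, so u (x) 1 = 0, and the map from F
    (x) B to F / (x_j^(c j)) F turns this into the claim. *)
Lemma flat_regular (F : pmod n k) : flat F -> regular F.
Proof.
move=> fF c S i d u iS hu h.
have gr (M : pmod n k) := @idl_graded n k M.
pose B := pquot (@idl_submod n k Rp c S) (@gr Rp c S).
pose C := pquot (@idl_submod n k B (ones n) [set i]%SET) (@gr B (ones n) [set i]%SET).
pose A := shift B (- mdegZ U_(i)).
pose f (x : A) : B := 'x_U_(i)%MM *: x.
have lf : linear f.
  by move=> r x y; rewrite /f scalerDr !scalerA [_ * r]mulrC.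
pose linf := GRing.isLinear.Build _ _ _ _ f lf.
pose f' : {linear A -> B} := HB.pack f linf.
have hf d' x : pm_comp A d' x -> pm_comp B d' (f' x).
  by move=> hx; move: (@comp_x n k B (- mdegZ U_(i) + d') U_(i)%MM x hx); rewrite addrAC addNr add0r.
pose g : pmor B C := PMor (M := B) (N := C) (@comp_lproj n k B _ _ _).
have [|||fI _ _] := fF A B C (PMor hf) g.
- move=> x y; rewrite /= /f => e; apply/eqP; rewrite -subr_eq0; apply/eqP.
  move: e => /eqP; rewrite -subr_eq0 -scalerBr -[x - y]lreprK -linearZ => /eqP/lproj_eq0.
  by move=> /(regular_idl Rp_regular iS) h'; apply/lproj_eq0.
- move=> y; split=> [/lproj_eq0/idlP[w]|[x ->]].
    by rewrite big_set1 onesE mulm1n => ->; exists (w i).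
  by apply/lproj_eq0/idlP; exists (fun=> x); rewrite big_set1 onesE mulm1n.
- by move=> x; exists (lrepr x); rewrite /= lreprK.
pose e1 : B := lproj (@idl_submod n k Rp c S) one.
have t0 : tens (u : F) (e1 : A) = 0.
  apply: fI; have [H hH] := tens_mapP F f'.
  rewrite -[RHS]hH raddf0 -[LHS]/(tens_map f' (tens (u : F) (e1 : A))) tens_mapE /= /f.
  rewrite tensZr -tensZl; have [w [_ ->]] := h.
  have sumE (s : seq 'I_n) (P : pred 'I_n) (G : 'I_n -> F) :
      tens (\sum_(j <- s | P j) G j) e1 = \sum_(j <- s | P j) tens (G j) e1.
    by elim/big_rec2: _ => [|j x y _ <-]; rewrite ?tens0l ?tensDl.
  rewrite sumE big1 // => j jS; rewrite tensZl -tensZr.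
  rewrite [X in tens _ X](_ : _ = 0) ?tens0r //.
  rewrite /e1 -linearZ; apply/lproj_eq0/idlP; exists (fun l => if l == j then one else 0).
  rewrite (bigD1 j) //= eqxx big1 ?addr0 // => l /andP[_ /negbTE ->].
  by rewrite scaler0.
pose Q : {linear F -> lquot (@idl_submod n k F c S)} := lproj (@idl_submod n k F c S).
(* A polynomial representing the class x: this choice is linear only modulo the ideal, which is
   enough after Q. *)
pose ev (x : B) : R := coeff tt (lrepr x : {freeg unit / R}).
have evD (x y z : B) (r : R) (v : F) : lrepr z - (r *: lrepr x + lrepr y) \in @idl n k Rp c S ->
    Q (ev z *: v) = r *: Q (ev x *: v) + Q (ev y *: v).
  move=> /idlP[w e]; rewrite -linearZ -raddfD scalerA -scalerDl.
  apply/lproj_eq; rewrite -scalerBl.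
  have -> : ev z - (r * ev x + ev y) = coeff tt (lrepr z - (r *: lrepr x + lrepr y) : {freeg unit / R}).
    by rewrite coeffB coeffD coeffZ.
  rewrite e raddf_sum scaler_suml; apply/idlP.
  exists (fun j => coeff tt (w j : {freeg unit / R}) *: v); apply: eq_bigr => j _.
  by rewrite /= coeffZ scalerA.
have [||||hh hhE] := @tens_lift R F B (lquot (@idl_submod n k F c S)) (fun v x => Q (ev x *: v)).
- by move=> v v' x; rewrite scalerDr raddfD.
- move=> v x y; rewrite (evD x y (x + y) 1) ?scale1r //.
  by apply/(lproj_eq (@idl_submod n k Rp c S)); rewrite lprojD !lreprK.
- by move=> r v x; rewrite -[RHS](linearZ_LR Q) !scalerA mulrC.
- move=> r v x; rewrite (evD x 0 (r *: x) r); last first.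
    by apply/(lproj_eq (@idl_submod n k Rp c S)); rewrite lprojD linearZ /= !lreprK addr0.
  rewrite [X in _ + X](_ : _ = 0) ?addr0 //; apply/lproj_eq0.
  have /lproj_eq0/idlP[w e] := lreprK (0 : B).
  rewrite /ev e raddf_sum scaler_suml; apply/idlP.
  exists (fun j => coeff tt (w j : {freeg unit / R}) *: v); apply: eq_bigr => j _.
  by rewrite /= coeffZ scalerA.
apply: idl_gid => //.
have := hhE u e1; rewrite [tens _ _]t0 raddf0 => /esym/lproj_eq0 h1.
have /lproj_eq/idlP[w e] : lproj (@idl_submod n k Rp c S) (lrepr e1) = lproj (@idl_submod n k Rp c S) one.
  by rewrite lreprK.
have -> : u = ev e1 *: u - coeff tt (lrepr e1 - one : {freeg unit / R}) *: u.
  rewrite -scalerBl coeffB -[X in (X - _)]/(ev e1) opprB addrC subrK coeffU eqxx mulr1.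
  by rewrite scale1r.
have clF := @idl_submod n k F c S.
rewrite -[_ \in _]/(_ \in closed_pred clF); apply: rpredB; first exact: h1.
apply/idlP; rewrite e raddf_sum scaler_suml.
exists (fun j => coeff tt (w j : {freeg unit / R}) *: u); apply: eq_bigr => j _.
by rewrite /= coeffZ scalerA.
Qed.
End FlatRegular.

(** * The k-dual, and flatness of regular modules *)

Section KDual.
Variables (n : nat) (k : fieldType) (F : lmodType {mpoly k[n]}).
Local Notation R := {mpoly k[n]}.
Local Notation fns := (dprod (fun _ : F => k^o)).

Definition is_klinear : {pred fns} := fun phi =>
  `[< forall (c : k) (x y : F), phi (c%:MP_[n] *: x + y) = c * phi x + phi y >].

Lemma klinear_submod : submod_closed is_klinear.
Proof.
split; first by apply/asboolP => c x y; rewrite mulr0 addr0.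
move=> a u v /asboolP hu /asboolP hv; apply/asboolP => c x y.
have E z : (a *: u + v) z = a * u z + v z by [].
by rewrite !E hu hv !mulrDr addrACA mulrCA.
Qed.

HB.instance Definition _ := GRing.isSubmodClosed.Build k fns is_klinear klinear_submod.

Record kdual := KDual { kdual_val : fns; _ : kdual_val \in is_klinear }.
HB.instance Definition _ := [isSub for kdual_val].
HB.instance Definition _ := [Choice of kdual by <:].
HB.instance Definition _ := [SubChoice_isSubZmodule of kdual by <:].

Lemma kdual_lin (u : kdual) c x y :
  kdual_val u (c%:MP_[n] *: x + y) = c * kdual_val u x + kdual_val u y.
Proof. by have /asboolP := valP u; exact. Qed.

Lemma kdualD (u : kdual) x y : kdual_val u (x + y) = kdual_val u x + kdual_val u y.
Proof. by have := kdual_lin u 1 x y; rewrite mpolyC1 scale1r mul1r. Qed.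

Lemma kdual0 (u : kdual) : kdual_val u 0 = 0.
Proof. by apply: (@addrI _ (kdual_val u 0)); rewrite -kdualD !addr0. Qed.

Lemma kdual_eq (u v : kdual) : (forall x, kdual_val u x = kdual_val v x) -> u = v.
Proof. by move=> h; apply/val_inj/dprodP. Qed.

Let dscale_sub (r : R) (u : kdual) : (fun x : F => kdual_val u (r *: x)) \in is_klinear.
Proof.
apply/asboolP => c x y; rewrite scalerDr scalerA mulrC -scalerA.
exact: kdual_lin.
Qed.
Let dscale r u : kdual := KDual (dscale_sub r u).

Let dscaleA r s u : dscale r (dscale s u) = dscale (r * s) u.
Proof. by apply: kdual_eq => x /=; rewrite scalerA mulrC. Qed.
Let dscale1 : left_id 1 dscale.
Proof. by move=> u; apply: kdual_eq => x /=; rewrite scale1r. Qed.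
Let dscaleDr : right_distributive dscale +%R.
Proof. by move=> r u v; apply: kdual_eq. Qed.
Let dscaleDl u : {morph dscale^~ u : r s / r + s}.
Proof. by move=> r s; apply: kdual_eq => x /=; rewrite scalerDl kdualD. Qed.
HB.instance Definition _ := GRing.Zmodule_isLmodule.Build R kdual
  dscaleA dscale1 dscaleDr dscaleDl.

Lemma kdualZE r (u : kdual) x : kdual_val (r *: u) x = kdual_val u (r *: x).
Proof. by []. Qed.

Lemma kdualDE (u v : kdual) x : kdual_val (u + v) x = kdual_val u x + kdual_val v x.
Proof. by []. Qed.

Lemma kdual_of (l : {linear kres F -> k^o}) :
  exists u : kdual, forall x, kdual_val u x = l x.
Proof.
have h : (fun x : F => l x) \in is_klinear.
  by apply/asboolP => c x y; rewrite (raddfD l) /= kres_linearZ.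
by exists (KDual h).
Qed.

Lemma kres_separates (t : F) : t != 0 -> exists l : {linear kres F -> k^o}, l t != 0.
Proof.
move=> t0; pose G0 (p : kres F * k^o) := exists c : k, p.1 = c *: (t : kres F) /\ p.2 = c.
have [||l hl] := @linear_extension _ _ _ G0.
- split=> [|a p q [c [h1 h2]] [c' [h1' h2']]]; first by exists 0; rewrite scale0r.
  exists (a * c + c'); rewrite /= h1 h2 h1' h2'; split=> //.
  by rewrite scalerDl scalerA.
- move=> v [c [/= h ->]]; apply/eqP; apply: contraNT t0 => c0.
  have -> : t = (c^-1 * c) *: (t : kres F) by rewrite mulVf // scale1r.
  by rewrite -scalerA -h scaler0.
exists l; rewrite (hl _ 1) ?oner_eq0 //.
by exists 1; rewrite scale1r.
Qed.
End KDual.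

Section Extension.
Variables (n : nat) (k : fieldType).
Local Notation deg := 'rV[int]_n.
Local Notation R := {mpoly k[n]}.
Local Notation "''x_' m" := ('X_[k, m] : R) (at level 2, m at level 2).

Lemma hcomp_scale (M : pmod n k) e (u : M) (r : R) d : pm_comp M e u ->
  hcomp (r *: u) d = (\sum_(m <- msupp r | mdegZ m + e == d) r@_m *: 'x_m) *: u.
Proof.
move=> hu; rewrite {1}[r]mpolyE !scaler_suml.
rewrite (_ : hcomp _ d = \sum_(m <- msupp r) hcomp ((r@_m *: 'x_m) *: u) d); last first.
  by elim/big_rec2: _ => [|m x y _ <-]; [exact: hcomp0|exact: hcompD].
rewrite [RHS]big_mkcond; apply: eq_bigr => m _.
by rewrite (hcompE1 _ (pm_compZ (@RdegZX n k r@_m m) hu)) eq_sym.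
Qed.

Lemma hcomp_scale1 (M : pmod n k) e (u : M) (r : R) m : pm_comp M e u ->
  hcomp (r *: u) (mdegZ m + e) = (r@_m *: 'x_m) *: u.
Proof.
move=> hu; rewrite (hcomp_scale _ _ hu); congr (_ *: u).
have [mr|mr] := boolP (m \in msupp r); last first.
  rewrite (memN_msupp_eq0 mr) scale0r big_seq_cond big1 // => l /andP[lr].
  by move=> /eqP/addIr/mdegZ_inj e'; rewrite -e' lr in mr.
rewrite (big_rem m mr) /= eqxx big_seq_cond big1 ?addr0 // => l /andP[lr].
move=> /eqP/addIr/mdegZ_inj e'; move: lr; rewrite e' mem_rem_uniq ?msupp_uniq //.
by rewrite !inE eqxx.
Qed.

(* Maps from the prime ideal (x_i, i in S) to E extend to R. *)
Definition face_injective (E : lmodType R) : Prop :=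
  forall (S : {set 'I_n}) (y : 'I_n -> E),
  (forall i j, i \in S -> j \in S -> 'x_U_(j)%MM *: y i = 'x_U_(i)%MM *: y j) ->
  exists e, forall i, i \in S -> 'x_U_(i)%MM *: e = y i.

(** The functional e has to send a sum of x_i f i to the sum of the y i (f i). As F is regular, the
    relations between the x_i are generated by the Koszul ones, and the compatibility of the y i
    kills these; the partial functional then extends to F. *)
Lemma regular_face_injective (F : pmod n k) : regular F -> face_injective (kdual F).
Proof.
move=> rF S0 y hy.
have key N (S : {set 'I_n}) (f : 'I_n -> F) : #|S| = N -> S \subset S0 ->
    \sum_(i in S) 'x_U_(i)%MM *: f i = 0 -> \sum_(i in S) kdual_val (y i) (f i) = 0.
  elim: N S f => [|N IH] S f cS sS e.
    by move/eqP: cS; rewrite cards_eq0 => /eqP ->; rewrite big_set0.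
  have [i iS] : exists i, i \in S by apply/set0Pn; rewrite -card_gt0 cS.
  have subx j : j \in S -> j \in S0 by exact: (fintype.subsetP sS).
  (* The relation puts x_i f i, hence f i, in the ideal of the other variables; substituting its
     expression removes i from the relation. *)
  have /idlP[g eg] : f i \in idl (ones n) (S :\ i).
    apply: (regular_idl rF (i := i)); first by rewrite !inE eqxx.
    move: e; rewrite (big_setD1 i) //= => /eqP; rewrite addr_eq0 => /eqP ->.
    rewrite -sumrN; apply/idlP; exists (fun j => - f j); apply: eq_bigr => j _.
    by rewrite onesE mulm1n scalerN.
  have {}eg : f i = \sum_(j in S :\ i) 'x_U_(j)%MM *: g j.
    by rewrite eg; apply: eq_bigr => j _; rewrite onesE mulm1n.
  have e2 : \sum_(j in S :\ i) 'x_U_(j)%MM *: (f j + 'x_U_(i)%MM *: g j) = 0.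
    rewrite -[RHS]e [in RHS](big_setD1 i iS) /= eg scaler_sumr -big_split /=.
    by apply: eq_bigr => j _; rewrite scalerDr xactC addrC.
  have cS' : #|S :\ i| = N by move: cS; rewrite (cardsD1 i) iS => -[].
  have sS' : S :\ i \subset S0 by apply: fintype.subset_trans sS; exact: subD1set.
  rewrite -[RHS](IH _ _ cS' sS' e2) (big_setD1 i iS) /=.
  have -> : kdual_val (y i) (f i) = \sum_(j in S :\ i) kdual_val (y i) ('x_U_(j)%MM *: g j).
    rewrite eg; elim/big_rec2: _ => [|j u v _ <-]; first exact: kdual0.
    by rewrite kdualD.
  rewrite -big_split /=; apply: eq_bigr => j; rewrite inE => /andP[_ jS].
  by rewrite kdualD addrC -!kdualZE hy // subx.
pose G0 (p : kres F * k^o) := exists f : 'I_n -> F,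
  p.1 = \sum_(i in S0) 'x_U_(i)%MM *: f i /\ p.2 = \sum_(i in S0) kdual_val (y i) (f i).
have [||l hl] := @linear_extension _ _ _ G0.
- split=> [|c p q [f [h1 h2]] [g [h1' h2']]].
    exists (fun=> 0); split; rewrite big1 // => i _; [by rewrite scaler0|exact: kdual0].
  exists (fun i => c%:MP *: f i + g i); split; rewrite /= ?h1 ?h2 ?h1' ?h2'.
    rewrite kscaleE scaler_sumr -big_split /=; apply: eq_bigr => i _.
    by rewrite scalerDr cactC.
  rewrite scaler_sumr -big_split /=; apply: eq_bigr => i _.
  by rewrite kdual_lin.
- by move=> v [f [/= h ->]]; apply: (key _ S0) => //; rewrite -h.
have [e he] := kdual_of l; exists e => i iS; apply: kdual_eq => x.
rewrite kdualZE he; apply: hl; exists (fun j => if j == i then x else 0); split.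
  rewrite (bigD1 i) //= eqxx big1 ?addr0 // => j /andP[_ /negbTE ->].
  by rewrite scaler0.
rewrite (bigD1 i) //= eqxx big1 ?addr0 // => j /andP[_ /negbTE ->].
exact: kdual0.
Qed.

(* A maximal graded partial extension is total: if b is homogeneous, not in the
   domain D, with as many x_i as possible sending b to D, then
   (D : b) = (x_i, i in S). *)
Lemma face_injective_extend (A B : pmod n k) (E : lmodType R) (f : pmor A B)
    (phi : {linear A -> E}) : face_injective E -> injective f ->
  exists psi : {linear B -> E}, forall a, psi (f a) = phi a.
Proof.
move=> iE fI.
pose Q (G : set (B * E)) := [/\ lin_closed (G : B * E -> Prop), forall v, G (0, v) -> v = 0
  & forall b v, G (b, v) -> forall d, exists w, G (hcomp b d, w)].
pose G0 : set (B * E) := fun p => exists a, p = (f a, phi a).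
have [||G [[cG fG gG] sG mG]] := @zorn_above _ Q G0.
- split=> [|v [a [/esym e ->]]|b v [a [-> _]] d].
  + split=> [|r _ _ [a ->] [a' ->]]; first by exists 0; rewrite !raddf0.
    by exists (r *: a + a'); rewrite !linearP.
  + by rewrite (_ : a = 0) ?raddf0 //; apply: fI; rewrite e raddf0.
  + by exists (phi (hcomp a d)), (hcomp a d); rewrite pmor_hcomp.
- move=> H [A0 HA0] HQ tH; split=> [|v [X HX Xv]|b v [X HX Xv] d].
  + split; first by exists A0 => //; case: (HQ _ HA0) => [[]].
    move=> a x y [X HX Xx] [Y HY Yy].
    by case: (tH _ _ HX HY) => XY; [exists Y|exists X] => //;
      case: (HQ _ HY) => cY _ _; case: (HQ _ HX) => cX _ _;
      [apply: (proj2 cY) => //|apply: (proj2 cX) => //]; exact: XY.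
  + by case: (HQ _ HX) => _ h _; exact: h.
  + by case: (HQ _ HX) => _ _ h; have [w hw] := h _ _ Xv d; exists w, X.
have uG b v w : G (b, v) -> G (b, w) -> v = w.
  move=> h1 h2; apply/eqP; rewrite -subr_eq0; apply/eqP/fG.
  by have := lin_closedB cG h1 h2; congr (G (_, _)) => /=; rewrite subrr.
pose D (b : B) := exists v, G (b, v).
have DZ r b : D b -> D (r *: b).
  by move=> [v hv]; exists (r *: v); exact: (lin_closedZ cG r hv).
have D0 : D 0 by exists 0; exact: (proj1 cG).
have DD b b' : D b -> D b' -> D (b + b').
  by move=> [v hv] [w hw]; exists (v + w); exact: (lin_closedD cG hv hw).
suff tot b : D b.
  have [psi hpsi] := choice tot.
  have lp : linear psi.
    by move=> a x y; apply: uG (hpsi _) _; exact: (proj2 cG a (x, psi x) (y, psi y)).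
  pose lin := GRing.isLinear.Build _ _ _ _ psi lp.
  pose Psi : {linear B -> E} := HB.pack psi lin.
  by exists Psi => a; apply: uG (hpsi _) _; apply: sG; exists a.
apply: contrapT => nb.
have [b0 [d0 [hb0 nb0]]] : exists b' d, pm_comp B d b' /\ ~ D b'.
  apply: contrapT => h; apply: nb; rewrite [b]hsuppE; apply: big_ind => // d _.
  by apply: contrapT => h'; apply: h; exists (hcomp b d), d; split=> //; exact: hcompP.
pose SS (b : B) : {set 'I_n} := [set i | `[< D ('x_U_(i)%MM *: b) >]].
pose P (m : nat) := `[< exists b d, [/\ pm_comp B d b, ~ D b & #|SS b| = m] >].
have exP : exists m, P m by exists #|SS b0|; apply/asboolP; exists b0, d0.
have bnd m : P m -> (m <= n)%N.
  by move=> /asboolP[b2 [d2 [_ _ <-]]]; rewrite -[n in (_ <= n)%N]card_ord max_card.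
have [m /asboolP[b1 [d1 [hb nb1 cS]]] mx] := ex_maxnP exP bnd.
pose S := SS b1.
have SP i : reflect (D ('x_U_(i)%MM *: b1)) (i \in S) by rewrite inE; exact: asboolP.
(* If a variable x_i with i outside S sent some x^l b1 not in D into D, that element would be sent
   to D by x_i and by all of S, against the maximality of S. *)
have nS (l : 'X_{1..n}) : (forall i, i \in S -> l i = 0%N) -> ~ D ('x_l *: b1).
  move: l; apply: mnm_ind => [_|i l IH hl]; first by rewrite xact0.
  have iS : i \notin S by apply/negP => /hl; rewrite mnmDE mnm1E eqxx addn1.
  have {}IH : ~ D ('x_l *: b1).
    by apply: IH => j /hl; rewrite mnmDE => /eqP; rewrite addn_eq0 => /andP[/eqP].
  rewrite addmC xactD => hD.
  have sub : i |: S \subset SS ('x_l *: b1).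
    apply/fintype.subsetP => j; rewrite in_setU1 [in X in _ -> X]inE => /orP[/eqP ->|/SP h].
      exact/asboolP.
    by apply/asboolP; rewrite xactC; exact: DZ.
  have := subset_leq_card sub; rewrite cardsU1 iS cS add1n ltnNge => /negP; apply.
  by apply: mx; apply/asboolP; exists ('x_l *: b1), (d1 + mdegZ l); split=> //; exact: comp_x.
have /choice[y hy] i : exists y, i \in S -> G ('x_U_(i)%MM *: b1, y).
  by have [/SP[y hy]|_] := boolP (i \in S); [exists y|exists 0].
have [i j iS jS|e he] := iE S y.
  apply: uG (lin_closedZ cG 'x_U_(j)%MM (hy i iS)) _.
  have := lin_closedZ cG 'x_U_(i)%MM (hy j jS); congr (G (_, _)).
  by rewrite /= xactC.
have Gx l : D ('x_l *: b1) -> G ('x_l *: b1, 'x_l *: e).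
  move=> hD; have [i iS li] : exists2 i, i \in S & l i != 0%N.
    apply: contrapT => h; apply: (nS l) hD => i iS; apply/eqP; apply: contraT => li.
    by case: h; exists i.
  have le : (U_(i) <= l)%MM.
    by apply/mnm_lepP => j; rewrite mnm1E; case: eqP => [<-|_] //=; rewrite lt0n.
  rewrite -(submK le) !xactD he //.
  exact: (lin_closedZ cG 'x_(l - U_(i))%MM (hy i iS)).
(* D is graded and distinct monomials have distinct degrees, so every monomial term of r already
   sends b1 into D. *)
have Gr r : D (r *: b1) -> G (r *: b1, r *: e).
  move=> [w hw]; rewrite [r]mpolyE !scaler_suml big_seq [X in (_, X)]big_seq.
  apply: (big_ind2 (fun b v => G (b, v))); first exact: (proj1 cG).
    by move=> b2 v b' v' h h'; exact: (lin_closedD cG h h').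
  move=> l hl; rewrite -mul_mpolyC -!scalerA.
  have hD : D ('x_l *: b1); last exact: (lin_closedZ cG (r@_l)%:MP (Gx l hD)).
  have [v hv] := gG _ _ hw (mdegZ l + d1).
  rewrite (hcomp_scale1 r l hb) in hv.
  have -> : 'x_l *: b1 = (r@_l)^-1%:MP *: (r@_l *: 'x_l *: b1).
    by rewrite -mul_mpolyC !scalerA mulrA -mpolyCM mulVf ?mpolyC1 ?mul1r // -mcoeff_msupp.
  by apply: DZ; exists v.
pose H : set (B * E) := fun p => exists g v r, G (g, v) /\ p = (g + r *: b1, v + r *: e).
have GH : (G `<=` H)%classic.
  by move=> [g v] hg; exists g, v, 0; rewrite !scale0r !addr0.
apply: nb1; exists e; apply: (mG H GH).
  split=> [|v [g [w [r [hg [e1 ->]]]]]|b' v [g [w [r [hg [-> _]]]]] d].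
  - split; first exact/GH/(proj1 cG).
    move=> a _ _ [g [v [r [hg ->]]]] [g' [v' [r' [hg' ->]]]].
    exists (a *: g + g'), (a *: v + v'), (a * r + r'); split; first exact: (proj2 cG _ _ _ hg hg').
    by congr (_, _); rewrite /= scalerDr scalerDl scalerA addrACA.
  - apply: fG; have /Gr h : D (r *: b1).
      have -> : r *: b1 = (-1) *: g by rewrite scaleN1r; apply/eqP; rewrite -addr_eq0 addrC -e1.
      by apply: DZ; exists w.
    by have := lin_closedD cG hg h; congr (G (_, _)); rewrite /= -e1.
  - have [w' hw'] := gG _ _ hg d.
    rewrite hcompD (hcomp_scale r d hb).
    by eexists; exists (hcomp g d), w'; eexists; split.
by exists 0, 0, 1; split; [exact: (proj1 cG)|rewrite !scale1r !add0r].
Qed.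

(** If w in F (x) A is nonzero, some k-linear l has l w nonzero. By adjunction l is a linear map
    from A to the dual of F; extended to B, it gives a functional on F (x) B whose restriction is l,
    so w is not killed. *)
Lemma regular_flat (F : pmod n k) : regular F -> flat F.
Proof.
move=> rF A B C f g fI ex sg; split; last 2 first.
- exact: tens_map_exact.
- exact: tens_map_surj.
have [T hT] := tens_mapP F f.
suff T0 w : T w = 0 -> w = 0.
  move=> x y; rewrite -!hT => e; apply/eqP; rewrite -subr_eq0; apply/eqP/T0.
  by rewrite raddfB /= e subrr.
move=> Tw; apply/eqP; apply: contraT => /kres_separates[l lw].
have phiE a : exists v : kdual F, forall u, kdual_val v u = l (tens u a).
  have la : linear (fun u : kres F => l (tens (u : F) a) : k^o).
    by move=> c x y; rewrite tensDl kscaleE tensZl (raddfD l) /= kres_linearZ.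
  pose lin := GRing.isLinear.Build _ _ _ _ _ la.
  pose L : {linear kres F -> k^o} := HB.pack (fun u : kres F => l (tens (u : F) a) : k^o) lin.
  exact: (kdual_of L).
have [phi hphi] := choice phiE.
have lphi : linear phi.
  move=> r a a'; apply: kdual_eq => u; rewrite kdualDE kdualZE !hphi tensDr tensZr -tensZl.
  exact: (raddfD l).
pose lin := GRing.isLinear.Build _ _ _ _ phi lphi.
pose Phi : {linear A -> kdual F} := HB.pack phi lin.
have [psi hpsi] := face_injective_extend Phi (regular_face_injective rF) fI.
(* [tens_lift] produces R-linear maps, so the k-linear functional u (x) b |-> psi b u is obtained
   from an R-linear map into the dual of R, evaluated at 1. *)
have etaE u b : exists v : kdual R^o, forall r, kdual_val v r = kdual_val (psi b) (r *: u).
  have la : linear (fun r : kres R^o => kdual_val (psi b) ((r : R) *: u) : k^o).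
    by move=> c x y; rewrite kscaleE scalerDl -scalerA kdual_lin.
  pose lin' := GRing.isLinear.Build _ _ _ _ _ la.
  pose L : {linear kres R^o -> k^o} :=
    HB.pack (fun r : kres R^o => kdual_val (psi b) ((r : R) *: u) : k^o) lin'.
  exact: (kdual_of L).
pose eta u b := sval (cid (etaE u b)).
have hE u b r : kdual_val (eta u b) r = kdual_val (psi b) (r *: u) := svalP (cid (etaE u b)) r.
have [||||L hL] := @tens_lift R F B (kdual R^o) eta.
- by move=> u u' b; apply: kdual_eq => r; rewrite kdualDE !hE scalerDr kdualD.
- by move=> u b b'; apply: kdual_eq => r; rewrite kdualDE !hE raddfD kdualDE.
- move=> r u b; apply: kdual_eq => s; rewrite kdualZE !hE scalerA.
  by congr (kdual_val _ (_ *: _)); rewrite mulrC.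
- move=> r u b; apply: kdual_eq => s; rewrite kdualZE !hE linearZ_LR kdualZE scalerA.
  by [].
have LT x : kdual_val (L (T x)) (1 : R) = l x.
  move: x; apply: tens_ind => [|x y hx hy|u a].
  - by rewrite !raddf0.
  - by rewrite (raddfD T) (raddfD L) (raddfD l) kdualDE hx hy.
  - by rewrite hT tens_mapE hL hE scale1r hpsi hphi.
by move: lw; rewrite -LT Tw raddf0 eqxx.
Qed.
End Extension.

(** * Divisible submodules *)

Ltac deglia := apply/rowP => ?; rewrite !mxE; dlia.

Section Divisible.
Variables (n : nat) (k : fieldType).
Local Notation deg := 'rV[int]_n.
Local Notation R := {mpoly k[n]}.
Local Notation "''x_' m" := ('X_[k, m] : R) (at level 2, m at level 2).
Local Notation ones := (ones n).
Implicit Types (d e a : deg) (sigma rho S : {set 'I_n}) (c : 'X_{1..n}).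

Lemma Uones i : (U_(i) *+ ones i)%MM = U_(i)%MM :> 'X_{1..n}.
Proof. by rewrite onesE mulm1n. Qed.

Lemma mset0 : mset finset.set0 = 0%MM :> 'X_{1..n}.
Proof. by apply/mnmP => i; rewrite mnmE inE mnm0E. Qed.

Lemma msetU1 i sigma : i \notin sigma -> mset (i |: sigma) = (U_(i) + mset sigma)%MM.
Proof.
move=> iS; apply/mnmP => j; rewrite mnmDE mnm1E !mnmE in_setU1 eq_sym.
by case: eqP => [<-|_] //=; rewrite (negbTE iS).
Qed.

Lemma mulmnDl (l l' : 'X_{1..n}) N : ((l + l') *+ N = l *+ N + l' *+ N)%MM.
Proof. by apply/mnmP => i; rewrite !(mulmnE, mnmDE) mulnDl. Qed.

Lemma mulmnDr (l : 'X_{1..n}) N N' : (l *+ (N + N') = l *+ N + l *+ N')%MM.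
Proof. by apply/mnmP => i; rewrite !(mulmnE, mnmDE) mulnDr. Qed.

Lemma face_le sigma (m : 'X_{1..n}) : (forall i, i \notin sigma -> m i = 0%N) ->
  (m <= mset sigma *+ mdeg m)%MM.
Proof.
move=> hm; apply/mnm_lepP => i; rewrite mulmnE mnmE.
have [iS|/hm -> //] := boolP (i \in sigma).
by rewrite mul1n mdegE (bigD1 i) //= leq_addr.
Qed.

(* The image of Hom(R_sigma, F) -> F. *)
Definition divis (F : pmod n k) sigma d (u : F) : Prop := forall N, exists2 v,
  pm_comp F (d - mdegZ (mset sigma *+ N)%MM) v & u = 'x_(mset sigma *+ N)%MM *: v.

(* lim^1 of G_d <- G_(d - l) <- G_(d - 2 l) <- ... vanishes. *)
Definition tel (F : pmod n k) (G : deg -> F -> Prop) (l : 'X_{1..n}) : Prop :=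
  forall d (g : nat -> F), (forall m, G (d - mdegZ (l *+ m)%MM) (g m)) ->
  exists h : nat -> F, forall m,
    G (d - mdegZ (l *+ m)%MM) (h m) /\ h m - 'x_l *: h m.+1 = g m.

(** lim^1 is right exact and [gid G c rho] is a quotient of a finite sum of shifts of G: the system
    is solved coefficient by coefficient. *)
Lemma tel_gid (F : pmod n k) (G : deg -> F -> Prop) l c rho : tel G l -> tel (gid G c rho) l.
Proof.
move=> tG d w hw.
pose g m := sval (cid (hw m)); have hg m := svalP (cid (hw m)).
have /choice[h hh] j : exists h : nat -> F, j \in rho -> forall m,
    G (d - mdegZ (l *+ m)%MM - mdegZ (U_(j) *+ c j)%MM) (h m) /\ h m - 'x_l *: h m.+1 = g m j.
  have [jr|_] := boolP (j \in rho); last by exists (fun=> 0).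
  have [m|h hh] := tG (d - mdegZ (U_(j) *+ c j)%MM) (fun m => g m j).
    by rewrite addrAC; exact: (proj1 (hg m)).
  by exists h => _ m; rewrite addrAC.
exists (fun m => \sum_(j in rho) 'x_(U_(j) *+ c j)%MM *: h j m) => m; split.
  by exists (fun j => h j m); split=> // j /hh/(_ m)[].
rewrite (proj2 (hg m)) scaler_sumr -sumrB; apply: eq_bigr => j /hh/(_ m)[_].
by rewrite -/(g m) => <-; rewrite scalerBr [X in _ - X = _]xactC.
Qed.

Section OneModule.
Variable F : pmod n k.
Local Notation D := (divis (F := F)).
Implicit Types u v : F.

Lemma divis_comp sigma d u : D sigma d u -> pm_comp F d u.
Proof. by case/(_ 0%N) => v; rewrite mulm0n mdegZ0 subr0 xact0 => h ->. Qed.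

Lemma divis_set0 d u : pm_comp F d u -> D finset.set0 d u.
Proof.
move=> hu N; exists u; have -> : (mset finset.set0 *+ N)%MM = 0%MM :> 'X_{1..n}.
- by apply/mnmP => i; rewrite mulmnE mset0 mnm0E.
- by rewrite mdegZ0 subr0.
- by apply/mnmP => i; rewrite mulmnE mset0 mnm0E.
- by rewrite xact0.
Qed.

Lemma divis_submod sigma : graded_submod (D sigma).
Proof.
split=> [d N|d u v hu hv N|d a u hu N|d m u hu N].
- by exists 0; [exact: pm_comp0|rewrite scaler0].
- have [u' h1 ->] := hu N; have [v' h2 ->] := hv N.
  by exists (u' - v'); [exact: pm_compB|rewrite scalerBr].
- by have [u' h1 ->] := hu N; exists (a%:MP *: u'); [exact: comp_c|rewrite cactC].
- have [u' h1 ->] := hu N; exists ('x_m *: u'); last by rewrite xactC.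
  by rewrite addrAC; exact: comp_x.
Qed.

Lemma divis_U1 i sigma d u : i \notin sigma -> D (i |: sigma) d u -> D sigma d u.
Proof.
move=> iS hu N; have [v hv ->] := hu N.
move: hv; rewrite (msetU1 iS) mulmnDl mdegZD => hv.
exists ('x_(U_(i) *+ N)%MM *: v); last by rewrite addmC xactD.
by move: (comp_x (U_(i) *+ N)%MM hv); rewrite opprD addrA addrAC subrK.
Qed.

Lemma seq_div l (u : nat -> F) : (forall m, u m = 'x_l *: u m.+1) ->
  forall N m, u m = 'x_(l *+ N)%MM *: u (m + N)%N.
Proof.
move=> e; elim=> [|N IH] m; first by rewrite mulm0n xact0 addn0.
by rewrite IH e mulmSr xactD addnS.
Qed.

Lemma divis_seq sigma d (u : nat -> F) :
  (forall m, pm_comp F (d - mdegZ (mset sigma *+ m)%MM) (u m)) ->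
  (forall m, u m = 'x_(mset sigma) *: u m.+1) -> D sigma d (u 0%N).
Proof. by move=> hu e N; exists (u N) => //; rewrite (seq_div e N 0). Qed.

(** u 0 is x_i^N u N, and u N is divisible by x_sigma^N: the N-th term supplies the N-th
    quotient. *)
Lemma divis_step i sigma d (u : nat -> F) : i \notin sigma ->
  (forall m, D sigma (d - mdegZ (U_(i) *+ m)%MM) (u m)) ->
  (forall m, u m = 'x_U_(i)%MM *: u m.+1) -> D (i |: sigma) d (u 0%N).
Proof.
move=> iS hu e N; have [v hv ev] := hu N N.
exists v; first by rewrite (msetU1 iS) mulmnDl mdegZD opprD addrA.
by rewrite (seq_div e N 0) add0n ev (msetU1 iS) mulmnDl xactD.
Qed.

Section Regular.
Hypothesis rF : regular F.

(** Monomials act injectively, so the quotient of u by x^m is unique; it is therefore divisible by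
    x_sigma^K because u is divisible by high enough powers. *)
Lemma divis_x sigma d (m : 'X_{1..n}) u : (forall i, i \notin sigma -> m i = 0%N) -> D sigma d u ->
  exists2 v, D sigma (d - mdegZ m) v & u = 'x_m *: v.
Proof.
move=> hm hu; set N := mdeg m; have le := face_le hm; rewrite -/N in le.
have [w hw ew] := hu N; set q := (mset sigma *+ N - m)%MM.
have qE : (mset sigma *+ N)%MM = (m + q)%MM by rewrite addmC submK.
exists ('x_q *: w); last by rewrite -xactD -qE.
move=> K; have [w' hw' ew'] := hu (N + K)%N.
exists ('x_q *: w').
  move: (comp_x q hw'); rewrite mulmnDr qE !mdegZD !opprD; congr (pm_comp F _ _).
  by deglia.
apply: (regular_inj rF (m := m)); rewrite /= -!xactD -qE -ew ew' mulmnDr qE.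
by rewrite !xactD [X in _ = _ *: X]xactC.
Qed.

(** By regularity the quotients us m of u by x_sigma^m also lie in x_rho F, but their coefficients f
    m at x_i are compatible only modulo the other variables. lim^1 corrects them by a sequence z in
    the ideal of the other variables; then f 0 - z 0 is in D_sigma F, and rho loses i. *)
Lemma gid_divis sigma rho d u : tel (pm_comp F) (mset sigma) ->
  (forall i, i \in rho -> i \notin sigma) -> D sigma d u ->
  gid (pm_comp F) ones rho d u -> gid (D sigma) ones rho d u.
Proof.
move=> tF; have hF := graded_submod_comp F; have hD := divis_submod sigma.
set y := mset sigma; rewrite -/y in tF.
move: {2}#|rho| (erefl #|rho|) => N; elim: N rho u => [|N IH] rho u cS disj hu h.
  move/eqP: cS; rewrite cards_eq0 => /eqP S0; move: h; rewrite S0 => /gid_set0 ->.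
  by apply: gsub0; exact: gid_submod.
have [i iS] : exists i, i \in rho by apply/set0Pn; rewrite -card_gt0 cS.
have [us hus] := choice (fun N => let: ex_intro2 v h1 h2 := hu N in
   ex_intro (fun v => pm_comp F (d - mdegZ (y *+ N)%MM) v /\ u = 'x_(y *+ N)%MM *: v) v (conj h1 h2)).
have usS m : us m = 'x_y *: us m.+1.
  apply: (regular_inj rF (m := (y *+ m)%MM)); rewrite /= -xactD -mulmSr.
  by rewrite -(proj2 (hus m)) -(proj2 (hus m.+1)).
have u0 : u = us 0%N by have [_] := hus 0%N; rewrite mulm0n xact0.
have y0 j m : j \in rho -> (y *+ m)%MM j = 0%N.
  by move=> /disj; rewrite mulmnE mnmE => /negbTE ->.
have gus m : gid (pm_comp F) ones rho (d - mdegZ (y *+ m)%MM) (us m).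
  apply: (regular_x rF (m := (y *+ m)%MM)); [by move=> j /y0|by case: (hus m)|].
  by rewrite subrK -(proj2 (hus m)).
have /choice[f hf] m : exists f, pm_comp F (d - mdegZ (y *+ m)%MM - mdegZ U_(i)%MM) f /\
    gid (pm_comp F) ones (rho :\ i) (d - mdegZ (y *+ m)%MM) (us m - 'x_U_(i)%MM *: f).
  by have [f] := gid_split iS (gus m); rewrite Uones => h1 h2; exists f.
have gI := gid_submod hF ones (rho :\ i).
have [m|z hz] := tel_gid (c := ones) (rho := rho :\ i) tF
    (d := d - mdegZ U_(i)%MM) (g := fun m => f m - 'x_y *: f m.+1).
  apply: (rF (i := i)); rewrite ?inE ?eqxx //.
    apply: pm_compB; first by rewrite addrAC; exact: (proj1 (hf m)).
    move: (comp_x y (proj1 (hf m.+1))); rewrite mulmSr mdegZD.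
    by congr (pm_comp F _ _); deglia.
  rewrite addrAC subrK scalerBr.
  have -> : 'x_U_(i)%MM *: f m - 'x_U_(i)%MM *: ('x_y *: f m.+1) =
      - (us m - 'x_U_(i)%MM *: f m) + 'x_y *: (us m.+1 - 'x_U_(i)%MM *: f m.+1).
    by rewrite scalerBr -usS xactC opprB addrA subrK.
  apply: (gsubD gI); first by apply: (gsubN gI); exact: (proj2 (hf m)).
  move: (gsub_x gI y (proj2 (hf m.+1))); rewrite mulmSr mdegZD opprD.
  by rewrite addrA subrK.
pose f' m := f m - z m.
have hf' : D sigma (d - mdegZ U_(i)%MM) (f' 0%N).
  apply: divis_seq => m.
    apply: pm_compB; first by rewrite addrAC; exact: (proj1 (hf m)).
    by apply: gid_sub (proj1 (hz m)); exact: hF.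
  rewrite /f' -/y scalerBr; have e := proj2 (hz m).
  have -> : f m = z m - 'x_y *: z m.+1 + 'x_y *: f m.+1 by rewrite e subrK.
  by rewrite addrAC [z m - _ - _]addrAC subrr add0r addrC.
set x := 'x_U_(i)%MM.
have -> : u = x *: f' 0%N + (u - x *: f' 0%N) by rewrite addrC subrK.
have Dx : D sigma d (x *: f' 0%N) by rewrite -[d](subrK (mdegZ U_(i)%MM)); exact: (gsub_x hD U_(i)%MM hf').
apply: gsubD; first exact: gid_submod.
  by rewrite /x -Uones; apply: gid_gen => //; rewrite Uones.
apply: (@gid_mono _ _ _ _ hD _ (rho :\ i)); first exact: subD1set.
apply: IH.
- by move: cS; rewrite (cardsD1 i) iS => -[].
- by move=> j; rewrite inE => /andP[_ /disj].
- exact: (gsubB hD hu Dx).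
rewrite /f' scalerBr opprB addrCA u0; apply: (gsubD gI); last first.
  by have [_] := hf 0%N; rewrite mulm0n mdegZ0 subr0.
rewrite -[d](subrK (mdegZ U_(i)%MM)); apply: (gsub_x gI).
by have [] := hz 0%N; rewrite mulm0n mdegZ0 subr0.
Qed.

(** Dividing g m by x_sigma^m turns the system for x_i into one for x_t = x_i x_sigma, which is
    solvable in F. Its solution lies in D_sigma F automatically: N equations unrolled give h' m =
    x_t^N v + w with w in D_sigma F, so x_sigma^N divides h' m. *)
Lemma tel_divis i sigma : i \notin sigma -> tel (pm_comp F) (mset (i |: sigma)) ->
  tel (D sigma) U_(i)%MM.
Proof.
move=> iS tF d g hg; set y := mset sigma; set t := mset (i |: sigma) in tF.
have tE : t = (U_(i) + y)%MM by exact: msetU1.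
have hD := divis_submod sigma.
have /choice[g' hg'] m : exists g', D sigma (d - mdegZ (t *+ m)%MM) g' /\ g m = 'x_(y *+ m)%MM *: g'.
  have [|g' h1 h2] := divis_x (m := (y *+ m)%MM) _ (hg m).
    by move=> j js; rewrite mulmnE mnmE (negbTE js).
  by exists g'; rewrite tE mulmnDl mdegZD opprD addrA.
have [m|h' hh'] := tF d g'; first by apply: divis_comp (proj1 (hg' m)).
have approx N : forall m, exists w v, [/\ D sigma (d - mdegZ (t *+ m)%MM) w,
    pm_comp F (d - mdegZ (t *+ (m + N))%MM) v & h' m = 'x_(t *+ N)%MM *: v + w].
  elim: N => [|N IH] m.
    exists 0, (h' m); rewrite addn0 mulm0n xact0 addr0; split=> //; [exact: gsub0|exact: (proj1 (hh' m))].
  have [w [v [hw hv e]]] := IH m.+1.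
  exists (g' m + 'x_t *: w), v; split.
  - apply: (gsubD hD); first exact: (proj1 (hg' m)).
    by move: (gsub_x hD t hw); rewrite mulmSr mdegZD opprD addrA subrK.
  - by rewrite -addSnnS.
  - by rewrite -(proj2 (hh' m)) e scalerDr -xactD -mulmS addrCA subrK.
have hDh m : D sigma (d - mdegZ (t *+ m)%MM) (h' m).
  move=> N; have [w [v [hw hv ->]]] := approx N m; have [w' hw' ->] := hw N.
  exists ('x_(U_(i) *+ N)%MM *: v + w').
    apply: pm_compD => //; move: (comp_x (U_(i) *+ N)%MM hv).
    by rewrite mulmnDr (_ : t *+ N = U_(i) *+ N + y *+ N)%MM ?mdegZD; [rewrite -?/y; congr (pm_comp F _ _); deglia|rewrite tE mulmnDl].
  by rewrite scalerDr -xactD tE mulmnDl addmC.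
exists (fun m => 'x_(y *+ m)%MM *: h' m) => m; split.
  move: (gsub_x hD (y *+ m)%MM (hDh m)).
  by rewrite tE mulmnDl mdegZD opprD addrA subrK.
rewrite (proj2 (hg' m)) -(proj2 (hh' m)) scalerBr; congr (_ - _).
rewrite -!xactD tE mulmSr; congr ('X_[_] *: _).
by apply/mnmP => j; rewrite !mnmDE; lia.
Qed.

(** As d and a agree outside sigma, the exponents of [offspan] there are M - d + 1. Hence
    [regular_shrink] cancels the monomial x^(M - d) brought in by [push], and [gid_divis] moves the
    coefficients into D_sigma F. *)
Lemma offspan_divis sigma a d u : tel (pm_comp F) (mset sigma) ->
  (forall i, i \notin sigma -> d 0 i = a 0 i) -> D sigma d u -> offspan sigma a u ->
  gid (D sigma) ones (~: sigma) d u.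
Proof.
move=> tF da hu [M0 hM0]; apply: gid_divis => //; first by move=> i; rewrite inE.
have cu := divis_comp hu; pose M := updeg d M0.
have dM : ledeg d M by exact: ledeg_upl.
have := hM0 M (ledeg_upr _ _); rewrite (push1 _ cu) /xto dM => h.
apply: (regular_shrink rF (m := absm (M - d))) => //; rewrite absmK //.
apply: gid_eqc h => j; rewrite inE => /da e; rewrite !mnmDE; congr (_ + _)%N.
by rewrite !mnmE !mxE e.
Qed.
End Regular.
End OneModule.

Lemma pmor_divis (F M : pmod n k) (f : pmor F M) sigma d u :
  divis (F := F) sigma d u -> divis sigma d (f u).
Proof.
move=> hu N; have [v hv ->] := hu N; exists (f v); first exact: pmor_deg.
by rewrite linearZ_LR.
Qed.

Lemma pmor_gid_divis (F M : pmod n k) (f : pmor F M) sigma c rho d u :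
  gid (divis (F := F) sigma) c rho d u -> gid (divis (F := M) sigma) c rho d (f u).
Proof.
move=> [g [hg ->]]; exists (f \o g); split=> [j /hg h|]; first exact: pmor_divis.
by rewrite raddf_sum; apply: eq_bigr => j _; rewrite /= linearZ_LR.
Qed.
End Divisible.

(** * Bijectivity of the comparison map, by removing one variable at a time *)

Section Comparison.
Variables (n : nat) (k : fieldType) (F M : pmod n k) (Phi : pmor F M).
Local Notation deg := 'rV[int]_n.
Local Notation R := {mpoly k[n]}.
Local Notation "''x_' m" := ('X_[k, m] : R) (at level 2, m at level 2).
Local Notation ones := (ones n).
Local Notation DF := (divis (F := F)).
Local Notation DM := (divis (F := M)).
Implicit Types (d e : deg) (sigma rho : {set 'I_n}).

Hypotheses (rF : regular F) (rM : regular M).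
Hypotheses (tF : forall S, tel (pm_comp F) (mset S)) (tM : forall S, tel (pm_comp M) (mset S)).

(* Phi induces an isomorphism D_sigma F / x_rho -> D_sigma M / x_rho in degree d. *)
Definition iso_mod sigma rho d : Prop :=
  (forall u, DF sigma d u -> gid (DM sigma) ones rho d (Phi u) -> gid (DF sigma) ones rho d u) /\
  (forall v, DM sigma d v -> exists2 u, DF sigma d u & gid (DM sigma) ones rho d (v - Phi u)).

Lemma iterate (V : Type) (P : nat -> V -> Prop) (Q : nat -> V -> V -> Prop) u :
  P 0%N u -> (forall m v, P m v -> exists2 w, P m.+1 w & Q m v w) ->
  exists s : nat -> V, [/\ s 0%N = u, forall m, P m (s m) & forall m, Q m (s m) (s m.+1)].
Proof.
move=> Pu step.
have /choice[f hf] (p : nat * V) : exists w, P p.1 p.2 -> P p.1.+1 w /\ Q p.1 p.2 w.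
  have [hp|h] := pselect (P p.1 p.2); last by exists u.
  by have [w h1 h2] := step _ _ hp; exists w.
pose s := fix s m := if m is m'.+1 then f (m', s m') else u.
have sP m : P m (s m) by elim: m => [//|m IH]; case: (hf (m, s m) IH).
by exists s; split=> // m; case: (hf (m, s m) (sP m)).
Qed.

(** Monomials in the variables of sigma act invertibly on D_sigma N. Consequently
    [iso_mod sigma rho d] depends only on the coordinates of d outside sigma, as the next two lemmas
    record. *)
Lemma gid_divis_xK (N : pmod n k) sigma rho c d (m : 'X_{1..n}) (u : N) : regular N ->
  (forall i, i \notin sigma -> m i = 0%N) ->
  gid (divis (F := N) sigma) c rho (d + mdegZ m) ('x_m *: u) ->
  gid (divis (F := N) sigma) c rho d u.
Proof.
move=> rN hm [f [hf e]].
have /choice[f' hf'] j : exists v, j \in rho ->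
    divis (F := N) sigma (d - mdegZ (U_(j) *+ c j)%MM) v /\ f j = 'x_m *: v.
  have [jr|_] := boolP (j \in rho); last by exists 0.
  have [v hv ev] := divis_x rN hm (hf j jr); exists v => _; split=> //.
  by move: hv; rewrite addrAC addrK.
exists f'; split=> [j /hf'[] //|]; apply: (regular_inj rN (m := m)).
rewrite /= e scaler_sumr; apply: eq_bigr => j /hf'[_ ->].
by rewrite xactC.
Qed.

Lemma iso_mod_up sigma rho d (m : 'X_{1..n}) : (forall i, i \notin sigma -> m i = 0%N) ->
  iso_mod sigma rho d -> iso_mod sigma rho (d + mdegZ m).
Proof.
move=> hm [hi hs]; have hDF := divis_submod F sigma; have hDM := divis_submod M sigma.
have gF := gid_submod hDF ones rho; have gM := gid_submod hDM ones rho.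
split=> [u hu hPu|v hv].
  have [v hv e] := divis_x rF hm hu; rewrite addrK in hv.
  rewrite e; apply: (gsub_x gF); apply: hi => //.
  by apply: gid_divis_xK rM hm _; rewrite -linearZ_LR -e.
have [w hw e] := divis_x rM hm hv; rewrite addrK in hw.
have [u hu h] := hs w hw; exists ('x_m *: u); first exact: (gsub_x hDF).
by rewrite e linearZ_LR -scalerBr; exact: (gsub_x gM).
Qed.

Lemma iso_mod_down sigma rho d (m : 'X_{1..n}) : (forall i, i \notin sigma -> m i = 0%N) ->
  iso_mod sigma rho (d + mdegZ m) -> iso_mod sigma rho d.
Proof.
move=> hm [hi hs]; have hDF := divis_submod F sigma; have hDM := divis_submod M sigma.
have gM := gid_submod hDM ones rho.
split=> [u hu hPu|v hv].
  apply: (gid_divis_xK rF hm); apply: hi; first exact: (gsub_x hDF).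
  by rewrite linearZ_LR; exact: (gsub_x gM).
have [u hu h] := hs _ (gsub_x hDM m hv); have [w hw e] := divis_x rF hm hu.
rewrite addrK in hw; exists w => //; apply: (gid_divis_xK rM hm).
by rewrite scalerBr -linearZ_LR -e.
Qed.

Section Step.
Variables (i : 'I_n) (sigma rho : {set 'I_n}).
Hypotheses (is_ : i \notin sigma) (ir : i \notin rho).
Hypothesis disj : forall j, j \in rho -> j \notin sigma.
Hypothesis H1 : forall d, iso_mod (i |: sigma) rho d.
Hypothesis H2 : forall d, iso_mod sigma (i |: rho) d.

Let deg_S d m : d - mdegZ (U_(i) *+ m)%MM - mdegZ U_(i)%MM = d - mdegZ (U_(i) *+ m.+1)%MM.
Proof. by rewrite mulmSr mdegZD opprD addrA. Qed.

Let hDF := divis_submod F sigma.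
Let hDM := divis_submod M sigma.
Let gF := gid_submod hDF ones rho.
Let gM := gid_submod hDM ones rho.

Let disj1 j : j \in rho -> j \notin i |: sigma.
Proof.
move=> jr; rewrite in_setU1 negb_or disj // andbT.
by apply: contraNneq ir => <-.
Qed.

Let split_i (N : pmod n k) (G : deg -> N -> Prop) d u : gid G ones (i |: rho) d u ->
  exists2 v, G (d - mdegZ U_(i)%MM) v & gid G ones rho d (u - 'x_U_(i)%MM *: v).
Proof.
move=> /(gid_split (setU11 i rho))[v]; rewrite Uones setU1K // => h1 h2.
by exists v.
Qed.

(** By H2, u is x_i u1 modulo x_rho, and Phi u1 is again in x_rho D_sigma M because x_i cancels
    there. Iterating and correcting the errors by lim^1, u is modulo x_rho an element of D_sigma F
    that is also infinitely divisible by x_i, and H1 applies to it. *)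
Lemma iso_step_inj d u : DF sigma d u -> gid (DM sigma) ones rho d (Phi u) ->
  gid (DF sigma) ones rho d u.
Proof.
move=> hu hPu.
have [||us [us0 usP usQ]] := @iterate F
    (fun m u => DF sigma (d - mdegZ (U_(i) *+ m)%MM) u /\
       gid (DM sigma) ones rho (d - mdegZ (U_(i) *+ m)%MM) (Phi u))
    (fun m u v => gid (DF sigma) ones rho (d - mdegZ (U_(i) *+ m)%MM) (u - 'x_U_(i)%MM *: v)) u.
- by rewrite mulm0n mdegZ0 subr0.
- move=> m v [hv hPv]; set e := d - _ in hv hPv *.
  have /split_i[w hw hw'] : gid (DF sigma) ones (i |: rho) e v.
    by apply: (proj1 (H2 e)) => //; apply: gid_mono hPv => //; exact: subsetU1.
  exists w => //; rewrite -deg_S -/e; split=> //.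
  have hPw : DM sigma (e - mdegZ U_(i)%MM) (Phi w) by exact: pmor_divis.
  apply: gid_divis => //; apply: (rM ir); first exact: divis_comp hPw.
  rewrite subrK; apply: (@gid_weaken _ _ _ (DM sigma)) => [a x|]; first exact: divis_comp.
  have -> : 'x_U_(i)%MM *: Phi w = Phi v - Phi (v - 'x_U_(i)%MM *: w).
    by rewrite [X in _ - X]raddfB /= opprB addrC subrK linearZ_LR.
  by apply: (gsubB gM) => //; exact: pmor_gid_divis.
have [z hz] := tel_gid (c := ones) (rho := rho) (tel_divis rF is_ (@tF (i |: sigma))) usQ.
pose q m := us m - z m.
have hq : DF (i |: sigma) d (q 0%N).
  apply: divis_step => // m.
    by apply: (gsubB hDF); [case: (usP m)|apply: gid_sub (proj1 (hz m)); exact: hDF].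
  rewrite /q scalerBr; have e := proj2 (hz m).
  have -> : us m = z m - 'x_U_(i)%MM *: z m.+1 + 'x_U_(i)%MM *: us m.+1 by rewrite e subrK.
  by rewrite addrAC [z m - _ - _]addrAC subrr add0r addrC.
have hz0 : gid (DF sigma) ones rho d (z 0%N).
  by have [] := hz 0%N; rewrite mulm0n mdegZ0 subr0.
have -> : u = q 0%N + z 0%N by rewrite /q subrK us0.
apply: (gsubD gF) => //; apply: (@gid_weaken _ _ _ (DF (i |: sigma))).
  by move=> a x; exact: divis_U1.
apply: (proj1 (H1 d)) => //; apply: (gid_divis rM _ disj1) => //; first exact: pmor_divis.
apply: (@gid_weaken _ _ _ (DM sigma)) => [a x|]; first exact: divis_comp.
rewrite /q raddfB /= us0; apply: (gsubB gM) => //; exact: pmor_gid_divis.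
Qed.

(** By H2, v is Phi u0 + x_i v1 modulo x_rho, and v1 can be treated in the same way. What remains of
    v after all these terms is infinitely divisible by x_i, hence reached through H1. *)
Lemma iso_step_surj d v : DM sigma d v ->
  exists2 u, DF sigma d u & gid (DM sigma) ones rho d (v - Phi u).
Proof.
move=> hv.
have [||s [s0 sP sQ]] := @iterate (M * F)
    (fun m p => DM sigma (d - mdegZ (U_(i) *+ m)%MM) p.1)
    (fun m p p' => DF sigma (d - mdegZ (U_(i) *+ m)%MM) p'.2 /\
       gid (DM sigma) ones rho (d - mdegZ (U_(i) *+ m)%MM)
         (p.1 - Phi p'.2 - 'x_U_(i)%MM *: p'.1)) (v, 0).
- by rewrite mulm0n mdegZ0 subr0.
- move=> m [w x] /= hw; have [u hu /split_i[w' h1 h2]] := proj2 (H2 _) _ hw.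
  by exists (w', u) => //=; rewrite -deg_S.
(* The element of F chosen at stage m is stored in the pair of stage m + 1; the 0 in the initial
   pair is a filler. Below, h 0 stands for the sum of the series of the x_i^m us m, and z 0 for the
   accumulated errors. *)
pose vs m := (s m).1; pose us m := (s m.+1).2.
have husP m : DF sigma (d - mdegZ (U_(i) *+ m)%MM) (us m) := proj1 (sQ m).
have [h hh] := tel_divis rF is_ (@tF (i |: sigma)) husP.
have hw m : gid (DM sigma) ones rho (d - mdegZ (U_(i) *+ m)%MM)
    (vs m - Phi (us m) - 'x_U_(i)%MM *: vs m.+1) := proj2 (sQ m).
have [z hz] := tel_gid (c := ones) (rho := rho) (tel_divis rM is_ (@tM (i |: sigma))) hw.
pose q m := vs m - Phi (h m) - z m.
have hq : DM (i |: sigma) d (q 0%N).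
  apply: divis_step => // m.
    apply: (gsubB hDM); last by apply: gid_sub (proj1 (hz m)); exact: hDM.
    by apply: (gsubB hDM); [exact: sP|apply: pmor_divis; exact: (proj1 (hh m))].
  rewrite /q !scalerBr; have e := proj2 (hz m); have e' := proj2 (hh m).
  have e2 : z m = vs m - Phi (us m) - 'x_U_(i)%MM *: vs m.+1 + 'x_U_(i)%MM *: z m.+1.
    by rewrite -e subrK.
  rewrite e2 -e' raddfB /= linearZ_LR; set X := vs m - Phi (h m).
  have -> : vs m - (Phi (h m) - 'x_U_(i)%MM *: Phi (h m.+1)) = X + 'x_U_(i)%MM *: Phi (h m.+1).
    by rewrite opprB addrA addrAC.
  rewrite -[X + _ - _]addrA -[X + _ + _]addrA opprD addrA subrr add0r opprD opprB.
  by [].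
have [u' hu' hu2] := proj2 (H1 d) _ hq.
have hh0 : DF sigma d (h 0%N) by have [] := hh 0%N; rewrite mulm0n mdegZ0 subr0.
have hz0 : gid (DM sigma) ones rho d (z 0%N).
  by have [] := hz 0%N; rewrite mulm0n mdegZ0 subr0.
exists (h 0%N + u'); first by apply: (gsubD hDF) => //; exact: divis_U1 hu'.
have -> : v - Phi (h 0%N + u') = q 0%N - Phi u' + z 0%N.
  by rewrite /q /vs s0 raddfD /= opprD addrA [RHS]addrAC subrK.
apply: (gsubD gM) => //; apply: gid_weaken hu2 => a x; exact: divis_U1.
Qed.
End Step.

Lemma iso_mod_all sigma rho d : (forall j, j \in rho -> j \notin sigma) ->
  (forall tau e, iso_mod tau (~: tau) e) -> iso_mod sigma rho d.
Proof.
move=> + base; move: {2}#|~: (sigma :|: rho)| (erefl #|~: (sigma :|: rho)|) => N.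
elim: N sigma rho d => [|N IH] sigma rho d cN disj.
  have -> : rho = ~: sigma; last exact: base.
  move/eqP: cN; rewrite cards_eq0 => /eqP/setP h; apply/setP => j; rewrite inE.
  have := h j; rewrite !inE negb_or => /negbT; rewrite negb_and !negbK.
  by case: (boolP (j \in rho)) => [/disj -> //|_]; rewrite orbF => ->.
have [i] : exists i, i \in ~: (sigma :|: rho) by apply/set0Pn; rewrite -card_gt0 cN.
move=> iC; have cN' : #|~: (sigma :|: rho) :\ i| = N.
  by move: cN; rewrite (cardsD1 i) iC => -[].
move: iC; rewrite !inE negb_or => /andP[is_ ir].
have H1 e : iso_mod (i |: sigma) rho e.
  apply: IH => [|j jr]; last first.
    by rewrite in_setU1 negb_or disj // andbT; apply: contraNneq ir => <-.
  rewrite -cN'; congr #|pred_of_set _|; apply/setP => j; rewrite !inE !negb_or.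
  by rewrite andbA.
have H2 e : iso_mod sigma (i |: rho) e.
  apply: IH => [|j]; last by rewrite in_setU1 => /orP[/eqP -> //|/disj].
  rewrite -cN'; congr #|pred_of_set _|; apply/setP => j; rewrite !inE !negb_or.
  by rewrite andbCA.
split=> [u hu hP|v hv].
- exact: (@iso_step_inj i).
- exact: (@iso_step_surj i).
Qed.

Lemma pmor_bij_iso : (forall d, iso_mod finset.set0 finset.set0 d) -> pm_iso F M.
Proof.
move=> H.
have injd d u : pm_comp F d u -> Phi u = 0 -> u = 0.
  move=> hu e; apply: (@gid_set0 _ _ _ (DF finset.set0) ones d).
  apply: (proj1 (H d)); first exact: divis_set0.
  by rewrite e; apply: gsub0; apply: gid_submod; exact: divis_submod.
have surjd d v : pm_comp M d v -> exists2 u, pm_comp F d u & Phi u = v.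
  move=> hv; have [u hu /gid_set0/eqP] := proj2 (H d) v (divis_set0 hv).
  by rewrite subr_eq0 => /eqP ->; exists u => //; exact: divis_comp hu.
have inj u v : Phi u = Phi v -> u = v.
  move=> /eqP; rewrite -subr_eq0 -raddfB => /eqP e; apply/eqP; rewrite -subr_eq0; apply/eqP.
  rewrite [_ - _]hsuppE big1 // => d _; apply: (injd d); first exact: hcompP.
  by rewrite pmor_hcomp e hcomp0.
have sur v : exists u, Phi u = v.
  move: v; apply: homogeneous_ind => [|v w [x <-] [y <-]|d v hv].
  - by exists 0; rewrite raddf0.
  - by exists (x + y); rewrite raddfD.
  - by have [u _ <-] := surjd d v hv; exists u.
have [g hg] := choice sur.
have lg : linear g by move=> r x y; apply: inj; rewrite linearP !hg.
pose lin := GRing.isLinear.Build _ _ _ _ g lg.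
pose G : {linear M -> F} := HB.pack g lin.
have hG d v : pm_comp M d v -> pm_comp F d (G v).
  move=> hv; have [u hu e] := surjd d v hv.
  by rewrite (_ : G v = u) //; apply: inj; rewrite [LHS]hg.
by exists Phi, (PMor hG); split=> [u|v]; [apply: inj; exact: hg|exact: hg].
Qed.
End Comparison.

(** * Flat cotorsion modules *)

Section Pieces.
Variables (n : nat) (k : fieldType).
Local Notation deg := 'rV[int]_n.
Local Notation R := {mpoly k[n]}.
Local Notation "''x_' m" := ('X_[k, m] : R) (at level 2, m at level 2).
Local Notation ones := (ones n).

Lemma fd_deg0 (j : face_deg n) i : i \in fd_face j -> fd_deg j 0 i = 0.
Proof. by case: j => sigma a /= /forall_inP h /h /eqP. Qed.

Lemma face_deg_eq (j j' : face_deg n) : fd_face j = fd_face j' -> fd_deg j = fd_deg j' -> j = j'.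
Proof.
case: j => s a h; case: j' => s' a' h' /= es ea; case: _ / es in h' *; case: _ / ea in h' *.
by rewrite (bool_irrelevance h h').
Qed.

Lemma face_deg_ex (sigma : {set 'I_n}) (d : deg) : exists j : face_deg n,
  fd_face j = sigma /\ forall i, i \notin sigma -> fd_deg j 0 i = d 0 i.
Proof.
have h : [forall i in sigma, (\row_i (if i \in sigma then 0 else d 0 i) : deg) 0 i == 0].
  by apply/forall_inP => i is_; rewrite mxE is_.
by exists (FaceDeg h); split=> // i /negbTE h'; rewrite mxE h'.
Qed.

Lemma traced_mset_div (sigma : {set 'I_n}) (a : deg) (V : lmodType k) (N : pmod n k)
    (T : {linear kres N -> V}) d (u : N) (m : 'X_{1..n}) : traced sigma a T ->
  (forall i, i \notin sigma -> m i = 0%N) -> pm_comp N d u ->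
  exists2 v, pm_comp N (d - mdegZ m) v & u = 'x_m *: v.
Proof.
move=> tr hm hu; have [->|u0] := eqVneq u 0; first by exists 0; [exact: pm_comp0|rewrite scaler0].
have [i is_|v hv e] := @traced_onto _ _ _ _ _ _ _ tr (d - mdegZ m) (T u).
  by have := traced_supp tr hu u0 is_; rewrite !mxE (hm i is_); dlia.
exists v => //; apply: (traced_inj tr hu); last by rewrite (traced_x tr).
by move: (comp_x m hv); rewrite subrK.
Qed.

Lemma gprod_single (I : Type) (N : I -> pmod n k) j d (v : N j) : pm_comp (N j) d v ->
  exists x : pprod N, [/\ pm_comp (pprod N) d x, gprod_val x j = v &
    forall i, i <> j -> gprod_val x i = 0].
Proof.
move=> hv; pose w i : N i := if pselect (j = i) is left e then eq_rect j (fun i => pm_sort (N i)) v i e else 0.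
have hw i : pm_comp (N i) d (w i).
  rewrite /w; case: pselect => [e|_]; last exact: pm_comp0.
  by case: _ / e.
have [x hx ex] := gprod_hom hw; exists x; split=> // [|i ij]; rewrite ex /w.
  by case: pselect => // e; rewrite (Prop_irrelevance e erefl).
by case: pselect => // e; case: ij.
Qed.

Section Model.
Variable N : face_deg n -> pmod n k.
Variable V : face_deg n -> lmodType k.
Variable T : forall j, {linear kres (N j) -> V j}.
Hypothesis tr : forall j, traced (fd_face j) (fd_deg j) (T j).

Lemma pieces_regular : regular (pprod N).
Proof. by apply: pprod_regular => j; exact: traced_regular (tr j). Qed.

Lemma pieces_cotorsion : cotorsion (pprod N).
Proof.
move=> F /flat_regular rF; apply: Ext1_eq0_of => P a phi phi0.
exact: traced_pprod_extend tr (@res_surj _ _ _ P) (@res_exact0 _ _ _ P) (@res_exact _ _ _ P 0%N) rF phi0.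
Qed.

Lemma cotorsion_tel (F : pmod n k) S : cotorsion F -> tel (pm_comp F) (mset S).
Proof.
move=> cF d g hg; apply: (@telescope_solve n k S) => //; apply: cF.
have [T' hT'] := @traced_Rloc n k S; exact: regular_flat (traced_regular hT').
Qed.

(** If the component at l is nonzero, the face of l contains sigma, since that component is
    divisible by all powers of x_sigma, and its degree is at most d outside the face. Unless l = j,
    there is room at some i outside sigma, and x_i divides the component. [gid_divis] then provides
    coefficients in D_sigma. *)
Lemma piece_component_divis j d (u : pprod N) :
  divis (F := pprod N) (fd_face j) d u -> (forall i, i \notin fd_face j -> d 0 i = fd_deg j 0 i) ->
  gprod_val u j = 0 -> gid (divis (F := pprod N) (fd_face j)) ones (~: fd_face j) d u.
Proof.
move=> hu hd uj; set sigma := fd_face j in hu hd *.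
apply: (gid_divis pieces_regular) => //.
- exact: (@cotorsion_tel _ sigma pieces_cotorsion).
- by move=> i; rewrite inE.
apply: (gid_pprod (G := fun i => pm_comp (N i))) => // l.
have cu : pm_comp (N l) d (gprod_val u l) by exact: (divis_comp hu).
have [->|u0] := eqVneq (gprod_val u l) 0.
  by apply: gsub0; apply: gid_submod; exact: graded_submod_comp.
have supp := traced_supp (tr l) cu u0.
have sub i : i \in sigma -> i \in fd_face l.
  move=> is_; apply: contraT => il; move/eqP: u0; case.
  (* Lowering d i by this much gives a degree below that of l, outside the support. *)
  have [v hv ev] := hu (absz (d 0%R i - fd_deg l 0%R i)%R).+1.
  have -> : gprod_val u l = 'x_(mset sigma *+ (absz (d 0%R i - fd_deg l 0%R i)%R).+1)%MM *: gprod_val v l.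
    by rewrite {1}ev.
  rewrite (traced_out (tr l) il _ (hv l)) ?scaler0 //.
  by rewrite !mxE mulmnE mnmE is_; move: (d 0 i) (fd_deg l 0 i) => x y; lia.
have [i [is_ hi]] : exists i, i \notin sigma /\
    (i \notin fd_face l -> fd_deg l 0 i <= d 0 i - 1%N%:Z).
  apply: contrapT => h.
  have out i : i \notin sigma -> i \notin fd_face l /\ fd_deg l 0 i = d 0 i.
    move=> is_; have il : i \notin fd_face l.
      by apply/negP => il; apply: h; exists i; split=> //; rewrite il.
    split=> //; apply/eqP; apply: contrapT => /negP ne; apply: h; exists i; split=> // _.
    by move: ne (supp i il); dlia.
  have lj : l = j.
    apply: face_deg_eq.
      apply/setP => i; apply/idP/idP => [|/sub //].
      by apply: contraLR => /out[].
    apply/rowP => i; have [is_|is_] := boolP (i \in sigma).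
      by rewrite !fd_deg0 ?sub.
    by rewrite (proj2 (out i is_)) hd.
  by move: u0; rewrite lj uj eqxx.
have [v hv ->] := traced_div (tr l) (j := i) (c := 1) cu hi.
rewrite -(onesE i); apply: gid_gen; [exact: graded_submod_comp|by rewrite inE|].
by rewrite onesE.
Qed.

(* By offspan_divis, l j identifies (D_sigma F / p_sigma D_sigma F)_a with V j, where
   j = (sigma, a) and D_sigma F is the part of F divisible by x_sigma. *)
Lemma pieces_iso (F : pmod n k) (l : forall j, {linear kres F -> V j}) :
  regular F -> (forall S, tel (pm_comp F) (mset S)) ->
  (forall j, [/\ forall c, exists2 u : F, divis (F := F) (fd_face j) (fd_deg j) u & l j u = c,
      forall w, offspan (fd_face j) (fd_deg j) w -> l j w = 0
    & forall u, divis (F := F) (fd_face j) (fd_deg j) u -> l j u = 0 ->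
        offspan (fd_face j) (fd_deg j) u]) ->
  pm_iso F (pprod N).
Proof.
move=> rF tF hl; set M := pprod N.
have rM : regular M := pieces_regular.
have tM S : tel (pm_comp M) (mset S) := @cotorsion_tel _ S pieces_cotorsion.
have fE j : exists f : pmor F (N j), forall u, T j (f u) = l j u.
  by have [_ h _] := hl j; exact: (traced_hom (tr j) h).
pose f j := sval (cid (fE j)).
have hf j u : T j (f j u) = l j u := svalP (cid (fE j)) u.
have [i d u hu|g hg] := @pprod_into n k _ N F 0 (fun j => f j : {linear F -> N j}).
  by rewrite add0r; exact: pmor_deg.
have hPhi d u : pm_comp F d u -> pm_comp M d (g u).
  by move=> hu; rewrite -[d]add0r; exact: (pmor_deg g hu).
pose Phi : pmor F M := PMor (N := M) (pmor_fun := (pmor_fun g : {linear F -> M})) hPhi.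
have PhiE u j : gprod_val (Phi u) j = f j u by exact: hg.
apply: (@pmor_bij_iso _ _ _ _ Phi) => d; apply: (iso_mod_all rF rM tF tM) => [j|tau e].
  by rewrite inE.
(* Coordinates of e in sigma do not matter, so e is moved to the degree a of the piece j. There x_i
   times an element of degree a - e_i has component 0 at j for i outside sigma, so the component at
   j only depends on the class modulo p_sigma D_sigma. *)
have [j [<- {tau} ej]] := face_deg_ex tau e.
set sigma := fd_face j in ej *; set a := fd_deg j in ej.
have at_a : iso_mod Phi sigma (~: sigma) a.
  have [honto hoff hker] := hl j; split=> [u hu hPu|v hv].
    apply: (offspan_divis rF (a := a)); [exact: (@tF _)|by []|exact: hu|].
    apply: hker => //; rewrite -hf -PhiE.
    have [w [hw ->]] := hPu; rewrite gprod_bigE raddf_sum big1 // => i ic.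
    have hwi := divis_comp (hw i ic); rewrite inE in ic.
    rewrite [gprod_val _ j](_ : _ = 'x_(U_(i) *+ ones i)%MM *: gprod_val (w i) j) //.
    rewrite (traced_out (tr j) ic _ (hwi j)) ?scaler0 ?raddf0 //.
    by rewrite !mxE Uones mnm1E eqxx; dlia.
  have [u hu lu] := honto (T j (gprod_val v j)).
  exists u => //; apply: piece_component_divis => //.
    by apply: (gsubB (divis_submod _ _)) => //; exact: pmor_divis.
  have -> : gprod_val (v - Phi u) j = gprod_val v j - gprod_val (Phi u) j by [].
  rewrite PhiE; apply/eqP; rewrite subr_eq0; apply/eqP.
  apply: (traced_inj (tr j)); [exact: (divis_comp hv)|exact: pmor_deg (divis_comp hu)|].
  by rewrite hf lu.
have pos (x : deg) : exists m : 'X_{1..n},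
    (forall i, i \notin sigma -> m i = 0%N) /\ forall i, i \in sigma -> (m i)%:Z = (if (0 <= x 0 i)%R then x 0 i else 0).
  exists [multinom if i \in sigma then absz (if (0 <= x 0%R i)%R then x 0%R i else 0%R) else 0%N | i < n].
  by split=> i; rewrite mnmE; [move/negbTE ->|move=> ->; case: ifP => //; dlia].
(* p and q are the positive parts on sigma of e - a and a - e, so that e + q = a + p. *)
have [p [p0 p1]] := pos (e - a); have [q [q0 q1]] := pos (a - e).
apply: (iso_mod_down rF rM q0).
have -> : e + mdegZ q = a + mdegZ p; last exact: (iso_mod_up rF rM p0 at_a).
apply/rowP => i; rewrite !mxE; have [is_|is_] := boolP (i \in sigma); last first.
  by rewrite p0 // q0 // ej.
rewrite p1 // q1 // !mxE; do 2 case: ifP; dlia.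
Qed.
End Model.

(** * Uniqueness of the sets beta *)

Section Uniqueness.
Variables N N' : face_deg n -> pmod n k.
Variables B B' : face_deg n -> Type.
Variables (T : forall j, {linear kres (N j) -> {freeg {classic (B j)} / k}})
  (T' : forall j, {linear kres (N' j) -> {freeg {classic (B' j)} / k}}).
Hypothesis tr : forall j, traced (fd_face j) (fd_deg j) (T j).
Hypothesis tr' : forall j, traced (fd_face j) (fd_deg j) (T' j).

(** Each c is placed in component j, in degree a, sent through f and read off in component j. If the
    result is 0, f (x c) lies in p_sigma D_sigma by [piece_component_divis]; applying g, so does x
    c, whose component at j in degree a is then 0, that is c = 0. *)
Lemma pieces_injection j : pm_iso (pprod N) (pprod N') ->
  exists f : {linear {freeg {classic (B j)} / k} -> {freeg {classic (B' j)} / k}}, injective f.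
Proof.
move=> [f [g [fg gf]]]; set a := fd_deg j; set sigma := fd_face j.
have /choice[x hx] (c : {freeg {classic (B j)} / k}) : exists x : pprod N,
    [/\ pm_comp (pprod N) a x, T j (gprod_val x j) = c & forall i, i <> j -> gprod_val x i = 0].
  have [v hv vc] := traced_onto (tr j) c (d := a) (fun i _ => Order.POrderTheory.lexx (a 0 i)).
  by have [x [h1 h2 h3]] := gprod_single hv; exists x; rewrite h2.
have xD c : divis (F := pprod N) sigma a (x c).
  move=> K; have [h1 h2 h3] := hx c.
  have [|v hv ev] := traced_mset_div (m := (mset sigma *+ K)%MM) (tr j) _ (h1 j).
    by move=> i /negbTE is_; rewrite mulmnE mnmE is_.
  have [y [hy yj y0]] := gprod_single hv; exists y => //.
  apply: gprod_eq => i.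
  have -> : gprod_val ('x_(mset sigma *+ K)%MM *: y) i = 'x_(mset sigma *+ K)%MM *: gprod_val y i by [].
  have [-> |ij] := pselect (i = j); first by rewrite yj.
  by rewrite y0 // h3 // scaler0.
pose phi c := T' j (gprod_val (f (x c)) j).
have lphi : linear phi.
  move=> r c c'.
  have e : x (r *: c + c') = r%:MP_[n] *: x c + x c'.
    have [h1 h2 h3] := hx c; have [h1' h2' h3'] := hx c'.
    have [h1'' h2'' h3''] := hx (r *: c + c').
    apply: gprod_eq => i.
    have -> : gprod_val (r%:MP_[n] *: x c + x c') i = r%:MP_[n] *: gprod_val (x c) i + gprod_val (x c') i by [].
    have [-> |ij] := pselect (i = j); last by rewrite h3 // h3' // h3'' // scaler0 addr0.
    apply: (traced_inj (tr j) (h1'' j)).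
      by apply: pm_compD; [apply: comp_c|]; [exact: h1|exact: h1'].
    by rewrite h2'' [RHS]raddfD /= kres_linearZ h2 h2'.
  rewrite /phi e raddfD /= linearZ_LR.
  transitivity (T' j (r%:MP_[n] *: gprod_val (f (x c)) j + gprod_val (f (x c')) j)) => //.
  by rewrite [LHS]raddfD /= kres_linearZ.
pose lin := GRing.isLinear.Build _ _ _ _ phi lphi.
pose L : {linear {freeg {classic (B j)} / k} -> {freeg {classic (B' j)} / k}} := HB.pack phi lin.
exists L; suff L0 c : L c = 0 -> c = 0.
  by move=> c c' e; apply/eqP; rewrite -subr_eq0; apply/eqP/L0; rewrite raddfB /= -[phi c]/(L c) e subrr.
move=> e; have [h1 h2 h3] := hx c.
have fD : divis (F := pprod N') sigma a (f (x c)) by exact: pmor_divis.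
have := piece_component_divis tr' fD (fun _ _ => erefl) (traced_inj (tr' j) (divis_comp fD j) (pm_comp0 _ _) _).
rewrite [T' j 0]raddf0 => /(_ e) /(pmor_gid_divis g); rewrite fg => -[w [hw ew]].
rewrite -h2 ew gprod_bigE raddf_sum big1 // => i is_.
have hwi := divis_comp (hw i is_); rewrite inE in is_.
rewrite [gprod_val _ j](_ : _ = 'x_(U_(i) *+ ones i)%MM *: gprod_val (w i) j) //.
rewrite (traced_out (tr j) is_ _ (hwi j)) ?scaler0 ?raddf0 //.
by rewrite !mxE Uones mnm1E eqxx; dlia.
Qed.
End Uniqueness.
End Pieces.

Theorem theorem2p3p4 (n : nat) (k : fieldType) (F : pmod n k) :
  ((flat F /\ cotorsion F) <->
     exists beta : face_deg n -> Type, pm_iso F (flat_cotorsion_model k beta)) /\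
  (forall beta beta' : face_deg n -> Type,
     pm_iso F (flat_cotorsion_model k beta) ->
     pm_iso F (flat_cotorsion_model k beta') ->
     forall j : face_deg n, exists h : beta j -> beta' j, bijective h).
Proof.
have piece (beta : face_deg n -> Type) j := traced_piece k j (beta j).
pose T beta j := sval (cid (piece beta j)).
have tr beta j : traced (fd_face j) (fd_deg j) (T beta j) := svalP (cid (piece beta j)).
split.
  split=> [[fF cF]|[beta iso]].
    have rF := flat_regular fF.
    have cD (j : face_deg n) : lin_closed (divis (F := F) (fd_face j) (fd_deg j) : kres F -> Prop).
      have hD := divis_submod F (fd_face j); split; first exact: (gsub0 hD).
      by move=> c x y hx hy; apply: (gsubD hD) => //; exact: (gsub_c hD).
    have basis j := @relative_basis k (kres F) _ _ (cD j)
      (offspan_closed F (fd_face j) (fd_deg j)).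
    pose B j := sval (cid (basis j)).
    have lE j := svalP (cid (basis j)).
    pose l j := sval (cid (lE j)); have hl j := svalP (cid (lE j)).
    exists B; apply: (pieces_iso (tr B) (l := l)) => // S.
    exact: cotorsion_tel.
  split; last exact: iso_cotorsion iso (pieces_cotorsion (tr beta)).
  exact: regular_flat (iso_regular iso (pieces_regular (tr beta))).
move=> beta beta' [f [g [fg gf]]] [f' [g' [fg' gf']]] j.
have iso : pm_iso (flat_cotorsion_model k beta) (flat_cotorsion_model k beta').
  exists (pmor_comp f' g), (pmor_comp f g').
  by split=> x; rewrite /= ?fg' ?gf ?fg ?gf'.
have iso' : pm_iso (flat_cotorsion_model k beta') (flat_cotorsion_model k beta).
  by case: iso => [p [q [h1 h2]]]; exists q, p.
have [p hp] := pieces_injection (tr beta) (tr beta') j iso.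
have [q hq] := pieces_injection (tr beta') (tr beta) j iso'.
exact: freeg_bijection hp hq.
Qed.
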